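(* Let $\varphi$ be an entire function and $0<p<\infty$. Then: (a) $S_\varphi(\mathcal{D})\subset \mathcal{D}^p_{p-1}$ if and only if $\varphi$ is of order less than $2$, or of order $2$ and finite type. (b) $S_\varphi(\mathcal{D}^p_{p-1})\subset \mathcal{D}$ if and only if $\varphi$ is constant.
   Context: $\mathbb{D}=\{z\in\mathbb{C}:|z|<1\}$, $\mathcal{H}ol(\mathbb{D})$ is the space of analytic functions in $\mathbb{D}$, and $dA(z)=\frac1\pi\,dx\,dy$. Superposition operator: for an entire function $\varphi$, $S_\varphi(f)=\varphi\circ f$ for $f\in\mathcal{H}ol(\mathbb{D})$. For $X,Y\subset\mathcal{H}ol(\mathbb{D})$, $S_\varphi(X)\subset Y$ means $\varphi\circ f\in Y$ for every $f\in X$. Spaces: for $0<p<\infty$ and $\alpha>-1$, $\mathcal{D}^p_\alpha$ is the set of $f\in\mathcal{H}ol(\mathbb{D})$ with $\int_{\mathbb{D}}(1-|z|^2)^\alpha|f'(z)|^p\,dA(z)<\infty$; $\mathcal{D}^p_{p-1}$ is the case $\alpha=p-1$. The classical Dirichlet space is $\mathcal{D}=\mathcal{D}^2_0$, i.e. the set of $f\in\mathcal{H}ol(\mathbb{D})$ with $\int_{\mathbb{D}}|f'(z)|^2\,dA(z)<\infty$. Order and type: with $M(r,\varphi)=\max_{|z|=r}|\varphi(z)|$, the order of a non-constant entire function $\varphi$ is $\rho=\limsup_{r\to\infty}\frac{\log\log M(r,\varphi)}{\log r}$, and if $0<\rho<\infty$ its type is $\tau=\limsup_{r\to\infty}\frac{\log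 M(r,\varphi)}{r^\rho}$. Constant functions are regarded as having order $0$. *)

(* Defs.v *)
From HB Require Import structures.
From mathcomp Require Import all_boot all_order all_algebra.
From mathcomp Require Import complex.
From mathcomp Require Import all_classical all_reals all_analysis.

Set Implicit Arguments.
Unset Strict Implicit.
Unset Printing Implicit Defensive.

Import Order.TTheory GRing.Theory Num.Theory.
Import numFieldNormedType.Exports.
Import ComplexField.Normc.

Local Open Scope classical_set_scope.
Local Open Scope ring_scope.
Local Open Scope complex_scope.

Section HolomorphicFunctions.
Variable R : realType.
Local Notation C := R[i].

Definition unit_disc : set C := [set z | normc z < 1].

(* Complex derivability: derivable over the numFieldType R[i], with increments
   h : R[i]; on an open set U this is analyticity. *)
Definition Hol (U : set C) : set (C -> C) :=
  [set f | forall z, U z -> derivable (f : C^o -> C^o) z 1].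

Definition entire (phi : C -> C) : Prop := Hol setT phi.

(* Functions on the disc are represented by total functions, of which only the
   restriction to the disc matters. *)
Definition dirichlet_integral (p alpha : R) (f : C -> C) : \bar R :=
  ((pi^-1)%:E *
   \int[lebesgue_measure \x lebesgue_measure]_(w in
          [set w : R * R | unit_disc (w.1 +i* w.2)])
     ((1 - normc (w.1 +i* w.2) ^+ 2) `^ alpha *
      normc (derive1 (f : C^o -> C^o) (w.1 +i* w.2)) `^ p)%:E)%E.

Definition dirichlet_type_space (p alpha : R) : set (C -> C) :=
  [set f | Hol unit_disc f /\ (dirichlet_integral p alpha f < +oo)%E].

Definition dirichlet_space : set (C -> C) := dirichlet_type_space 2 0.

Definition superposition (phi : C -> C) (f : C -> C) : C -> C := phi \o f.

Definition is_constant (phi : C -> C) : Prop := exists c, forall z, phi z = c.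

(* For r >= 0 and phi continuous the supremum is attained, by compactness of the
   circle. *)
Definition max_modulus (phi : C -> C) (r : R) : R :=
  sup [set normc (phi z) | z in [set z | normc z = r]].

(* ln is 0 on nonpositive reals; this is harmless in the limsup, since
   max_modulus phi r --> +oo for a non-constant entire phi. *)
Definition growth_order (phi : C -> C) : \bar R :=
  if `[< is_constant phi >] then 0%E
  else limf_esup (fun r : R => (ln (ln (max_modulus phi r)) / ln r)%:E) (pinfty_nbhs R).

(* Only meaningful when the order is in ]0, +oo[. *)
Definition growth_type (phi : C -> C) : \bar R :=
  limf_esup (fun r : R =>
    (ln (max_modulus phi r) / r `^ fine (growth_order phi))%:E) (pinfty_nbhs R).

End HolomorphicFunctions.

(* Main.v *)
(* The weighted spaces D^2_c with 0 <= c < 1 and c p <= 2 embed into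
   D^p_{p-1}: by Young's inequality and the integrability of (1 - |z|^2)^s for
   s > -1 when p < 2, by the pointwise bound on the derivative when p >= 2.

   If f is in D, summing the energy over dyadic annuli gives
   |f|^2 <= e log (1 / (1 - |z|)) + O(1) for every e > 0. When phi has order
   at most 2 and finite type if 2, so that |phi'| <= A exp (B |w|^2), this
   yields |(phi o f)'| = O((1 - |z|)^(- e) |f'|), hence phi o f is in D^2_c for
   every c > 0, and therefore in D^p_{p-1}.

   Conversely, functions in D^p_{p-1} have polynomial growth in 1 / (1 - |z|)
   and functions in D have square-root-logarithmic growth. Both necessary
   conditions follow by building f, as a gliding-hump sum of truncated
   logarithms (1 / n) sum_{k <= 2^n} z^k / k, whose values at points 1 - 2^-n
   are prescribed. A hump of height |w| costs |w|^2 / n in D but only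
   |w|^2 / n^2 in D^2_c with c > 0. In (a), if phi violates the growth
   condition there are w with |w|^2 / n small and |phi w| >= 2^(K n); in (b) a
   non-constant phi has, by Liouville, |phi w| >= sqrt (2 n) for some
   |w| = O(sqrt n), which is affordable in D^2_c, a subspace of D^p_{p-1}.

   Holomorphy is exploited through a Cauchy estimate for the derivative,
   derived from Goursat's theorem on rectangles after the substitution
   z = e^w. *)
Require Import Defs.
From HB Require Import structures.
From mathcomp Require Import all_boot all_order all_algebra.
From mathcomp Require Import complex.
From mathcomp Require Import all_classical all_reals all_analysis.
From mathcomp Require Import measurable_realfun ring lra.

Set Implicit Arguments.
Unset Strict Implicit.
Unset Printing Implicit Defensive.

Import Order.TTheory GRing.Theory Num.Theory.
Import numFieldNormedType.Exports.
Import ComplexField.Normc.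
Local Open Scope classical_set_scope.
Local Open Scope ring_scope.
Local Open Scope complex_scope.

(** * Complex derivatives in epsilon-delta form *)

(** The arbitrary [e] in the growth of the Dirichlet space is the crux of the sufficient condition.
    A mere O(log) bound for |f|^2 would turn a finite type of [phi] into one fixed power of 1 / (1 -
    |z|), possibly too large for the weight; with every [e > 0] at hand the power falls below any
    given [c].

    The exponent [p] enters only through the embedding of [D^2_c] and through one pointwise bound.
    All sums of functions are estimated in quadratic energies, where (x + y)^2 <= 2 x^2 + 2 y^2 is
    enough, so [p < 1], for which the triangle inequality fails in [D^p_{p-1}], is not a special
    case.

    In the converses the target value [w] is found before the index [n] of its hump: the price is
    |w|^2 / n or |w|^2 / n^2 for [w] of a size dictated by [phi], so [n] must be large against |w|,
    yet small enough for |phi w| to exceed what the target space allows at distance 2^-n from the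
    circle. Truncating the logarithm at degree 2^n suits exactly this distance: the hump is a
    polynomial, its singularity is resolved down to scale 2^-n, and at 1 - 2^-n only a constant
    factor is lost. *)

Section ComplexModulus.
Variable R : realType.
Local Notation C := R[i].
Implicit Types (x y : R) (z w : C).

Lemma normcD z w : normc (z + w) <= normc z + normc w.
Proof. exact: (@le_normcD R). Qed.

Lemma normc_opp z : normc (- z) = normc z.
Proof. exact: (@normcN R). Qed.

Lemma normcB z w : normc (z - w) <= normc z + normc w.
Proof. by rewrite -(normc_opp w) normcD. Qed.

Lemma normc_distC z w : normc (z - w) = normc (w - z).
Proof. by rewrite -normc_opp opprB. Qed.

Lemma normc_ge0 z : 0 <= normc z.
Proof. by case: z => a b /=; rewrite sqrtr_ge0. Qed.

Lemma normc_eq0 z : (normc z == 0) = (z == 0).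
Proof. by apply/eqP/eqP => [/eq0_normc //|->]; exact: normc0. Qed.

Lemma normc_gt0 z : (0 < normc z) = (z != 0).
Proof. by rewrite lt_def normc_eq0 normc_ge0 andbT. Qed.

Lemma normc_real x : normc x%:C = `|x|.
Proof. by rewrite /= expr0n addr0 sqrtr_sqr. Qed.

Lemma normr_normc z : `|z| = (normc z)%:C.
Proof. by case: z. Qed.

Lemma normcX z n : normc (z ^+ n) = normc z ^+ n.
Proof. by elim: n => [|n IH]; rewrite ?expr0 ?normc1 // !exprS normcM IH. Qed.

Lemma sqr_normc_def x y : normc (x +i* y) ^+ 2 = x ^+ 2 + y ^+ 2.
Proof. by rewrite /= sqr_sqrtr // addr_ge0 ?sqr_ge0. Qed.

Lemma normc_Re z : `|complex.Re z| <= normc z.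
Proof.
case: z => a b /=; rewrite -sqrtr_sqr ler_sqrt ?addr_ge0 ?sqr_ge0 //.
by rewrite lerDl sqr_ge0.
Qed.

Lemma normc_Im z : `|complex.Im z| <= normc z.
Proof.
case: z => a b /=; rewrite -sqrtr_sqr ler_sqrt ?addr_ge0 ?sqr_ge0 //.
by rewrite lerDr sqr_ge0.
Qed.

Lemma normc_ReIm z : normc z <= `|complex.Re z| + `|complex.Im z|.
Proof.
case: z => a b; rewrite -[leLHS]ger0_norm ?normc_ge0 // -ler_sqr ?nnegrE ?addr_ge0 //.
rewrite real_normK ?num_real // sqr_normc_def /= sqrrD !real_normK ?num_real //.
by rewrite lerD2r lerDl mulrn_wge0 ?mulr_ge0.
Qed.

Lemma normc_le_dist z w : normc z <= normc w + normc (z - w).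
Proof. by apply: le_trans (normcD _ _); rewrite addrC subrK. Qed.

Lemma normc_dist_trans z w u : normc (z - u) <= normc (z - w) + normc (w - u).
Proof. by apply: le_trans (normcD _ _); rewrite addrA subrK. Qed.

End ComplexModulus.

Section ComplexDerivative.
Variable R : realType.
Local Notation C := R[i].
Implicit Types (x y d e M : R) (z w h l : C) (f g : C -> C).

(** A product form with real [e] and [d], valid also at [h = 0]: estimates stay free of quotients
    and of radii in [R[i]], so that real arithmetic on moduli closes them. *)
Definition cdiff f z l := forall e, 0 < e -> exists2 d, 0 < d &
  forall h, normc h < d -> normc (f (z + h) - f z - l * h) <= e * normc h.

Let quotE f z h l : h != 0 ->
  l - h^-1 *: (f (h *: (1 : C^o) + z) - f z) = - ((f (z + h) - f z - l * h) * h^-1).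
Proof.
move=> h0; rewrite /GRing.scale /= mulr1 [h + z]addrC [in RHS]mulrBl mulfK // opprB.
by rewrite [h^-1 * _]mulrC.
Qed.

Lemma cdiff_cvg f z l : cdiff f z l <->
  h^-1 *: (((f : C^o -> C^o) \o shift z) (h *: (1 : C^o)) - f z) @[h --> (0:C^o)^'] --> (l : C^o).
Proof.
split=> [fl|fl e e0].
- apply/cvgrPdist_le => /= -[e e'] /[dup]; rewrite {1}ltcE /= => /andP[/eqP e'0 e0] _.
  subst e'; have [d d0 H] := fl _ e0.
  exists d%:C => /=; first by rewrite ltcR.
  move=> h /=; rewrite sub0r normrN normr_normc ltcR => hd h0.
  rewrite normr_normc lecR.
  have -> : l - h^-1 *: (f (h *: 1 + z) - f z) = - ((f (z + h) - f z - l * h) * h^-1).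
    exact: quotE.
  rewrite normc_opp normcM normcV ler_pdivrMr ?normc_gt0 //.
  exact: H.
- move/cvgrPdist_le: fl => /(_ e%:C); rewrite ltcR => /(_ e0) /= [[d d'] /=].
  rewrite ltcE/= => /andP[/eqP d'0 d0] H; subst d'.
  exists d => // h hd; have [->|h0] := eqVneq h 0.
    by rewrite addr0 mulr0 subrr subr0 normc0 mulr0.
  have := H h; rewrite /= sub0r normrN !normr_normc ltcR => /(_ hd h0).
  have -> : l - h^-1 *: (f (h *: 1 + z) - f z) = - ((f (z + h) - f z - l * h) * h^-1).
    exact: quotE.
  by rewrite lecR normc_opp normcM normcV ler_pdivrMr ?normc_gt0.
Qed.

Lemma cdiff_derivable f z l : cdiff f z l -> derivable (f : C^o -> C^o) z 1.
Proof. by move/cdiff_cvg => fl; apply/cvg_ex; exists l. Qed.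

Lemma cdiff_derive1 f z l : cdiff f z l -> derive1 (f : C^o -> C^o) z = l.
Proof.
move/cdiff_cvg => fl; rewrite derive1E; apply: (@cvg_lim C^o) => //.
Qed.

Lemma derivable_cdiff f z : derivable (f : C^o -> C^o) z 1 ->
  cdiff f z (derive1 (f : C^o -> C^o) z).
Proof. by move=> fz; apply/cdiff_cvg; rewrite derive1E. Qed.

End ComplexDerivative.

Section CDiffRules.
Variable R : realType.
Local Notation C := R[i].
Implicit Types (x y d e M : R) (z w h l m : C) (f g : C -> C).

Lemma cdiff_ext_near f g z l d : 0 < d -> (forall w, normc (w - z) < d -> f w = g w) ->
  cdiff f z l -> cdiff g z l.
Proof.
move=> d0 fg fl e e0; have [d' d'0 H] := fl _ e0.
exists (Num.min d d'); first by rewrite lt_min d0.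
move=> h; rewrite lt_min => /andP[hd hd'].
rewrite -!fg ?H //; first by rewrite subrr normc0.
by rewrite addrC addKr.
Qed.

Lemma cdiff_cst c z : cdiff (fun=> c) z 0.
Proof.
move=> e e0; exists 1 => // h _; rewrite /= subrr mul0r subr0 normc0.
by rewrite mulr_ge0 ?normc_ge0 // ltW.
Qed.

Lemma cdiff_id z : cdiff id z 1.
Proof.
move=> e e0; exists 1 => // h _; rewrite /= mul1r [z + h]addrC addrK subrr normc0.
by rewrite mulr_ge0 ?normc_ge0 // ltW.
Qed.

Lemma cdiffD f g z l m : cdiff f z l -> cdiff g z m -> cdiff (fun w => f w + g w) z (l + m).
Proof.
move=> fl gm e e0; have e20 : 0 < e / 2 by rewrite divr_gt0.
have [d d0 H] := fl _ e20; have [d' d'0 H'] := gm _ e20.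
exists (Num.min d d'); first by rewrite lt_min d0.
move=> h; rewrite lt_min => /andP[/H hd /H' hd'].
have -> : f (z + h) + g (z + h) - (f z + g z) - (l + m) * h =
  (f (z + h) - f z - l * h) + (g (z + h) - g z - m * h) by ring.
by apply: le_trans (normcD _ _) _; lra.
Qed.

Lemma cdiff_lip f z l : cdiff f z l -> exists2 d, 0 < d &
  forall h, normc h < d -> normc (f (z + h) - f z) <= (normc l + 1) * normc h.
Proof.
move=> fl; have [d d0 H] := fl 1 ltr01; exists d => // h /H.
by have := normc_le_dist (f (z + h) - f z) (l * h); rewrite normcM; lra.
Qed.

Lemma cdiff_continuous f z l : cdiff f z l -> forall e, 0 < e -> exists2 d, 0 < d &
  forall h, normc h < d -> normc (f (z + h) - f z) < e.
Proof.
move=> /cdiff_lip[d d0 H] e e0; have l1 : 0 < normc l + 1 by rewrite ltr_wpDl ?normc_ge0.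
exists (Num.min d (e / (normc l + 1))); first by rewrite lt_min d0 divr_gt0.
move=> h; rewrite lt_min => /andP[/H hd]; rewrite ltr_pdivlMr // => he.
by apply: le_lt_trans hd _; rewrite mulrC.
Qed.

Lemma cdiffM f g z l m : cdiff f z l -> cdiff g z m ->
  cdiff (fun w => f w * g w) z (l * g z + f z * m).
Proof.
move=> fl gm e e0.
set K := normc (g z) + normc (f z) + normc l + 1.
have K0 : 0 < K by rewrite ltr_wpDl // !addr_ge0 ?normc_ge0.
(* The cap at 1 bounds [normc (g (z + h))] by [normc (g z) + 1]; the three error terms then add up
   to at most [e' * K * normc h]. *)
pose e' := Num.min 1 (e / K / 2).
have e'0 : 0 < e' by rewrite lt_min ltr01 !divr_gt0.
have [d d0 H] := fl _ e'0; have [d' d'0 H'] := gm _ e'0.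
have [d'' d''0 H''] := cdiff_continuous gm e'0.
exists (Num.min d (Num.min d' d'')); first by rewrite !lt_min d0 d'0.
move=> h; rewrite !lt_min => /and3P[/H hd /H' hd' /H'' hd''].
have -> : f (z + h) * g (z + h) - f z * g z - (l * g z + f z * m) * h =
  (f (z + h) - f z - l * h) * g (z + h) + f z * (g (z + h) - g z - m * h)
  + l * h * (g (z + h) - g z) by ring.
have gh : normc (g (z + h)) <= normc (g z) + 1.
  apply: le_trans (normc_le_dist _ (g z)) _; rewrite lerD2l.
  by apply/ltW/(lt_le_trans hd''); rewrite ge_min lexx.
have e'K : e' * (K * 2) <= e by rewrite -ler_pdivlMr ?mulr_gt0 // invfM mulrA ge_min lexx orbT.
have h0 := normc_ge0 h.
apply: le_trans (normcD _ _) _; apply: le_trans (lerD (normcD _ _) (lexx _)) _.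
rewrite !normcM.
have := ler_pM (normc_ge0 _) (normc_ge0 _) hd gh.
have := ler_wpM2l (normc_ge0 (f z)) hd'.
have := ler_wpM2l (mulr_ge0 (normc_ge0 l) h0) (ltW hd'').
have := ler_wpM2r h0 e'K; have : 0 <= e' * normc h by rewrite mulr_ge0 // ltW.
rewrite /K; have := normc_ge0 (f z); have := normc_ge0 (g z); have := normc_ge0 l.
move: (normc (f z)) (normc (g z)) (normc l) (normc h) h0 => a b c n n0; nra.
Qed.

Lemma cdiffZ c f z l : cdiff f z l -> cdiff (fun w => c * f w) z (c * l).
Proof. by move=> fl; have := cdiffM (cdiff_cst c z) fl; rewrite mul0r add0r. Qed.

Lemma cdiffN f z l : cdiff f z l -> cdiff (fun w => - f w) z (- l).
Proof.
move=> /(cdiffZ (-1)); rewrite mulN1r; apply: (cdiff_ext_near ltr01) => w _.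
by rewrite mulN1r.
Qed.

Lemma cdiffB f g z l m : cdiff f z l -> cdiff g z m -> cdiff (fun w => f w - g w) z (l - m).
Proof. by move=> fl gm; apply: cdiffD => //; exact: cdiffN. Qed.

Lemma cdiff_comp f g z l m : cdiff f z l -> cdiff g (f z) m ->
  cdiff (fun w => g (f w)) z (m * l).
Proof.
move=> fl gm e e0.
set K := normc m + normc l + 1.
have K0 : 0 < K by rewrite ltr_wpDl // !addr_ge0 ?normc_ge0.
pose e' := e / K / 2.
have e'0 : 0 < e' by rewrite !divr_gt0.
have [d d0 H] := fl _ e'0; have [d' d'0 H'] := gm _ e'0.
have [d1 d10 H1] := cdiff_lip fl; have [d2 d20 H2] := cdiff_continuous fl d'0.
exists (Num.min d (Num.min d1 d2)); first by rewrite !lt_min d0 d10.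
move=> h; rewrite !lt_min => /and3P[/H hd /H1 hd1 /H2 hd2].
have := H' _ hd2; rewrite [f z + _]addrC subrK => gh.
have -> : g (f (z + h)) - g (f z) - m * l * h =
  g (f (z + h)) - g (f z) - m * (f (z + h) - f z) + m * (f (z + h) - f z - l * h) by ring.
apply: le_trans (normcD _ _) _; rewrite [normc (m * _)]normcM.
have h0 := normc_ge0 h.
have e'K : e' * (K * 2) = e by rewrite /e'; field; rewrite gt_eqF.
have := ler_wpM2l (ltW e'0) hd1; have := ler_wpM2l (normc_ge0 m) hd.
have -> : e * normc h = e' * (K * 2) * normc h by rewrite e'K.
rewrite /K; have := normc_ge0 m; have := normc_ge0 l.
have : 0 <= e' * normc h by rewrite mulr_ge0 // ltW.
move: gh; move: (normc _) (normc (f (z + h) - f z)) (normc l) (normc m) (normc h) h0 => a b c n k k0.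
move: (normc _) => u; nra.
Qed.

Lemma is_derive_eps (G : R -> R) (t r : R) : (forall e, 0 < e -> exists2 d, 0 < d &
    forall h : R, `|h| < d -> `|G (t + h) - G t - r * h| <= e * `|h|) ->
  is_derive t 1 G r.
Proof.
move=> H.
have c : h^-1 *: ((G \o shift t) (h *: (1 : R)) - G t) @[h --> 0^'] --> r.
  apply/cvgrPdist_le => /= e e0; have [d d0 {}H] := H _ e0.
  exists d => //= s /=; rewrite sub0r normrN => sd s0.
  have := H _ sd.
  have -> : r - s^-1 *: (G (s *: 1 + t) - G t) = - ((G (t + s) - G t - r * s) * s^-1).
    rewrite /GRing.scale /= mulr1 [s + t]addrC [in RHS]mulrBl mulfK // opprB.
    by rewrite [s^-1 * _]mulrC.
  by rewrite normrN normrM normfV ler_pdivrMr ?normr_gt0.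
apply: DeriveDef; first by apply/cvg_ex; exists r.
exact: cvg_lim.
Qed.

(** The multiplier [c] selects a real component: [c = 1] gives the real part of [f] and [c = - 'i]
    its imaginary part. This is the bridge to the mean value theorem and to continuity results for
    real functions. *)
Lemma cdiff_derive_line f z h l (t : R) : cdiff f (z + t%:C * h) l -> forall c,
  is_derive t 1 (fun s : R => complex.Re (c * f (z + s%:C * h))) (complex.Re (c * (l * h))).
Proof.
move=> fl c; apply: is_derive_eps => e e0.
have K0 : 0 < normc c * normc h + 1 by rewrite ltr_wpDl // mulr_ge0 ?normc_ge0.
have [d d0 H] := fl (e / (normc c * normc h + 1)) (divr_gt0 e0 K0).
exists (d / (normc h + 1)); first by rewrite divr_gt0 // ltr_wpDl ?normc_ge0.
move=> s; rewrite ltr_pdivlMr ?ltr_wpDl ?normc_ge0 // => sd.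
have sh : normc (s%:C * h) < d.
  rewrite normcM normc_real; apply: le_lt_trans sd; rewrite ler_wpM2l //.
  by rewrite lerDl.
have := H _ sh.
have -> : z + t%:C * h + s%:C * h = z + (t + s)%:C * h by rewrite rmorphD /=; ring.
set A := f _; set B := f _ => AB.
have -> : complex.Re (c * A) - complex.Re (c * B) - complex.Re (c * (l * h)) * s =
   complex.Re (c * (A - B - l * (s%:C * h))).
  clearbody A B; move: c A B l h {K0 H fl sd sh AB} => [c1 c2] [a1 a2] [b1 b2] [l1 l2] [h1 h2] /=.
  ring.
apply: le_trans (normc_Re _) _; rewrite normcM.
apply: le_trans (ler_wpM2l (normc_ge0 _) AB) _.
rewrite normcM normc_real.
have -> : normc c * (e / (normc c * normc h + 1) * (`|s| * normc h)) =
  e * `|s| * ((normc c * normc h) / (normc c * normc h + 1)) by ring.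
rewrite ler_piMr ?mulr_ge0 ?(ltW e0) // ler_pdivrMr // mul1r; lra.
Qed.

(** The mean value theorem fails for complex values, so it is applied to the real and to the
    imaginary part along the segment; adding the two costs the factor 2. *)
Lemma cdiff_mean_value f z h M :
  (forall t : R, 0 <= t <= 1 -> exists2 l, cdiff f (z + t%:C * h) l & normc l <= M) ->
  normc (f (z + h) - f z) <= 2 * M * normc h.
Proof.
move=> H.
have comp c : normc c <= 1 -> `|complex.Re (c * (f (z + h) - f z))| <= M * normc h.
  move=> c1.
  pose G (s : R) := complex.Re (c * f (z + s%:C * h)).
  pose dG (s : R) := complex.Re (c * (derive1 (f : C^o -> C^o) (z + s%:C * h) * h)).
  have Gd (s : R) : 0 <= s <= 1 -> is_derive s 1 G (dG s).
    by move=> /H[l fl _]; rewrite /dG (cdiff_derive1 fl); exact: cdiff_derive_line.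
  have dGM (s : R) : 0 <= s <= 1 -> `|dG s| <= M * normc h.
    move=> /H[l fl lM]; rewrite /dG (cdiff_derive1 fl).
    apply: le_trans (normc_Re _) _; rewrite !normcM.
    have := ler_wpM2r (normc_ge0 h) lM.
    have := ler_wpM2r (mulr_ge0 (normc_ge0 l) (normc_ge0 h)) c1; lra.
  have := @MVT_segment R G dG 0 1 ler01.
  case=> [s|| s].
  - by rewrite in_itv /= => /andP[s0 s1]; apply: Gd; rewrite !ltW.
  - by apply: derivable_within_continuous => s; rewrite in_itv /= => /Gd[].
  - rewrite in_itv /= subr0 mulr1 => /dGM sM GG.
    suff -> : complex.Re (c * (f (z + h) - f z)) = G 1 - G 0 by rewrite GG.
    rewrite /G rmorph1 rmorph0 mul1r mul0r addr0 mulrBr.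
    by case: (c * f (z + h)) (c * f z) => [? ?] [].
apply: le_trans (normc_ReIm _) _.
have := comp 1; rewrite normc1 lexx mul1r => /(_ isT).
have := comp (- 'i); rewrite normc_opp /= expr0n expr1n add0r sqrtr1 lexx => /(_ isT).
have -> : complex.Re (- 'i * (f (z + h) - f z)) = complex.Im (f (z + h) - f z).
  by case: (f (z + h) - f z) => a b /=; ring.
by lra.
Qed.

End CDiffRules.

(** * Goursat's theorem on rectangles *)

Section RectangleIntegral.
Variable R : realType.
Implicit Types (a b c k M x y : R) (g : R -> R).
Local Notation mu := (@lebesgue_measure R).

Definition segint a b g : R := \int[mu]_(x in `[a, b]) g x.

Lemma segint_integrable a b g : {within `[a, b], continuous g} ->
  mu.-integrable `[a, b] (EFin \o g).
Proof. by move=> cg; apply: continuous_compact_integrable => //; exact: segment_compact. Qed.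

Lemma segint_split a c b g : a <= c -> c <= b -> {within `[a, b], continuous g} ->
  segint a b g = segint a c g + segint c b g.
Proof.
move=> ac cb /segint_integrable ig; rewrite /segint.
have -> : [set` `[a, b]] = [set` `[a, c]] `|` [set` `]c, b]] :> set R.
  by apply: itv_bndbnd_setU; rewrite bnd_simp.
rewrite Rintegral_setU //=.
- congr (_ + _); apply: Rintegral_itv_obnd_cbnd.
  apply: integrableS ig => //; apply: subset_itvr; rewrite bnd_simp //.
- by rewrite -itv_bndbnd_setU // bnd_simp.
- apply/disj_setPS => x [] /=; rewrite !in_itv /= => /andP[_ xc] /andP[cx _].
  by move: (lt_le_trans cx xc); rewrite ltxx.
Qed.

Lemma segint_bound a b g k M : a <= b -> {within `[a, b], continuous g} ->
  (forall x, a <= x <= b -> `|g x - k| <= M) ->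
  `|segint a b g - k * (b - a)| <= M * (b - a).
Proof.
move=> ab /segint_integrable ig H.
have mab : measurable `[a, b]%classic by [].
have ik r : mu.-integrable `[a, b] (EFin \o (fun=> r)).
  by apply: segint_integrable => x; apply: cst_continuous.
have cstE r : \int[mu]_(x in `[a, b]) r = r * (b - a).
  rewrite Rintegral_cst //; have := @lebesgue_measure_itv R `[a, b]; rewrite /= lte_fin => ->.
  by case: ifPn => //; rewrite -leNgt => ba; rewrite (@le_anti _ _ a b) ?ab ?ba //= subrr.
have H1 : segint a b g <= (k + M) * (b - a).
  rewrite -cstE; apply: le_Rintegral => // x /=; rewrite in_itv /= => /H.
  by rewrite ler_norml; lra.
have H2 : (k - M) * (b - a) <= segint a b g.
  rewrite -cstE; apply: le_Rintegral => // x /=; rewrite in_itv /= => /H.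
  by rewrite ler_norml; lra.
by rewrite ler_norml; lra.
Qed.

Lemma segintB a b g1 g2 : {within `[a, b], continuous g1} ->
  {within `[a, b], continuous g2} ->
  segint a b (fun x => g1 x - g2 x) = segint a b g1 - segint a b g2.
Proof. by move=> /segint_integrable i1 /segint_integrable i2; exact: RintegralB. Qed.

Variables (P Q : R -> R -> R).

(** The form P dx + Q dy is differentiable at the point, and its closedness is the coefficient [b]
    shared by dP/dy and dQ/dx. The condition is pointwise, with no continuity of the derivatives, as
    in Goursat's argument. *)
Definition closed_form_at x0 y0 := exists a b c, forall e, 0 < e -> exists2 d, 0 < d &
  forall x y, `|x - x0| < d -> `|y - y0| < d ->
  `|P x y - P x0 y0 - a * (x - x0) - b * (y - y0)| <= e * (`|x - x0| + `|y - y0|) /\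
  `|Q x y - Q x0 y0 - b * (x - x0) - c * (y - y0)| <= e * (`|x - x0| + `|y - y0|).

Definition rectint x1 x2 y1 y2 :=
  segint x1 x2 (P ^~ y1) + segint y1 y2 (Q x2) -
  segint x1 x2 (P ^~ y2) - segint y1 y2 (Q x1).

Section Goursat.
Variables (X1 X2 Y1 Y2 : R).
Hypotheses (X12 : X1 <= X2) (Y12 : Y1 <= Y2).
Hypothesis closedPQ : forall x y, X1 <= x <= X2 -> Y1 <= y <= Y2 -> closed_form_at x y.

Lemma closed_form_continuousP y a b : Y1 <= y <= Y2 -> X1 <= a -> b <= X2 ->
  {within `[a, b], continuous (P ^~ y)}.
Proof.
move=> yY aX bX; apply: derivable_within_continuous => x; rewrite in_itv /= => /andP[ax xb].
have [|k [l [m H]]] := @closedPQ x y _ yY.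
  by rewrite (le_trans aX) // (le_trans xb).
suff : is_derive x 1 (P ^~ y) k by case.
apply: is_derive_eps => e /H[d d0 {}H]; exists d => // h hd.
have [] := H (x + h) y; rewrite ?[x + h]addrC ?addrK ?subrr ?normr0 //.
by rewrite mulr0 subr0 addr0.
Qed.

Lemma closed_form_continuousQ x a b : X1 <= x <= X2 -> Y1 <= a -> b <= Y2 ->
  {within `[a, b], continuous (Q x)}.
Proof.
move=> xX aY bY; apply: derivable_within_continuous => y; rewrite in_itv /= => /andP[ay yb].
have [|k [l [m H]]] := @closedPQ x y xX _.
  by rewrite (le_trans aY) // (le_trans yb).
suff : is_derive y 1 (Q x) m by case.
apply: is_derive_eps => e /H[d d0 {}H]; exists d => // h hd.
have [] := H x (y + h); rewrite ?[y + h]addrC ?addrK ?subrr ?normr0 //.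
by move=> _; rewrite mulr0 subr0 add0r.
Qed.

Lemma rectint_split x1 xm x2 y1 ym y2 :
  X1 <= x1 -> x1 <= xm -> xm <= x2 -> x2 <= X2 ->
  Y1 <= y1 -> y1 <= ym -> ym <= y2 -> y2 <= Y2 ->
  rectint x1 x2 y1 y2 = rectint x1 xm y1 ym + rectint xm x2 y1 ym +
                        rectint x1 xm ym y2 + rectint xm x2 ym y2.
Proof.
move=> h1 h2 h3 h4 v1 v2 v3 v4; rewrite /rectint.
rewrite (@segint_split x1 xm x2 (P ^~ y1)) //; last first.
  by apply: closed_form_continuousP => //; lra.
rewrite (@segint_split x1 xm x2 (P ^~ y2)) //; last first.
  by apply: closed_form_continuousP => //; lra.
rewrite (@segint_split y1 ym y2 (Q x1)) //; last first.
  by apply: closed_form_continuousQ => //; lra.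
rewrite (@segint_split y1 ym y2 (Q x2)) //; last first.
  by apply: closed_form_continuousQ => //; lra.
ring.
Qed.

(** Near the point the form is affine up to a small error, and a closed affine form integrates to
    zero around a rectangle: the two pairs of opposite sides contribute [b * (y1 - y2) * (x2 - x1)]
    and [b * (x2 - x1) * (y2 - y1)]. *)
Lemma rectint_small x0 y0 e : X1 <= x0 <= X2 -> Y1 <= y0 <= Y2 -> 0 < e ->
  exists2 d, 0 < d & forall x1 x2 y1 y2 s,
    X1 <= x1 -> x1 <= x0 -> x0 <= x2 -> x2 <= X2 ->
    Y1 <= y1 -> y1 <= y0 -> y0 <= y2 -> y2 <= Y2 ->
    x2 - x1 <= s -> y2 - y1 <= s -> s < d -> `|rectint x1 x2 y1 y2| <= e * s ^+ 2.
Proof.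
move=> x0X y0Y e0; have [a [b [c H]]] := closedPQ x0X y0Y.
(* Each coefficient errs by at most [e / 4 * s], the difference over opposite sides by [e / 2 * s],
   and the two pairs of sides of length at most [s] give [e * s ^+ 2]. *)
have e80 : 0 < e / 8 by rewrite divr_gt0.
have [d d0 {}H] := H _ e80; exists d => //.
move=> x1 x2 y1 y2 s h1 h2 h3 h4 v1 v2 v3 v4 xs ys sd.
have K x y : x1 <= x <= x2 -> y1 <= y <= y2 ->
  `|P x y - P x0 y0 - a * (x - x0) - b * (y - y0)| <= e / 4 * s /\
  `|Q x y - Q x0 y0 - b * (x - x0) - c * (y - y0)| <= e / 4 * s.
  move=> /andP[xl xr] /andP[yl yr].
  have xx : `|x - x0| <= s by rewrite ler_norml; move: xl xr h2 h3 xs; clear - closedPQ X12 Y12; lra.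
  have yy : `|y - y0| <= s by rewrite ler_norml; move: yl yr v2 v3 ys; clear - closedPQ X12 Y12; lra.
  have [A B] := H x y (le_lt_trans xx sd) (le_lt_trans yy sd).
  have : e / 8 * (`|x - x0| + `|y - y0|) <= e / 8 * (s + s).
    by rewrite ler_wpM2l ?(ltW e80) // lerD.
  by move=> D; split; [apply: le_trans A _|apply: le_trans B _]; move: D; clear - closedPQ X12 Y12; lra.
have x12 := le_trans h2 h3.
have y12 := le_trans v2 v3.
have cP y : y1 <= y <= y2 -> {within `[x1, x2], continuous (P ^~ y)}.
  by move=> /andP[yl yr]; apply: closed_form_continuousP; rewrite ?(le_trans v1 yl) ?(le_trans yr v4).
have cQ x : x1 <= x <= x2 -> {within `[y1, y2], continuous (Q x)}.
  by move=> /andP[xl xr]; apply: closed_form_continuousQ; rewrite ?(le_trans h1 xl) ?(le_trans xr h4).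
have y1r : y1 <= y1 <= y2 by rewrite lexx.
have y2r : y1 <= y2 <= y2 by rewrite lexx andbT.
have x1r : x1 <= x1 <= x2 by rewrite lexx.
have x2r : x1 <= x2 <= x2 by rewrite lexx andbT.
have -> : rectint x1 x2 y1 y2 = segint x1 x2 (fun x => P x y1 - P x y2) +
                                segint y1 y2 (fun y => Q x2 y - Q x1 y).
  rewrite segintB; [|exact: cP|exact: cP].
  by rewrite segintB; [|exact: cQ|exact: cQ]; rewrite /rectint; ring.
have BP : `|segint x1 x2 (fun x => P x y1 - P x y2) - b * (y1 - y2) * (x2 - x1)| <=
          e / 2 * s * (x2 - x1).
  apply: segint_bound => //; first by move=> z; apply: continuousB; apply: cP.
  move=> x xr; have [A _] := K _ _ xr y1r; have [B _] := K _ _ xr y2r.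
  move: A B; rewrite !ler_norml; clear - closedPQ X12 Y12; lra.
have BQ : `|segint y1 y2 (fun y => Q x2 y - Q x1 y) - b * (x2 - x1) * (y2 - y1)| <=
          e / 2 * s * (y2 - y1).
  apply: segint_bound => //; first by move=> z; apply: continuousB; apply: cQ.
  move=> y yr; have [_ A] := K _ _ x2r yr; have [_ B] := K _ _ x1r yr.
  move: A B; rewrite !ler_norml; clear - closedPQ X12 Y12; lra.
have s0 : 0 <= s by apply: le_trans xs; rewrite subr_ge0.
have es0 : 0 <= e / 2 * s by rewrite mulr_ge0 // divr_ge0 // ltW.
have := ler_wpM2l es0 xs; have := ler_wpM2l es0 ys.
move: BP BQ; rewrite expr2 !ler_norml.
move: (segint _ _ _) (segint _ _ _) => A B; clear - closedPQ X12 Y12; lra.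
Qed.

(** Repeated quartering: some quarter keeps at least a fourth of the integral, the nested quarters
    shrink to a point, and there [rectint_small] allows only half of the amount kept. *)
Lemma goursat : rectint X1 X2 Y1 Y2 = 0.
Proof.
apply/eqP; apply/negP => /negP J0.
set J := rectint X1 X2 Y1 Y2 in J0.
have Jp : 0 < `|J| by rewrite normr_gt0.
have [A AE] : exists A, A = X2 - X1 by exists (X2 - X1).
have [B BE] : exists B, B = Y2 - Y1 by exists (Y2 - Y1).
(* A state is a number of halvings together with a lower left corner. *)
pose S (q : nat * (R * R)) := [/\ X1 <= q.2.1, q.2.1 + A / 2 ^+ q.1 <= X2,
  Y1 <= q.2.2, q.2.2 + B / 2 ^+ q.1 <= Y2 &
  `|J| / 4 ^+ q.1 <= `|rectint q.2.1 (q.2.1 + A / 2 ^+ q.1) q.2.2 (q.2.2 + B / 2 ^+ q.1)|].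
(* Conditional on [S q], because [dependent_choice] asks for a successor of every state, admissible
   or not. *)
pose Rel q q' := S q -> [/\ S q', q'.1 = q.1.+1,
  q.2.1 <= q'.2.1 /\ q'.2.1 + A / 2 ^+ q'.1 <= q.2.1 + A / 2 ^+ q.1 &
  q.2.2 <= q'.2.2 /\ q'.2.2 + B / 2 ^+ q'.1 <= q.2.2 + B / 2 ^+ q.1].
have A0 : 0 <= A by rewrite AE subr_ge0.
have B0 : 0 <= B by rewrite BE subr_ge0.
have step q : {q' | Rel q q'}.
  apply: cid; have [Sq|nSq] := pselect (S q); last by exists q.
  case: q Sq => n [x y] /= Sq; have [/= x1 x2 y1 y2 JJ] := Sq.
  pose a := A / 2 ^+ n.+1; pose b := B / 2 ^+ n.+1.
  have aE : A / 2 ^+ n = a + a by rewrite /a exprS invfM; field; rewrite expf_neq0.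
  have bE : B / 2 ^+ n = b + b by rewrite /b exprS invfM; field; rewrite expf_neq0.
  have a0 : 0 <= a by rewrite divr_ge0 // exprn_ge0.
  have b0 : 0 <= b by rewrite divr_ge0 // exprn_ge0.
  have J4 : `|J| / 4 ^+ n = 4 * (`|J| / 4 ^+ n.+1).
    by rewrite exprS invfM; field; rewrite expf_neq0.
  rewrite aE in x2 JJ; rewrite bE in y2 JJ.
  have E : rectint x (x + (a + a)) y (y + (b + b)) = rectint x (x + a) y (y + b) +
      rectint (x + a) (x + a + a) y (y + b) + rectint x (x + a) (y + b) (y + b + b) +
      rectint (x + a) (x + a + a) (y + b) (y + b + b).
    by rewrite -[x + a + a]addrA -[y + b + b]addrA; apply: rectint_split; rewrite ?lerDl // ?lerD2l ?lerDl //; lra.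
  rewrite E J4 in JJ.
  have fin x' y' : `|J| / 4 ^+ n.+1 <= `|rectint x' (x' + a) y' (y' + b)| ->
    x <= x' <= x + a -> y <= y' <= y + b ->
    exists q', Rel (n, (x, y)) q'.
    move=> Jq /andP[xl xr] /andP[yl yr].
    have xe : x' + a <= x + (a + a) by rewrite addrA lerD2r.
    have ye : y' + b <= y + (b + b) by rewrite addrA lerD2r.
    exists (n.+1, (x', y')) => _; split => //=; rewrite /S /= -/a -/b ?aE ?bE.
    - split => //; [exact: le_trans xl|exact: le_trans xe x2|exact: le_trans yl|].
      exact: le_trans ye y2.
    - by split.
    - by split.
  have x_lo : x <= x <= x + a by rewrite lexx lerDl.
  have x_hi : x <= x + a <= x + a by rewrite lexx lerDl andbT.
  have y_lo : y <= y <= y + b by rewrite lexx lerDl.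
  have y_hi : y <= y + b <= y + b by rewrite lexx lerDl andbT.
  set K := `|J| / 4 ^+ n.+1 in fin JJ *; clearbody K.
  have := ler_normD (rectint x (x + a) y (y + b) + rectint (x + a) (x + a + a) y (y + b) +
     rectint x (x + a) (y + b) (y + b + b)) (rectint (x + a) (x + a + a) (y + b) (y + b + b)).
  have := ler_normD (rectint x (x + a) y (y + b) + rectint (x + a) (x + a + a) y (y + b))
     (rectint x (x + a) (y + b) (y + b + b)).
  have := ler_normD (rectint x (x + a) y (y + b)) (rectint (x + a) (x + a + a) y (y + b)).
  move=> N1 N2 N3.
  have [|L1] := leP K `|rectint x (x + a) y (y + b)|.
    by move=> /fin /(_ x_lo y_lo).
  have [|L2] := leP K `|rectint (x + a) (x + a + a) y (y + b)|.
    by move=> /fin /(_ x_hi y_lo).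
  have [|L3] := leP K `|rectint x (x + a) (y + b) (y + b + b)|.
    by move=> /fin /(_ x_lo y_hi).
  have [|L4] := leP K `|rectint (x + a) (x + a + a) (y + b) (y + b + b)|.
    by move=> /fin /(_ x_hi y_hi).
  exfalso; move: L1 L2 L3 L4 N1 N2 N3 JJ; clear - closedPQ X12 Y12; lra.
have [u [u0 uS]] := dependent_choice step (0%N, (X1, Y1)).
have Su n : S (u n) /\ (u n).1 = n.
  elim: n => [|n [Sn un]]; last by have [? -> _ _] := uS n Sn; rewrite un.
  by rewrite u0 /S /= !expr0 !divr1 AE BE ![_ + (_ - _)]addrC !subrK; split.
pose x n := (u n).2.1; pose y n := (u n).2.2.
have un n : (u n).1 = n by have [] := Su n.
have xS n : x n <= x n.+1 /\ x n.+1 + A / 2 ^+ n.+1 <= x n + A / 2 ^+ n.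
  by have [Sn _] := Su n; have [_ _ + _] := uS n Sn; rewrite !un.
have yS n : y n <= y n.+1 /\ y n.+1 + B / 2 ^+ n.+1 <= y n + B / 2 ^+ n.
  by have [Sn _] := Su n; have [_ _ _] := uS n Sn; rewrite !un.
have lim (z : nat -> R) D : 0 <= D ->
  (forall n, z n <= z n.+1 /\ z n.+1 + D / 2 ^+ n.+1 <= z n + D / 2 ^+ n) ->
  exists z0, forall n, z n <= z0 <= z n + D / 2 ^+ n.
  move=> D0 zS.
  have D2 n : 0 <= D / 2 ^+ n by rewrite divr_ge0 // exprn_ge0.
  have mono n (k : nat) : z n <= z (n + k)%N /\ z (n + k)%N + D / 2 ^+ (n + k) <= z n + D / 2 ^+ n.
    elim: k => [|k [IH1 IH2]]; first by rewrite addn0.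
    by rewrite addnS; have [] := zS (n + k)%N; split; lra.
  have ub n : ubound (range z) (z n + D / 2 ^+ n).
    move=> _ [m _ <-]; have [nm|/ltnW mn] := leqP n m.
      by have [_] := mono n (m - n)%N; rewrite subnKC //; have := D2 m; lra.
    by have [+ _] := mono m (n - m)%N; rewrite subnKC //; have := D2 n; lra.
  exists (sup (range z)) => n; apply/andP; split.
    by apply: ub_le_sup; [exists (z n + D / 2 ^+ n)|exists n].
  by apply: ge_sup; [exists (z 0%N), 0%N|].
have [x0 x0P] := lim x A A0 xS; have [y0 y0P] := lim y B B0 yS.
have x0X : X1 <= x0 <= X2.
  by have := x0P 0%N; rewrite /x u0 /= expr0 divr1 AE; lra.
have y0Y : Y1 <= y0 <= Y2.
  by have := y0P 0%N; rewrite /y u0 /= expr0 divr1 BE; lra.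
pose s := A + B + 1.
have s0 : 0 < s by rewrite /s; lra.
have e0 : 0 < `|J| / 2 / s ^+ 2 by rewrite !divr_gt0 // exprn_gt0.
have [d d0 H] := rectint_small x0X y0Y e0.
have [n nd] : exists n, s / 2 ^+ n < d.
  have [m _] := near_infty_natSinv_expn_lt (PosNum (divr_gt0 d0 s0)).
  move=> /(_ m (leqnn m)) /= md; exists m; move: md.
  by rewrite ltr_pdivlMr // div1r mulrC.
have [[X1n X2n Y1n Y2n JJ] _] := Su n.
move: X1n X2n Y1n Y2n JJ; rewrite un -/(x n) -/(y n) => X1n X2n Y1n Y2n JJ.
have /andP[? ?] := x0P n; have /andP[? ?] := y0P n.
have p2 : 0 < 2 ^- n :> R by rewrite invr_gt0 exprn_gt0.
have As : A * 2 ^- n <= s * 2 ^- n by rewrite ler_wpM2r ?(ltW p2) // /s -addrA lerDl addr_ge0.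
have Bs : B * 2 ^- n <= s * 2 ^- n by rewrite ler_wpM2r ?(ltW p2) // /s addrAC lerDr addr_ge0.
have : `|rectint (x n) (x n + A / 2 ^+ n) (y n) (y n + B / 2 ^+ n)| <=
    `|J| / 2 / s ^+ 2 * (s / 2 ^+ n) ^+ 2.
  by apply: H => //; rewrite addrAC subrr add0r.
apply/negP; rewrite -ltNge; apply: lt_le_trans JJ.
rewrite expr_div_n mulrA divfK ?expf_neq0 ?gt_eqF //.
rewrite -exprM mulnC exprM (_ : 2 ^+ 2 = 4) -?natrX //.
rewrite ltr_pM2r ?invr_gt0 ?exprn_gt0 //; lra.
Qed.

End Goursat.
End RectangleIntegral.

(** * Cauchy estimates *)

Section ComplexExponential.
Variable R : realType.
Local Notation C := R[i].
Implicit Types (x y d e r M : R) (z w h l : C) (f F G : C -> C).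

Definition cexp w : C :=
  (expR (complex.Re w) * cos (complex.Im w)) +i* (expR (complex.Re w) * sin (complex.Im w)).

Lemma cexpD w h : cexp (w + h) = cexp w * cexp h.
Proof.
case: w h => [a b] [c d]; rewrite /cexp /= expRD cosD sinD.
by apply/eqP; rewrite eq_complex /=; apply/andP; split; apply/eqP; ring.
Qed.

Lemma normc_cexp w : normc (cexp w) = expR (complex.Re w).
Proof.
case: w => a b; rewrite /cexp /= !exprMn -mulrDr cos2Dsin2 mulr1 sqrtr_sqr.
by rewrite ger0_norm // expR_ge0.
Qed.

Lemma cexpN w : cexp w * cexp (- w) = 1.
Proof.
rewrite -cexpD subrr /cexp /= expR0 cos0 sin0 mulr0 mulr1; exact/eqP.
Qed.

Lemma derive_eps (g : R -> R) (t c : R) : is_derive t 1 g c -> forall e, 0 < e ->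
  exists2 d, 0 < d & forall s : R, `|s| < d -> `|g (t + s) - g t - c * s| <= e * `|s|.
Proof.
move=> gc e e0.
have : s^-1 *: ((g \o shift t) (s *: (1 : R)) - g t) @[s --> 0^'] --> c.
  by have [/cvg_ex[/= l gl] <-] := gc; rewrite /derive (cvg_lim _ gl).
move/cvgrPdist_le => /(_ e e0) [/= d d0 H]; exists d => // s sd.
have [->|s0] := eqVneq s 0; first by rewrite addr0 mulr0 !subrr normr0 mulr0.
have := H s; rewrite /= sub0r normrN => /(_ sd s0).
have -> : c - s^-1 *: (g (s *: 1 + t) - g t) = - ((g (t + s) - g t - c * s) * s^-1).
  rewrite /GRing.scale /= mulr1 [s + t]addrC [in RHS]mulrBl mulfK // opprB.
  by rewrite [s^-1 * _]mulrC.
by rewrite normrN normrM normfV ler_pdivrMr ?normr_gt0.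
Qed.

(** The derivative at 0 follows from those of the real exponential, sine and cosine; the functional
    equation carries it to [w]. *)
Lemma cdiff_cexp w : cdiff cexp w (cexp w).
Proof.
have c0 : cdiff cexp 0 1.
  (* With [n = normc h], the errors add up to at most [7 * e' * n + 2 * n * n], and both [e'] and
     [n] are at most [e / 16]. *)
  move=> e e0; pose e' := Num.min 1 (e / 16).
  have e'0 : 0 < e' by rewrite lt_min ltr01 divr_gt0.
  have [d1 d10 H1] := derive_eps (is_derive_expR (0 : R)) e'0.
  have [d2 d20 H2] := derive_eps (is_derive_sin (0 : R)) e'0.
  have [d3 d30 H3] := derive_eps (is_derive_cos (0 : R)) e'0.
  exists (Num.min (Num.min 1 (e / 16)) (Num.min d1 (Num.min d2 d3))).
    by rewrite !lt_min d10 d20 d30 divr_gt0 // ltr01.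
  move=> h; rewrite !lt_min => /and4P[/andP[h1 h16] hd1 hd2 hd3].
  have ha := normc_Re h; have hb := normc_Im h.
  set n := normc h in h1 h16 hd1 hd2 hd3 ha hb *.
  have := H1 _ (le_lt_trans ha hd1); have := H2 _ (le_lt_trans hb hd2).
  have := H3 _ (le_lt_trans hb hd3).
  rewrite !add0r expR0 sin0 cos0 oppr0 mul0r !mul1r !subr0 addr0 => K3 K2 K1.
  apply: le_trans (normc_ReIm _) _.
  rewrite ?add0r /cexp ?mul1r.
  clearbody n; move: h h1 h16 {hd1 hd2 hd3} ha hb K3 K2 K1 => [a b] /= n1 n16 ha hb.
  rewrite expR0 cos0 sin0 mulr0 mulr1 subr0 ?mul1r.
  move=> K3 K2 K1.
  have n0 : 0 <= n by exact: le_trans (normr_ge0 _) ha.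
  have e'1 : e' <= 1 by rewrite ge_min lexx.
  have e'8 : e' <= e / 16 by rewrite ge_min lexx orbT.
  have k1 : `|expR a - 1 - a| <= e' * n by apply: le_trans K1 _; rewrite ler_wpM2l // ltW.
  have k2 : `|sin b - b| <= e' * n by apply: le_trans K2 _; rewrite ler_wpM2l // ltW.
  have k3 : `|cos b - 1| <= e' * n by apply: le_trans K3 _; rewrite ler_wpM2l // ltW.
  have en : e' * n <= n by rewrite ler_piMl.
  have Ea : `|expR a - 1| <= 2 * n.
    have := ler_normD (expR a - 1 - a) a; rewrite subrK; lra.
  have Eb : `|expR a| <= 3 by have := ler_normD (expR a - 1) 1; rewrite subrK normr1; lra.
  have e8n : e' * n <= e / 16 * n by rewrite ler_wpM2r.
  have -> : expR a * cos b - 1 - a = (expR a - 1 - a) + expR a * (cos b - 1) by ring.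
  have := ler_normD (expR a - 1 - a) (expR a * (cos b - 1)).
  have -> : expR a * sin b - b = expR a * (sin b - b) + (expR a - 1) * b by ring.
  have := ler_normD (expR a * (sin b - b)) ((expR a - 1) * b).
  rewrite !normrM.
  have p1 := ler_pM (normr_ge0 _) (normr_ge0 _) Eb k3.
  have p2 := ler_pM (normr_ge0 _) (normr_ge0 _) Eb k2.
  have p3 := ler_pM (normr_ge0 _) (normr_ge0 _) Ea hb.
  have p4 : 2 * n * n <= 2 * n * (e / 16) by rewrite ler_wpM2l ?mulr_ge0 // ltW.
  have p5 : 0 <= e * n by rewrite mulr_ge0 // ltW.
  lra.
move=> e e0; have W0 : 0 < normc (cexp w) by rewrite normc_cexp expR_gt0.
have [d d0 H] := c0 (e / normc (cexp w)) (divr_gt0 e0 W0).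
exists d => // h /H; rewrite add0r mul1r cexpD.
have -> : cexp 0 = 1 by rewrite /cexp /= expR0 cos0 sin0 mulr1 mulr0.
have -> : cexp w * cexp h - cexp w - cexp w * h = cexp w * (cexp h - 1 - h) by ring.
by rewrite normcM mulrAC ler_pdivlMr // mulrC.
Qed.

Definition holo f z := exists l, cdiff f z l.

(** The form is the real part of f dz; the common mixed coefficient expresses one of the
    Cauchy-Riemann equations. *)
Lemma cdiff_closed_form f z l : cdiff f z l ->
  closed_form_at (fun x y => complex.Re (f (x +i* y))) (fun x y => - complex.Im (f (x +i* y)))
    (complex.Re z) (complex.Im z).
Proof.
case: z => x0 y0 /= fl; exists (complex.Re l), (- complex.Im l), (- complex.Re l) => e e0.
have [d d0 H] := fl e e0; exists (d / 2) => [|x y xd yd]; first by rewrite divr_gt0.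
pose h : C := (x - x0) +i* (y - y0).
have hN : normc h <= `|x - x0| + `|y - y0| := normc_ReIm h.
have := H h; case: ltP; last by lra.
have -> : (x0 +i* y0) + h = x +i* y.
  by apply/eqP; rewrite eq_complex /= ![_ + (_ - _)]addrC !subrK !eqxx.
move=> _ /(_ isT) K.
have := le_trans (normc_Re _) (le_trans K (ler_wpM2l (ltW e0) hN)).
have := le_trans (normc_Im _) (le_trans K (ler_wpM2l (ltW e0) hN)).
rewrite /h; case: (f (x +i* y)) (f (x0 +i* y0)) {H K fl} => [a b] [a' b']; case: l => l m /=.
move=> KI KR; split.
  by apply: le_trans KR; rewrite le_eqVlt; apply/orP; left; apply/eqP; congr `|_|; ring.
by apply: le_trans KI; rewrite -normrN le_eqVlt; apply/orP; left; apply/eqP; congr `|_|; ring.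
Qed.

(** Goursat's theorem on [X1, X2] x [0, p]: periodicity cancels the horizontal sides, and on the
    vertical ones the real part of G dz only involves the imaginary part of [G]. *)
Lemma periodic_strip_integral G X1 X2 p : X1 <= X2 -> 0 <= p ->
  (forall w, X1 <= complex.Re w <= X2 -> 0 <= complex.Im w <= p -> holo G w) ->
  (forall x, G (x +i* p) = G (x +i* 0)) ->
  segint 0 p (fun y => complex.Im (G (X1 +i* y))) =
  segint 0 p (fun y => complex.Im (G (X2 +i* y))).
Proof.
move=> X12 p0 HG per.
have closed x y : X1 <= x <= X2 -> 0 <= y <= p ->
   closed_form_at (fun x y => complex.Re (G (x +i* y))) (fun x y => - complex.Im (G (x +i* y))) x y.
  by move=> xX yp; have [|//|l /cdiff_closed_form] := HG (x +i* y).
have := goursat X12 p0 closed.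
have segN (g : R -> R) : {within `[0, p], continuous (fun y => - g y)} ->
    segint 0 p (fun y => - g y) = - segint 0 p g.
  move=> /segint_integrable cg.
  have -> : g = (fun y => -1 * - g y) by apply/funext => y; rewrite mulN1r opprK.
  rewrite {2}/segint RintegralZl // mulN1r opprK /segint.
  by apply: eq_Rintegral => y _; rewrite mulN1r !opprK.
have X1X : X1 <= X1 <= X2 by rewrite lexx.
have X2X : X1 <= X2 <= X2 by rewrite lexx X12.
rewrite /rectint.
rewrite !segN; last 2 first.
- exact: (closed_form_continuousQ closed).
- exact: (closed_form_continuousQ closed).
have -> : (fun x => complex.Re (G (x +i* p))) = (fun x => complex.Re (G (x +i* 0))).
  by apply/funext => x; rewrite per.
lra.
Qed.

End ComplexExponential.

Section CauchyEstimate.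
Variable R : realType.
Local Notation C := R[i].
Implicit Types (x y d e r M : R) (z w h l c : C) (f F G : C -> C).

Lemma holo_Im_continuous G x a b : (forall y, a <= y <= b -> holo G (x +i* y)) ->
  {within `[a, b], continuous (fun y => complex.Im (G (x +i* y)))}.
Proof.
move=> HG; apply: derivable_within_continuous => y; rewrite in_itv /= => /HG[l Gl].
have lineE (t : R) : x%:C + t%:C * 'i = x +i* t.
  by apply/eqP; rewrite eq_complex /=; apply/andP; split; apply/eqP; ring.
have := @cdiff_derive_line R G x%:C 'i l y; rewrite lineE => /(_ Gl (- 'i)).
have -> : (fun s : R => complex.Re (- 'i * G (x%:C + s%:C * 'i))) =
          (fun y => complex.Im (G (x +i* y))).
  by apply/funext => s; rewrite lineE; case: (G _) => u v /=; ring.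
by case.
Qed.

(* Oddness of [F] makes [F (e^w) e^(-w)] periodic of period [i pi], so its integrals
   over the two vertical sides of [X1, 0] x [0, pi] agree; as [X1] tends to
   [-oo] the left one tends to [pi l]. *)
Lemma cauchy_estimate_odd F M l : (forall z, normc z <= 1 -> holo F z) ->
  (forall z, F (- z) = - F z) -> (forall z, normc z <= 1 -> normc (F z) <= M) ->
  cdiff F 0 l -> normc l <= 2 * M.
Proof.
move=> HF Fodd FM Fl.
(* A nonzero value at 0 would make [F (e^w) e^(-w)] blow up on the left side of the rectangle. *)
have F0 : F 0 = 0.
  have /eqP := Fodd 0; rewrite oppr0 -addr_eq0 -mulr2n -mulr_natl mulf_eq0 pnatr_eq0 /=.
  by move/eqP.
have [P pp PE] : exists2 P : R, 0 < P & P = pi by exists pi => //; exact: pi_gt0.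
have p0 := ltW pp.
have comp c : normc c <= 1 -> `|complex.Im (c * l)| <= M.
  move=> c1; apply/ler_addgt0Pr => e e0.
  have [d d0 Hd] := Fl e e0.
  (* Far enough to the left for [e^w] to enter the disc where [F] is close to its linear part. *)
  pose X1 := Num.min 0 (ln d - 1).
  have X10 : X1 <= 0 by rewrite ge_min lexx.
  have eX1 : expR X1 < d.
    rewrite -[ltRHS]lnK ?posrE // ltr_expR; apply: (@le_lt_trans _ _ (ln d - 1)).
      by rewrite ge_min lexx orbT.
    by rewrite ltrBlDr ltrDl.
  pose G w := c * (F (cexp w) * cexp (- w)).
  have HG w : complex.Re w <= 0 -> holo G w.
    move=> w0; have [|m Fm] := HF (cexp w); first by rewrite normc_cexp expR_le1.
    eexists; apply: cdiffZ; apply: cdiffM.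
      by apply: (cdiff_comp (cdiff_cexp w)); exact: Fm.
    by apply: (cdiff_comp (cdiffN (cdiff_id w))); exact: cdiff_cexp.
  have cexp_pi x : cexp (x +i* P) = - cexp (x +i* 0).
    apply/eqP; rewrite eq_complex /= PE cospi sinpi cos0 sin0.
    by apply/andP; split; apply/eqP; ring.
  have cexp_Npi x : cexp (- (x +i* P)) = - cexp (- (x +i* 0)).
    apply/eqP; rewrite eq_complex /= cosN sinN PE cospi sinpi oppr0 cos0 sin0.
    by apply/andP; split; apply/eqP; ring.
  have per x : G (x +i* P) = G (x +i* 0).
    by rewrite /G cexp_pi cexp_Npi Fodd mulrNN.
  have strip := periodic_strip_integral X10 p0 _ per.
  have {}strip : segint 0 P (fun y => complex.Im (G (X1 +i* y))) =
      segint 0 P (fun y => complex.Im (G (0 +i* y))).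
    by apply: strip => w /andP[_ w0] _; exact: HG.
  have B0 : `|segint 0 P (fun y => complex.Im (G (0 +i* y))) - 0 * (P - 0)| <= M * (P - 0).
    apply: (segint_bound p0) => [|y _].
      by apply: holo_Im_continuous => y _; exact: HG.
    rewrite subr0; apply: le_trans (normc_Im _) _.
    rewrite !normcM !normc_cexp /= oppr0 expR0 mulr1.
    have Mb : normc (F (cexp (0 +i* y))) <= M by apply: FM; rewrite normc_cexp expR0.
    apply: le_trans Mb; rewrite ler_piMl ?normc_ge0 //.
  have B1 : `|segint 0 P (fun y => complex.Im (G (X1 +i* y))) - complex.Im (c * l) * (P - 0)|
            <= e * (P - 0).
    apply: (segint_bound p0) => [|y _].
      by apply: holo_Im_continuous => y _; exact: HG.
    set w := X1 +i* y; have := Hd (cexp w); rewrite normc_cexp => /(_ eX1).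
    rewrite add0r F0 subr0 => K.
    have -> : complex.Im (G w) - complex.Im (c * l) =
        complex.Im (c * ((F (cexp w) - l * cexp w) * cexp (- w))).
      rewrite mulrBl -mulrA cexpN mulr1 mulrBr /G.
      by case: (c * (_ * _)) (c * l) => [? ?] [].
    apply: le_trans (normc_Im _) _; rewrite normcM.
    apply: (@le_trans _ _ (normc ((F (cexp w) - l * cexp w) * cexp (- w)))).
      by rewrite ler_piMl ?normc_ge0.
    rewrite normcM normc_cexp /= expRN ler_pdivrMr ?expR_gt0 //.
  rewrite strip in B1; move: B0 B1; move: (segint _ _ _) (complex.Im _) => I0 t B0 B1.
  rewrite mul0r !subr0 in B0 B1.
  rewrite -(ler_pM2r pp) -[X in `|_| * X](gtr0_norm pp) -normrM.
  rewrite distrC in B1; have := ler_normD (t * P - I0) I0.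
  by rewrite subrK => /le_trans; apply; rewrite [M + e]addrC mulrDl lerD.
apply: le_trans (normc_ReIm _) _.
have := comp 1; rewrite normc1 lexx mul1r => /(_ isT).
have := comp 'i; rewrite /= expr0n expr1n add0r sqrtr1 lexx => /(_ isT).
have -> : complex.Im ('i * l) = complex.Re l by case: (l) => a b /=; ring.
lra.
Qed.

(** The odd part of [f] about [z0], rescaled to the unit disc, is still bounded by [M] and has
    derivative [r * l] at 0, while the even part, and with it the value [f z0], drops out. *)
Lemma cauchy_estimate f z0 r M l : 0 < r ->
  (forall z, normc (z - z0) <= r -> holo f z) ->
  (forall z, normc (z - z0) <= r -> normc (f z) <= M) ->
  cdiff f z0 l -> normc l <= 2 * M / r.
Proof.
move=> r0 Hf fM fl; rewrite ler_pdivlMr //.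
have half (a b : C) : normc a <= M -> normc b <= M -> normc (2^-1 * (a - b)) <= M.
  move=> aM bM; rewrite normcM normcV (_ : normc (2 : C) = 2); last first.
    by rewrite -[2 : C](rmorph_nat (real_complex R)) normc_real normr_nat.
  have := normcB a b; lra.
pose F z := 2^-1 * (f (z0 + r%:C * z) - f (z0 + r%:C * - z)).
have disc z : normc z <= 1 -> normc (z0 + r%:C * z - z0) <= r.
  move=> z1; rewrite addrC addKr normcM normc_real gtr0_norm //.
  by rewrite ler_piMr // ltW.
have discN z : normc z <= 1 -> normc (z0 + r%:C * - z - z0) <= r.
  by move=> z1; apply: disc; rewrite normc_opp.
have aff z : cdiff (fun w => z0 + r%:C * w) z r%:C.
  have := cdiffD (cdiff_cst z0 z) (cdiffZ r%:C (cdiff_id z)).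
  by rewrite mulr1 add0r.
have affN z : cdiff (fun w => z0 + r%:C * - w) z (- r%:C).
  have := cdiffD (cdiff_cst z0 z) (cdiffZ r%:C (cdiffN (cdiff_id z))).
  by rewrite mulrN1 add0r.
have -> : normc l * r = normc (r%:C * l).
  by rewrite normcM normc_real gtr0_norm // mulrC.
apply: (@cauchy_estimate_odd F).
- move=> z z1; have [m fm] := Hf _ (disc z z1); have [m' fm'] := Hf _ (discN z z1).
  eexists; apply: cdiffZ; apply: cdiffB.
    exact: cdiff_comp (aff z) fm.
  exact: cdiff_comp (affN z) fm'.
- by move=> z; rewrite /F opprK -mulrN opprB.
- by move=> z z1; apply: half; apply: fM; [exact: disc|exact: discN].
- have -> : r%:C * l = 2^-1 * (l * r%:C - l * - r%:C) by field.
  apply: cdiffZ; apply: cdiffB.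
    by apply: (cdiff_comp (aff 0)); rewrite mulr0 addr0.
  by apply: (cdiff_comp (affN 0)); rewrite oppr0 mulr0 addr0.
Qed.

End CauchyEstimate.

(** * Consequences of the Cauchy estimate *)

Section CauchyConsequences.
Variable R : realType.
Local Notation C := R[i].
Implicit Types (d e r M : R) (z w h l c : C) (f g : C -> C).
Local Notation D f := (derive1 (f : C^o -> C^o)).

Lemma holoP f z : holo f z <-> derivable (f : C^o -> C^o) z 1.
Proof. by split=> [[l /cdiff_derivable]|/derivable_cdiff]; last by exists (D f z). Qed.

Lemma holo_cdiff f z : holo f z -> cdiff f z (D f z).
Proof. by move/holoP/derivable_cdiff. Qed.

(** Cauchy's estimate about [z] with radius [r / 4], rather than [r / 2], so that the closed disc
    stays inside the open one. *)
Lemma derive1_bound f z0 r M z : 0 < r ->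
  (forall z, normc (z - z0) < r -> holo f z) ->
  (forall z, normc (z - z0) < r -> normc (f z) <= M) ->
  normc (z - z0) <= r / 2 -> normc (D f z) <= 8 * M / r.
Proof.
move=> r0 Hf fM zr.
have r4 : 0 < r / 4 by rewrite divr_gt0.
have sub w : normc (w - z) <= r / 4 -> normc (w - z0) < r.
  by move=> wz; apply: le_lt_trans (normc_dist_trans w z z0) _; lra.
have -> : 8 * M / r = 2 * M / (r / 4) by field; rewrite gt_eqF.
apply: (@cauchy_estimate _ f z) => // [w wz|w wz|].
- by apply: Hf; exact: sub.
- by apply: fM; exact: sub.
- by apply: holo_cdiff; apply: Hf; apply: sub; rewrite subrr normc0 ltW.
Qed.

Lemma segment_in_disc z0 z w r (t : R) : 0 <= t <= 1 -> normc (z - z0) <= r ->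
  normc (w - z0) <= r -> normc (z + t%:C * (w - z) - z0) <= r.
Proof.
move=> /andP[t0 t1] zr wr.
have -> : z + t%:C * (w - z) - z0 = (1 - t)%:C * (z - z0) + t%:C * (w - z0).
  by rewrite rmorphB rmorph1 /=; ring.
apply: le_trans (normcD _ _) _; rewrite !normcM !normc_real !ger0_norm ?subr_ge0 //.
have : (1 - t) * normc (z - z0) <= (1 - t) * r by rewrite ler_wpM2l // subr_ge0.
have : t * normc (w - z0) <= t * r by rewrite ler_wpM2l.
lra.
Qed.

Lemma holo_mean_value f z0 r M z w : (forall z, normc (z - z0) <= r -> holo f z) ->
  (forall z, normc (z - z0) <= r -> normc (D f z) <= M) ->
  normc (z - z0) <= r -> normc (w - z0) <= r ->
  normc (f w - f z) <= 2 * M * normc (w - z).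
Proof.
move=> Hf fM zr wr; have := @cdiff_mean_value _ f z (w - z) M.
rewrite [z + (w - z)]addrC subrK; apply => t t01.
have tr := segment_in_disc t01 zr wr.
by exists (D f (z + t%:C * (w - z))); [exact/holo_cdiff/Hf|exact: fM].
Qed.

Lemma holo_lipschitz f z0 r M z w : 0 < r ->
  (forall z, normc (z - z0) < r -> holo f z) ->
  (forall z, normc (z - z0) < r -> normc (f z) <= M) ->
  normc (z - z0) <= r / 2 -> normc (w - z0) <= r / 2 ->
  normc (f w - f z) <= 16 * M / r * normc (w - z).
Proof.
move=> r0 Hf fM zr wr.
have -> : 16 * M / r = 2 * (8 * M / r) by ring.
apply: (@holo_mean_value _ z0 (r / 2)) => // u ur.
  by apply: Hf; apply: le_lt_trans ur _; lra.
exact: derive1_bound Hf fM ur.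
Qed.

(** The intervals of radius [e n] about the real parts meet pairwise, so the supremum of their left
    ends lies in all of them; the imaginary parts are treated alike, and the two errors add up to
    [2 * e n]. *)
Lemma cauchy_limit (u : nat -> C) (e : nat -> R) :
  (forall n m, normc (u n - u m) <= e n + e m) ->
  exists l, forall n, normc (u n - l) <= 2 * e n.
Proof.
move=> H.
have lim (v : nat -> R) : (forall n m, `|v n - v m| <= e n + e m) ->
    exists s, forall n, `|v n - s| <= e n.
  move=> Hv; pose s := sup (range (fun n => v n - e n)).
  have ub m : ubound (range (fun n => v n - e n)) (v m + e m).
    by move=> _ [n _ <-]; have := Hv n m; rewrite ler_norml; lra.
  exists s => n; rewrite ler_norml.
  have : v n - e n <= s by apply: ub_le_sup; [exists (v n + e n)|exists n].
  have : s <= v n + e n by apply: ge_sup; [exists (v 0%N - e 0%N), 0%N|].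
  lra.
have ReB (a b : C) : complex.Re a - complex.Re b = complex.Re (a - b) by case: a b => [? ?] [].
have ImB (a b : C) : complex.Im a - complex.Im b = complex.Im (a - b) by case: a b => [? ?] [].
have [n m|a aP] := lim (fun n => complex.Re (u n)).
  by rewrite /= ReB; exact: le_trans (normc_Re _) (H n m).
have [n m|b bP] := lim (fun n => complex.Im (u n)).
  by rewrite /= ImB; exact: le_trans (normc_Im _) (H n m).
exists (a +i* b) => n; apply: le_trans (normc_ReIm _) _.
by rewrite -ReB -ImB /=; have := aP n; have := bP n; rewrite /=; lra.
Qed.

(** Cauchy estimates for [u n - u m] make the derivatives at [z0] converge to some [l]. That [g] has
    derivative [l] rests on the Lipschitz bound for [u n - u m]: it survives the limit in [m], so
    the increments of [u n - g] from [z0] are a small multiple of [normc h]. *)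
Lemma holo_uniform_limit (u : nat -> C -> C) g z0 r (e : nat -> R) : 0 < r ->
  (forall n z, normc (z - z0) < r -> holo (u n) z) ->
  (forall n z, normc (z - z0) < r -> normc (u n z - g z) <= e n) ->
  (forall d, 0 < d -> exists n, e n <= d) ->
  exists2 l, cdiff g z0 l & forall n, normc (D (u n) z0 - l) <= 16 / r * e n.
Proof.
move=> r0 Hu ue e_small.
have z0r : normc (z0 - z0) < r by rewrite subrr normc0.
have uB n m z : normc (z - z0) < r -> normc (u n z - u m z) <= e n + e m.
  move=> zr; apply: le_trans (normc_dist_trans _ (g z) _) _.
  by rewrite lerD ?ue // normc_distC ue.
have HB n m z : normc (z - z0) < r -> holo (fun z => u n z - u m z) z.
  by move=> zr; have [l ul] := Hu n z zr; have [m' um] := Hu m z zr; exists (l - m'); exact: cdiffB.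
have [|l lP] := @cauchy_limit (fun n => D (u n) z0) (fun n => 8 / r * e n).
  move=> n m; rewrite -mulrDr.
  have -> : D (u n) z0 - D (u m) z0 = D (fun z => u n z - u m z) z0.
    by apply/esym/cdiff_derive1/cdiffB; exact/holo_cdiff/Hu.
  have -> : 8 / r * (e n + e m) = 8 * (e n + e m) / r by ring.
  apply: (derive1_bound r0 (HB n m) (uB n m)).
  by rewrite subrr normc0 divr_ge0 // ltW.
have {}lP n : normc (D (u n) z0 - l) <= 16 / r * e n.
  by apply: le_trans (lP n) _; rewrite le_eqVlt; apply/orP; left; apply/eqP; ring.
exists l => // d d0.
have [|n en] := e_small (d / 4 / (16 / r)); first by rewrite !divr_gt0.
have en4 : 16 / r * e n <= d / 4.
  by rewrite mulrC -ler_pdivlMr // divr_gt0.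
have d40 : 0 < d / 4 by rewrite divr_gt0.
have [d1 d10 H1] := holo_cdiff (Hu n _ z0r) d40.
exists (Num.min d1 (r / 2)); first by rewrite lt_min d10 divr_gt0.
move=> h; rewrite lt_min => /andP[/H1 K hr].
have hz : normc (z0 + h - z0) <= r / 2 by rewrite addrC addKr ltW.
have h0 := normc_ge0 h.
have tail : normc ((u n (z0 + h) - u n z0) - (g (z0 + h) - g z0)) <= d / 2 * normc h.
  apply/ler_addgt0Pr => k k0.
  have [|m em] := e_small (Num.min (k / 2) (d / 4 / (16 / r))).
    by rewrite lt_min !divr_gt0.
  move: em; rewrite le_min => /andP[ek ed].
  have em4 : 16 / r * e m <= d / 4 by rewrite mulrC -ler_pdivlMr // divr_gt0.
  have zhr : normc (z0 + h - z0) < r by apply: le_lt_trans hz _; lra.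
  have := holo_lipschitz r0 (HB n m) (uB n m) (z := z0) (w := z0 + h).
  rewrite subrr normc0 => /(_ (divr_ge0 (ltW r0) (ler0n _ _)) hz).
  rewrite [z0 + h]addrC addrK [h + z0]addrC => L.
  have -> : (u n (z0 + h) - u n z0) - (g (z0 + h) - g z0) =
     (u n (z0 + h) - u m (z0 + h) - (u n z0 - u m z0)) +
     ((u m (z0 + h) - g (z0 + h)) - (u m z0 - g z0)) by ring.
  apply: le_trans (normcD _ _) _; apply: le_trans (lerD L (normcB _ _)) _.
  have := ue m _ zhr; have := ue m _ z0r.
  have : 16 * (e n + e m) / r <= d / 2.
    by rewrite (_ : _ / r = 16 / r * e n + 16 / r * e m); [lra|ring].
  by move=> /(ler_wpM2r h0); lra.
have -> : g (z0 + h) - g z0 - l * h =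
  - ((u n (z0 + h) - u n z0) - (g (z0 + h) - g z0)) +
  (u n (z0 + h) - u n z0 - D (u n) z0 * h) + (D (u n) z0 - l) * h by ring.
apply: le_trans (normcD _ _) _; rewrite normcM.
apply: le_trans (lerD (normcD _ _) (lexx _)) _; rewrite normc_opp.
have := ler_wpM2r h0 (le_trans (lP n) en4); lra.
Qed.

(** The derivative is a uniform limit near [z0] of its difference quotients [q h], which are
    holomorphic. They are uniformly bounded since [f] is Lipschitz, hence uniformly Lipschitz by
    Cauchy; their pointwise limit [D f] inherits this, which in turn gives a rate of convergence. *)
Lemma holo_derive1 f z0 r : 0 < r -> (forall z, normc (z - z0) < r -> holo f z) ->
  holo (D f) z0.
Proof.
move=> r0 Hf.
have z0r : normc (z0 - z0) < r by rewrite subrr normc0.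
have [d d0 dP] := cdiff_continuous (holo_cdiff (Hf _ z0r)) ltr01.
pose p := Num.min r d; have p0 : 0 < p by rewrite lt_min r0.
pose M := normc (f z0) + 1.
have {}Hf z : normc (z - z0) < p -> holo f z by rewrite lt_min => /andP[/Hf].
have fM z : normc (z - z0) < p -> normc (f z) <= M.
  rewrite lt_min => /andP[_ /dP]; rewrite [z0 + _]addrC subrK => zd.
  by apply: le_trans (normc_le_dist _ (f z0)) _; rewrite lerD2l ltW.
have lip := holo_lipschitz p0 Hf fM.
pose q h z := (f (z + h) - f z) / h.
pose M1 := 16 * M / p.
have p4 : 0 < p / 4 by rewrite divr_gt0.
have zh z h : normc (z - z0) < p / 4 -> normc h < p / 4 -> normc (z + h - z0) < p / 2.
  by move=> zp hp; rewrite addrAC; apply: le_lt_trans (normcD _ _) _; lra.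
have qM h z : normc h < p / 4 -> normc (z - z0) < p / 4 -> normc (q h z) <= M1.
  move=> hp zp; have M10 : 0 <= M1 by rewrite !mulr_ge0 ?invr_ge0 ?addr_ge0 ?normc_ge0 // ltW.
  have [->|h0] := eqVneq h 0; first by rewrite /q invr0 mulr0 normc0.
  rewrite normcM normcV ler_pdivrMr ?normc_gt0 //.
  have := lip z (z + h); rewrite [z + h - z]addrC addKr; apply; last exact/ltW/zh.
  by apply: le_trans (ltW zp) _; lra.
have Hq h z : normc h < p / 4 -> normc (z - z0) < p / 4 -> holo (q h) z.
  move=> hp zp.
  have [l fl] : holo f z by apply: Hf; apply: lt_trans zp _; lra.
  have [m fm] : holo f (z + h) by apply: Hf; apply: lt_trans (zh _ _ zp hp) _; lra.
  exists (h^-1 * (m * 1 - l)).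
  apply: (@cdiff_ext_near _ (fun z => h^-1 * (f (z + h) - f z)) _ _ _ 1) => // [w _|].
    by rewrite mulrC.
  apply/cdiffZ/cdiffB => //; apply: cdiff_comp => //.
  by have := cdiffD (cdiff_id z) (cdiff_cst h z); rewrite addr0.
pose L := 16 * M1 / (p / 4).
have qL h z w : normc h < p / 4 -> normc (z - z0) <= p / 8 -> normc (w - z0) <= p / 8 ->
    normc (q h w - q h z) <= L * normc (w - z).
  move=> hp zp wp.
  by apply: (holo_lipschitz p4 (fun u => @Hq h u hp) (fun u => @qM h u hp)); lra.
have qcv z e : normc (z - z0) < p -> 0 < e -> exists2 k, 0 < k &
    forall h, h != 0 -> normc h < k -> normc (q h z - D f z) <= e.
  move=> zp e0; have [k k0 kP] := holo_cdiff (Hf z zp) e0; exists k => // h h0 /kP.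
  have -> : q h z - D f z = (f (z + h) - f z - D f z * h) / h.
    by rewrite mulrBl mulfK.
  by rewrite normcM normcV ler_pdivrMr ?normc_gt0.
have DL z w : normc (z - z0) <= p / 8 -> normc (w - z0) <= p / 8 ->
    normc (D f w - D f z) <= L * normc (w - z).
  move=> zp wp; apply/ler_addgt0Pr => e e0.
  have e20 : 0 < e / 2 by rewrite divr_gt0.
  have [|k k0 kP] := qcv z (e / 2) _ e20; first by apply: le_lt_trans zp _; lra.
  have [|k' k'0 k'P] := qcv w (e / 2) _ e20; first by apply: le_lt_trans wp _; lra.
  pose s := Num.min (Num.min k k') (p / 4) / 2.
  have s0 : 0 < Num.min (Num.min k k') (p / 4) by rewrite !lt_min k0 k'0 p4.
  have sN : normc (s%:C : C) = s by rewrite normc_real ger0_norm // divr_ge0 // ltW.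
  have : s < Num.min (Num.min k k') (p / 4) by rewrite /s; lra.
  rewrite !lt_min -sN => /andP[/andP[sk sk'] sp].
  have h0 : s%:C != 0 :> C by rewrite -normc_gt0 sN divr_gt0.
  move: (kP _ h0 sk) (k'P _ h0 sk') (qL _ _ _ sp zp wp); clear.
  move: (D f w) (D f z) (q s%:C w) (q s%:C z) (L * _) => u v a b j A B E.
  have -> : u - v = (a - b) - (a - u) + (b - v) by ring.
  have := normcD ((a - b) - (a - u)) (b - v); have := normcB (a - b) (a - u). lra.
have L0 : 0 <= L.
  by rewrite !mulr_ge0 ?invr_ge0 ?addr_ge0 ?normc_ge0 // ltW.
(* The mean value inequality for [f w - D f z * w], whose derivative [D f w - D f z] is at most
   [L * normc h] between [z] and [z + h]. *)
have qD h z : h != 0 -> normc h < p / 16 -> normc (z - z0) < p / 16 ->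
    normc (q h z - D f z) <= 2 * L * normc h.
  move=> h0 hp zp.
  have -> : q h z - D f z = ((f (z + h) - D f z * (z + h)) - (f z - D f z * z)) / h.
    by rewrite /q -[X in _ - X](mulfK h0) -mulrBl; congr (_ / _); ring.
  rewrite normcM normcV ler_pdivrMr ?normc_gt0 //.
  rewrite -[2 * L * _]mulrA.
  apply: (@cdiff_mean_value _ (fun w => f w - D f z * w)) => t /andP[t0 t1].
  have th : normc (t%:C * h) <= normc h.
    by rewrite normcM normc_real ger0_norm // ler_piMl ?normc_ge0.
  have zt : normc (z + t%:C * h - z0) <= p / 8.
    by rewrite addrAC; apply: le_trans (normcD _ _) _; lra.
  exists (D f (z + t%:C * h) - D f z * 1).
    apply: cdiffB; last by apply: cdiffZ; exact: cdiff_id.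
    by apply: holo_cdiff; apply: Hf; apply: le_lt_trans zt _; lra.
  rewrite mulr1; apply: le_trans (DL _ _ _ zt) _; first by lra.
  by rewrite [z + _]addrC addrK ler_wpM2l.
pose s n := (p / 32) / n.+1%:R.
have s0 n : 0 < s n by rewrite !divr_gt0.
have sN n : normc ((s n)%:C : C) = s n by rewrite normc_real gtr0_norm.
have p16 : 0 < p / 16 by rewrite divr_gt0.
have sp n : s n < p / 16.
  have n1 : (1 <= n.+1%:R :> R) by rewrite ler1n.
  by rewrite ltr_pdivrMr //; have := ler_wpM2l (ltW p16) n1; lra.
have [||||l fl _] := @holo_uniform_limit (fun n => q (s n)%:C) (D f) z0 (p / 16) (fun n => 2 * L * s n).
- exact: p16.
- by move=> n z zp; apply: Hq; rewrite ?sN; have := sp n; lra.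
- move=> n z zp; rewrite -[X in 2 * L * X]sN; apply: qD => //; rewrite ?sN //.
  by rewrite -normc_gt0 sN.
- move=> e e0; pose K := 2 * L * (p / 32).
  have K0 : 0 <= K by apply: mulr_ge0; [exact: mulr_ge0|rewrite divr_ge0 // ltW].
  exists (Num.truncn (K / e)); rewrite /s mulrA ler_pdivrMr // [leRHS]mulrC.
  rewrite -ler_pdivrMr //; apply/ltW; exact: truncnS_gt.
by exists l.
Qed.

End CauchyConsequences.

(** * Lebesgue measure on the plane *)

Section PlaneMeasure.
Variable R : realType.
Local Notation C := R[i].
Implicit Types (d e r M x y s : R) (z c : C) (U V : set C) (w : R * R).
Local Notation mu := (@lebesgue_measure R).
Local Notation mu2 := (mu \x mu)%E.

Definition plane U : set (R * R) := [set w | U (w.1 +i* w.2)].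

Definition ocdisc c r : set C := [set z | normc (z - c) < r].

Definition copen U := forall z, U z -> exists2 r, 0 < r & ocdisc z r `<=` U.

Lemma ocdisc_open c r : copen (ocdisc c r).
Proof.
move=> z zr; exists (r - normc (z - c)); first by rewrite subr_gt0.
move=> z' /= z'z; apply: le_lt_trans (normc_dist_trans z' z c) _.
by rewrite -ltrBrDr.
Qed.

Definition box (a b s : R) : set (R * R) := `]a - s, a + s[ `*` `]b - s, b + s[.

Lemma box_measurable a b s : measurable (box a b s).
Proof. exact: measurableX. Qed.

Lemma mu2_box a b s : 0 <= s -> mu2 (box a b s) = (4 * s ^+ 2)%:E.
Proof.
move=> s0; pose I x : set R := `]x - s, x + s[%classic; have E x : mu (I x) = (2 * s)%:E.
  have := @lebesgue_measure_itv R `]x - s, x + s[; rewrite /= lte_fin => ->.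
  have -> : (x - s < x + s) = (0 < s) by apply/idP/idP; lra.
  case: ltP => [_|?]; first by rewrite -EFinB; congr EFin; ring.
  by congr EFin; lra.
transitivity (mu (I a) * mu (I b))%E.
  exact: product_measure1E.
by rewrite !E -EFinM; congr EFin; ring.
Qed.

Lemma box_sub_disc c r : box (complex.Re c) (complex.Im c) (r / 2) `<=` plane (ocdisc c r).
Proof.
case: c => a b [x y] /= [] /=; rewrite !in_itv /= => /andP[? ?] /andP[? ?].
apply: le_lt_trans (normc_ReIm _) _ => /=.
have : `|x - a| < r / 2 by rewrite ltr_norml; lra.
have : `|y - b| < r / 2 by rewrite ltr_norml; lra.
lra.
Qed.

(** An open set is the union of the countably many squares with rational centre and half-side that
    it contains, and squares are rectangles of the product sigma-algebra. *)
Lemma copen_measurable U : copen U -> measurable (plane U).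
Proof.
move=> oU.
pose B (q : rat * rat * rat) := box (ratr q.1.1) (ratr q.1.2) (ratr q.2).
have -> : plane U = \bigcup_q (if `[< B q `<=` plane U >] then B q else set0).
  apply/seteqP; split => [[x y] Uxy|w [q _]]; last by case: asboolP => // + Bw; exact.
  have [r r0 rU] := oU _ Uxy.
  have [q3] : exists q, ratr q \in `]r / 8, r / 4[ by apply: rat_in_itvoo; lra.
  rewrite in_itv /= => /andP[s8 s4].
  have [q1] : exists q, ratr q \in `]x - r / 8, x + r / 8[ by apply: rat_in_itvoo; lra.
  rewrite in_itv /= => /andP[q11 q12].
  have [q2] : exists q, ratr q \in `]y - r / 8, y + r / 8[ by apply: rat_in_itvoo; lra.
  rewrite in_itv /= => /andP[q21 q22].
  exists ((q1, q2), q3) => //; rewrite asboolT.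
    by split; rewrite /= in_itv /=; lra.
  move=> [x' y'] [] /=; rewrite !in_itv /= => /andP[? ?] /andP[? ?].
  apply: rU; apply: le_lt_trans (normc_ReIm _) _ => /=.
  have : `|x' - x| < r / 2 by rewrite ltr_norml; lra.
  have : `|y' - y| < r / 2 by rewrite ltr_norml; lra.
  lra.
apply: countable_bigcupT_measurable => // q.
by case: ifP => _; [exact: box_measurable|exact: measurable0].
Qed.

Definition ccont (F : C -> R) z := forall e, 0 < e -> exists2 d, 0 < d &
  forall z', normc (z' - z) < d -> `|F z' - F z| < e.

Lemma ccont_measurable U (F : C -> R) : copen U -> (forall z, U z -> ccont F z) ->
  measurable_fun (plane U) (fun w => F (w.1 +i* w.2)).
Proof.
move=> oU cF mU; apply: (measurability _ (RGenOInfty.measurableE R)) => // _ [_ [a ->] <-].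
rewrite (_ : _ `&` _ = plane [set z | U z /\ a < F z]); last first.
  by apply/seteqP; split => w [] /=; rewrite in_itv /= ?andbT.
apply: copen_measurable => z [Uz aF].
have [r r0 rU] := oU z Uz.
have Fa : 0 < F z - a by rewrite subr_gt0.
have [d d0 dF] := cF z Uz _ Fa.
exists (Num.min r d); first by rewrite lt_min r0.
move=> z'; rewrite /ocdisc /= lt_min => /andP[z'r /dF]; rewrite ltr_norml => /andP[? ?].
by split; [exact: rU|lra].
Qed.

Lemma ccont_normc z : ccont (@normc R) z.
Proof.
move=> e e0; exists e => // z'; apply: le_lt_trans.
have := normc_le_dist z z'; have := normc_le_dist z' z.
by rewrite normc_distC ler_norml; lra.
Qed.

Lemma holo_ccont (f : C -> C) z : holo f z -> ccont (fun z => normc (f z)) z.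
Proof.
move=> [l /cdiff_continuous cf] e /cf[d d0 dP]; exists d => // z' /dP.
rewrite [z + _]addrC subrK; apply: le_lt_trans.
have := normc_le_dist (f z) (f z'); have := normc_le_dist (f z') (f z).
by rewrite [normc (f z - _)]normc_distC ler_norml; lra.
Qed.

Lemma integral_ge_box (A : set (R * R)) (g : R * R -> R) a b s k :
  measurable A -> measurable_fun A g -> (forall w, A w -> 0 <= g w) ->
  0 <= s -> 0 <= k -> box a b s `<=` A -> (forall w, box a b s w -> k <= g w) ->
  ((k * (4 * s ^+ 2))%:E <= \int[mu2]_(w in A) (g w)%:E)%E.
Proof.
move=> mA mg g0 s0 k0 BA kg.
have mB := box_measurable a b s.
apply: (@le_trans _ _ (\int[mu2]_(w in box a b s) (g w)%:E)%E); last first.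
  by apply: ge0_subset_integral => //; exact/measurable_EFinP.
rewrite EFinM -(mu2_box a b s0) -integral_cst //.
apply: ge0_le_integral => //.
apply/measurable_EFinP; exact: measurable_funS mg.
Qed.

(** Compactness is applied to the closed square of half-side [s], whose corners lie within [2 * s]
    of the centre; hence the larger disc in the hypothesis. *)
Lemma ccont_box_bounded (F : C -> R) c s : 0 <= s ->
  (forall z, normc (z - c) <= 2 * s -> ccont F z) ->
  exists M, forall z, normc (z - c) <= s -> F z <= M.
Proof.
move=> s0; case: c => a b cF.
pose A := `[a - s, a + s]%classic `*` `[b - s, b + s]%classic.
have cA : compact A by apply: compact_setX; exact: segment_compact.
have A0 : A !=set0.
  by exists (a, b); split => /=; rewrite in_itv /=; lra.
pose g (w : R * R) := F (w.1 +i* w.2).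
have cg : {within A, continuous g}.
  apply: continuous_in_subspaceT => -[x y]; rewrite inE => -[] /=.
  rewrite !in_itv /= => /andP[? ?] /andP[? ?].
  have zA : normc (x +i* y - a +i* b) <= 2 * s.
    apply: le_trans (normc_ReIm _) _ => /=.
    have : `|x - a| <= s by rewrite ler_norml; lra.
    have : `|y - b| <= s by rewrite ler_norml; lra.
    lra.
  apply/cvgrPdist_lt => e e0; have [d d0 dP] := cF _ zA _ e0.
  exists (ball x (d / 2), ball y (d / 2)).
    by split; apply: nbhsx_ballx; rewrite divr_gt0.
  move=> [x' y'] [] /=; rewrite /ball /= => xd yd; rewrite distrC; apply: dP.
  apply: le_lt_trans (normc_ReIm _) _ => /=.
  by rewrite distrC [`|y' - y|]distrC; lra.
have [w _ wP] := compact_EVT_max A0 cA cg.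
exists (g w) => -[x y] zs; apply: (wP (x, y)); rewrite inE; split => /=; rewrite in_itv /=.
  by have := le_trans (normc_Re _) zs; rewrite /= ler_norml; lra.
by have := le_trans (normc_Im _) zs; rewrite /= ler_norml; lra.
Qed.

End PlaneMeasure.

(** * Weighted integrals and growth on the disc *)

Lemma powR_expr (R : realType) (x c : R) (n : nat) : 0 <= x ->
  (x ^+ n) `^ c = (x `^ c) ^+ n.
Proof. by move=> x0; rewrite -(powR_mulrn n x0) powRAC powR_mulrn // powR_ge0. Qed.

Section WeightedEnergy.
Variable R : realType.
Local Notation C := R[i].
Implicit Types (a p r : R) (z : C) (U : set C) (F : C -> C) (w : R * R).
Local Notation mu2 := ((@lebesgue_measure R) \x (@lebesgue_measure R))%E.

Definition wdens p a F w : R :=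
  (1 - normc (w.1 +i* w.2) ^+ 2) `^ a * normc (F (w.1 +i* w.2)) `^ p.

Definition energy p a F (A : set (R * R)) : \bar R :=
  \int[mu2]_(w in A) (wdens p a F w)%:E.

Lemma wdens_ge0 p a F w : 0 <= wdens p a F w.
Proof. by rewrite mulr_ge0 ?powR_ge0. Qed.

Lemma energy_ge0 p a F A : (0 <= energy p a F A)%E.
Proof. by apply: integral_ge0 => w _; rewrite lee_fin wdens_ge0. Qed.

Lemma measurable_wdens p a F U : copen U -> (forall z, U z -> holo F z) ->
  measurable_fun (plane U) (wdens p a F).
Proof.
move=> oU HF; apply: measurable_funM.
- apply: (measurableT_comp (measurable_powR a)).
  apply: measurable_funB => //; apply: measurable_funX.
  by apply: (ccont_measurable (F := @normc R)) => // z _; exact: ccont_normc.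
- apply: (measurableT_comp (measurable_powR p)).
  by apply: (ccont_measurable (F := fun z => normc (F z)) oU) => z /HF; exact: holo_ccont.
Qed.

Lemma energy_subset p a F (U V : set C) : copen U -> copen V -> V `<=` U ->
  (forall z, U z -> holo F z) -> (energy p a F (plane V) <= energy p a F (plane U))%E.
Proof.
move=> oU oV VU HF; apply: ge0_subset_integral.
- exact: copen_measurable.
- exact: copen_measurable.
- by apply/measurable_EFinP; exact: measurable_wdens.
- by move=> w _; rewrite lee_fin wdens_ge0.
- by move=> w; exact: VU.
Qed.

(* The point where [(s - |z - z0|)^2 |F|^p] is almost maximal sees [|F|] almost
   constant around it, which gives the bound for every exponent [p > 0]. *)
Lemma submean_powR p : 0 < p -> exists2 K, 0 < K & forall F z0 r, 0 < r ->
  (forall z, ocdisc z0 r z -> holo F z) ->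
  ((K * (normc (F z0) `^ p * r ^+ 2))%:E <= energy p 0 F (plane (ocdisc z0 r)))%E.
Proof.
(* The constant satisfies A^p = 8. At a near-maximum [z1] of [h], the value 4 d^2 m^p is at least
   half the supremum, while the weight is at least d^2 within distance [d] of [z1]; so |F|^p <= 8
   m^p there. *)
move=> p0; pose A : R := 8 `^ p^-1.
have A1 : 1 <= A by rewrite -(powRr0 8) ler_powR ?ler1n // invr_ge0 ltW.
have A0 : 0 < A by lra.
have Ap : A `^ p = 8 by rewrite -powRrM mulVf ?gt_eqF // powRr1.
pose K : R := 2^-1 `^ p * (4 * (64 * A) ^- 2) / 128.
have h0 : 0 < (2^-1 : R) `^ p by rewrite powR_gt0 // invr_gt0.
have K0 : 0 < K by rewrite !mulr_gt0 // invr_gt0 // exprn_gt0 // mulr_gt0.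
exists K => // F z0 r r0 HF.
have [Fz0|Fz0] := eqVneq (F z0) 0.
  by rewrite Fz0 normc0 powR0 ?gt_eqF // mul0r mulr0 energy_ge0.
pose s := r / 4; have s0 : 0 < s by rewrite divr_gt0.
have [|B BP] := @ccont_box_bounded R (fun z => normc (F z)) z0 s (ltW s0).
  by move=> z zs; apply: holo_ccont; apply: HF; rewrite /ocdisc /=; rewrite /s in zs; lra.
pose h z := (s - normc (z - z0)) ^+ 2 * normc (F z) `^ p.
pose E := [set h z | z in [set z | normc (z - z0) <= s]].
have hB z : normc (z - z0) <= s -> h z <= s ^+ 2 * B `^ p.
  move=> zs; have ? := normc_ge0 (z - z0); apply: ler_pM.
  - exact: sqr_ge0.
  - exact: powR_ge0.
  - by rewrite ler_sqr ?nnegrE; lra.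
  - by apply: ge0_ler_powR; rewrite ?nnegrE ?normc_ge0 ?(ltW p0) ?(le_trans (normc_ge0 _) (BP _ zs)) ?BP.
have z0s : normc (z0 - z0) <= s by rewrite subrr normc0 ltW.
have Eh : has_sup E.
  split; first by exists (h z0), z0.
  by exists (s ^+ 2 * B `^ p) => _ [z zs <-]; exact: hB.
have hS z : normc (z - z0) <= s -> h z <= sup E.
  by move=> zs; apply: sup_upper_bound => //; exists z.
have hz0 : h z0 = s ^+ 2 * normc (F z0) `^ p by rewrite /h subrr normc0 subr0.
have hz00 : 0 < h z0 by rewrite hz0 mulr_gt0 ?exprn_gt0 ?powR_gt0 ?normc_gt0.
have S0 : 0 < sup E by apply: lt_le_trans (hS _ z0s).
have [_ [z1 z1s <-]] := sup_adherent (divr_gt0 S0 (ltr0Sn _ 1)) Eh.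
rewrite (_ : sup E - sup E / 2 = sup E / 2); last by field.
move=> Sz1.
have hz10 : 0 < h z1 by apply: lt_trans Sz1; rewrite divr_gt0.
pose d := (s - normc (z1 - z0)) / 2.
have dE : s - normc (z1 - z0) = 2 * d by rewrite /d; field.
have d0 : 0 < d.
  rewrite /d divr_gt0 // lt_def subr_ge0 z1s andbT.
  by apply: contraTneq hz10 => dz; rewrite /h dz expr0n mul0r ltxx.
set m := normc (F z1).
have m0 : 0 < m.
  rewrite lt_def normc_ge0 andbT; apply: contraTneq hz10 => mz.
  by rewrite /h -/m mz powR0 ?gt_eqF // mulr0 ltxx.
have hz1 : h z1 = 4 * d ^+ 2 * m `^ p by rewrite /h dE -/m; ring.
have sub1 z : normc (z - z1) < d -> normc (z - z0) <= s - d.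
  by move=> zd; have := normc_dist_trans z z1 z0; lra.
have mp0 : 0 < m `^ p by rewrite powR_gt0.
have FA z : normc (z - z1) < d -> normc (F z) <= A * m.
  move=> zd; rewrite leNgt; apply/negP => AF.
  have : (A * m) `^ p < normc (F z) `^ p.
    by apply: gt0_ltr_powR => //; rewrite nnegrE ?normc_ge0 // mulr_ge0 // ltW.
  rewrite powRM ?(ltW A0) ?(ltW m0) // Ap => AF'.
  have zs := sub1 _ zd.
  have zs' : normc (z - z0) <= s by lra.
  have : d ^+ 2 * normc (F z) `^ p <= h z.
    by rewrite ler_wpM2r ?powR_ge0 // ler_sqr ?nnegrE; lra.
  have := hS _ zs'; have : d ^+ 2 * (8 * m `^ p) < d ^+ 2 * normc (F z) `^ p.
    by rewrite ltr_pM2l // exprn_gt0.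
  by move: Sz1; rewrite hz1; lra.
have subr z : normc (z - z1) < d -> ocdisc z0 r z.
  by move=> /sub1; rewrite /ocdisc /= /s; rewrite /s in s0; lra.
(* The Lipschitz constant of [F] near [z1] is [16 * (A * m) / d], so [F] moves by at most [m / 2]
   over a distance [2 * t]. *)
pose t := d / (64 * A).
have t0 : 0 < t by rewrite divr_gt0 // mulr_gt0.
have td : 2 * t <= d / 32.
  by rewrite /t mulrA ler_pdivrMr ?mulr_gt0 //; have := ler_wpM2l (ltW d0) A1; lra.
have Fm z : normc (z - z1) < 2 * t -> m / 2 <= normc (F z).
  move=> zt.
  have HF1 z' : normc (z' - z1) < d -> holo F z' by move/subr/HF.
  have := holo_lipschitz d0 HF1 FA (z := z1) (w := z).
  rewrite subrr normc0 => /(_ (ltW (divr_gt0 d0 (ltr0Sn _ 1)))) L.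
  have {}L : normc (F z - F z1) <= m / 2.
    apply: le_trans (L _) _; first by lra.
    have -> : m / 2 = 16 * (A * m) / d * (2 * t) by rewrite /t; field; rewrite !gt_eqF.
    by rewrite ler_wpM2l ?(ltW zt) // !mulr_ge0 ?invr_ge0 ?(ltW A0) ?(ltW m0) ?(ltW d0).
  by have := normc_le_dist (F z1) (F z); rewrite normc_distC -/m; lra.
have bsub : box (complex.Re z1) (complex.Im z1) t `<=` plane (ocdisc z1 (2 * t)).
  by have := @box_sub_disc R z1 (2 * t); rewrite mulrAC divff ?mul1r.
have mw : measurable_fun (plane (ocdisc z0 r)) (wdens p 0 F).
  by apply: measurable_wdens => //; exact: ocdisc_open.
have : (((m / 2) `^ p * (4 * t ^+ 2))%:E <= energy p 0 F (plane (ocdisc z0 r)))%E.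
  apply: (@integral_ge_box _ _ _ (complex.Re z1) (complex.Im z1)) => //.
  - by apply: copen_measurable; exact: ocdisc_open.
  - by move=> w _; exact: wdens_ge0.
  - exact: ltW.
  - exact: powR_ge0.
  - by move=> w /bsub wt; apply: subr; apply: lt_le_trans wt _; lra.
  - move=> w /bsub /Fm mF; rewrite /wdens powRr0 mul1r.
    by apply: ge0_ler_powR; rewrite ?nnegrE ?normc_ge0 ?(ltW p0) ?divr_ge0 ?(ltW m0).
apply: le_trans; rewrite lee_fin.
rewrite powRM ?(ltW m0) ?invr_ge0 //.
have -> : m `^ p * 2^-1 `^ p * (4 * t ^+ 2) =
   2^-1 `^ p * (4 * (64 * A) ^- 2) * (d ^+ 2 * m `^ p).
  by rewrite /t; field; rewrite gt_eqF.
have -> : K * (normc (F z0) `^ p * r ^+ 2) =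
   2^-1 `^ p * (4 * (64 * A) ^- 2) * (h z0 / 8).
  by rewrite /K hz0 /s; field; rewrite gt_eqF.
rewrite ler_wpM2l //.
  by rewrite !mulr_ge0 ?powR_ge0 // invr_ge0 exprn_ge0 // mulr_ge0 // ltW.
by have := hS _ z0s; rewrite hz1 in Sz1; lra.
Qed.

End WeightedEnergy.

(** * Growth of functions with finite weighted energy *)

Section DirichletGrowth.
Variable R : realType.
Local Notation C := R[i].
Implicit Types (a b p q r e k : R) (z u c : C) (U V : set C) (f F G : C -> C) (w : R * R).
Local Notation mu2 := ((@lebesgue_measure R) \x (@lebesgue_measure R))%E.
Local Notation D f := (derive1 (f : C^o -> C^o)).

Lemma unit_discE : @unit_disc R = ocdisc 0 1.
Proof. by apply/seteqP; split => z; rewrite /ocdisc /= subr0. Qed.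

Lemma unit_disc_open : copen (@unit_disc R).
Proof. by rewrite unit_discE; exact: ocdisc_open. Qed.

Lemma energyZ_le p a F q b G U k : copen U -> 0 <= k ->
  (forall z, U z -> holo F z) -> (forall z, U z -> holo G z) ->
  (forall w, plane U w -> k * wdens p a F w <= wdens q b G w) ->
  (k%:E * energy p a F (plane U) <= energy q b G (plane U))%E.
Proof.
move=> oU k0 HF HG FG.
have mF : measurable_fun (plane U) (EFin \o wdens p a F).
  by apply/measurable_EFinP; exact: measurable_wdens.
have mG : measurable_fun (plane U) (EFin \o wdens q b G).
  by apply/measurable_EFinP; exact: measurable_wdens.
have mU := copen_measurable oU.
rewrite -ge0_integralZl_EFin //; last by move=> w _; rewrite lee_fin wdens_ge0.
apply: ge0_le_integral => //.
  by move=> w _; rewrite -EFinM lee_fin mulr_ge0 // wdens_ge0.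
  exact: (measurable_funeM _ mF).
Qed.

(** The exponent may have either sign; for [a < 0] the upper bound on [x] is the one that counts,
    hence the minimum. *)
Lemma powR_le_between a (x y s t : R) : 0 < s -> 0 < t -> 0 < y -> s * y <= x -> x <= t * y ->
  Num.min (s `^ a) (t `^ a) * y `^ a <= x `^ a.
Proof.
move=> s0 t0 y0 sx xt; have x0 : 0 < x by apply: lt_le_trans sx; rewrite mulr_gt0.
have [a0|a0] := leP 0 a.
  apply: (@le_trans _ _ (s `^ a * y `^ a)).
    by rewrite ler_wpM2r ?powR_ge0 // ge_min lexx.
  rewrite -powRM ?(ltW s0) ?(ltW y0) //; apply: ge0_ler_powR; rewrite ?nnegrE ?(ltW x0) //.
  by rewrite mulr_ge0 ?(ltW s0) ?(ltW y0).
apply: (@le_trans _ _ (t `^ a * y `^ a)).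
  by rewrite ler_wpM2r ?powR_ge0 // ge_min lexx orbT.
rewrite -powRM ?(ltW t0) ?(ltW y0) // -(opprK a) powRN [leRHS]powRN.
have Na0 : 0 <= - a by rewrite oppr_ge0 ltW.
rewrite lef_pV2 ?posrE ?powR_gt0 ?mulr_gt0 //.
by apply: ge0_ler_powR; rewrite ?nnegrE ?(ltW x0) // mulr_ge0 ?(ltW t0) ?(ltW y0).
Qed.

Lemma powR_min_gt0 a (s t : R) : 0 < s -> 0 < t -> 0 < Num.min (s `^ a) (t `^ a).
Proof. by move=> s0 t0; rewrite lt_min !powR_gt0. Qed.

(** On the disc of radius (1 - |z|) / 2 about [z], the base of the weight lies between 1/2 and 3
    times 1 - |z|, so the weight is comparable to a constant and the unweighted estimate applies. *)
Lemma bergman_growth p a : 0 < p -> exists2 K, 0 < K & forall F,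
  (forall z, unit_disc z -> holo F z) -> forall z, unit_disc z ->
  ((K * (normc (F z) `^ p * (1 - normc z) ^+ 2 * (1 - normc z) `^ a))%:E <=
    energy p a F (plane (@unit_disc R)))%E.
Proof.
move=> p0; have [K K0 KP] := submean_powR p0.
pose k : R := Num.min (2^-1 `^ a) (3 `^ a).
have k0 : 0 < k by apply: powR_min_gt0 => //; rewrite invr_gt0.
exists (K * k / 4); first by rewrite !mulr_gt0.
move=> F HF z; rewrite /unit_disc /= => z1.
pose d := 1 - normc z; have d0 : 0 < d by rewrite subr_gt0.
have sub : ocdisc z (d / 2) `<=` @unit_disc R.
  move=> u; rewrite /ocdisc /unit_disc /= => uz; apply: le_lt_trans (normc_le_dist u z) _.
  by rewrite /d in uz d0 *; lra.
have HFd u : ocdisc z (d / 2) u -> holo F u by move/sub/HF.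
have := KP F z (d / 2) (divr_gt0 d0 (ltr0Sn _ 1)) HFd => L.
apply: le_trans (energy_subset p a unit_disc_open (@ocdisc_open R z (d / 2)) sub HF).
have kd0 : 0 <= k * d `^ a by rewrite mulr_ge0 ?powR_ge0 ?ltW.
have := @energyZ_le p 0 F p a F _ (k * d `^ a) (@ocdisc_open R z (d / 2)) kd0 HFd HFd.
have hyp w : plane (ocdisc z (d / 2)) w -> k * d `^ a * wdens p 0 F w <= wdens p a F w.
  move=> uw; rewrite /wdens powRr0 mul1r ler_wpM2r ?powR_ge0 //.
  have := uw; rewrite /plane /ocdisc /=; set u := _ +i* _ => ud.
  have := normc_le_dist u z; have := normc_le_dist z u.
  rewrite normc_distC => nzu nuz; have := normc_ge0 u => u0.
  have E : 1 - normc u ^+ 2 = (1 - normc u) * (1 + normc u) by ring.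
  have u1 : 0 <= 1 - normc u - d / 2 by rewrite /d in ud d0 *; lra.
  have u2 : 1 - normc u <= 3 / 2 * d by rewrite /d in ud d0 *; lra.
  have u3 : normc u <= 1 by rewrite /d in ud d0 *; lra.
  apply: powR_le_between => //; rewrite ?invr_gt0 // E.
    by have := mulr_ge0 u1 u0; have := mulr_ge0 (ltW d0) u0; rewrite mulrC; lra.
  have n0 : 0 <= 1 - normc u by lra.
  have n2 : 1 + normc u <= 2 by lra.
  by have := ler_wpM2l n0 n2; lra.
move=> /(_ hyp); apply: le_trans.
have -> : K * k / 4 * (normc (F z) `^ p * d ^+ 2 * d `^ a) =
  (k * d `^ a) * (K * (normc (F z) `^ p * (d / 2) ^+ 2)) by field.
by rewrite EFinM lee_wpmul2l // lee_fin.
Qed.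

Lemma sqr_sum_le (n : nat) (x : nat -> R) : (forall i, 0 <= x i) ->
  (\sum_(i < n) x i) ^+ 2 <= n%:R * \sum_(i < n) x i ^+ 2.
Proof.
move=> x0; elim: n => [|n IH]; first by rewrite !big_ord0 expr0n mulr0.
rewrite !big_ord_recr /=; set S := \sum_(i < n) x i in IH *; set Q := \sum_(i < n) _ in IH *.
have Q0 : 0 <= Q by apply: sumr_ge0 => i _; exact: sqr_ge0.
have -> : n.+1%:R = n%:R + 1 :> R by rewrite natr1.
set N : R := n%:R in IH *.
have [n0|n0] := posnP n.
  have N0 : N = 0 by rewrite /N n0.
  by rewrite N0 mul0r in IH *; have := sqr_ge0 S; have := sqr_ge0 (x n); nra.
have N0 : 0 < N by rewrite ltr0n.
suff : 2 * S * x n <= Q + N * x n ^+ 2 by lra.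
rewrite -(ler_pM2l N0); have := sqr_ge0 (S - N * x n); lra.
Qed.

(** Cumulative energies, so that annuli become differences and their sums telescope; [fine] loses
    nothing once the total energy is finite. *)
Definition vdisc F (n : nat) : R := fine (energy 2 0 F (plane (ocdisc 0 (1 - 2^-1 ^+ n)))).

Section VDisc.
Variable F : C -> C.
Hypothesis HF : forall z, unit_disc z -> holo F z.
Hypothesis EF : (energy 2 0 F (plane (@unit_disc R)) < +oo)%E.

Let p2 n : 0 < (2^-1 : R) ^+ n. Proof. by rewrite exprn_gt0 // invr_gt0. Qed.

Let subn n : ocdisc 0 (1 - 2^-1 ^+ n) `<=` @unit_disc R.
Proof.
by move=> z; rewrite /ocdisc /unit_disc /= subr0 => zn; have := p2 n; lra.
Qed.

Let vE n : energy 2 0 F (plane (ocdisc 0 (1 - 2^-1 ^+ n))) = (vdisc F n)%:E.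
Proof.
rewrite /vdisc fineK // ge0_fin_numE ?energy_ge0 //; apply: le_lt_trans EF.
by apply: energy_subset => //; [exact: unit_disc_open|exact: ocdisc_open].
Qed.

Lemma vdisc_le n : vdisc F n <= fine (energy 2 0 F (plane (@unit_disc R))).
Proof.
rewrite -lee_fin -vE fineK; last by rewrite ge0_fin_numE ?energy_ge0.
by apply: energy_subset => //; [exact: unit_disc_open|exact: ocdisc_open].
Qed.

(** The disc of radius (1 - |z|) / 2 about [z] misses the disc of radius 1 - 2^-i about 0 and stays
    in that of radius 1 - 2^-(i+3). Its radius is at least 2^-i / 8, which explains the 64 in the
    constant. *)
Lemma annulus_energy : exists2 K, 0 < K & forall i z,
  2^-1 ^+ i.+2 <= 1 - normc z -> 1 - normc z <= 2^-1 ^+ i.+1 ->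
  (K * normc (F z) * 2^-1 ^+ i) ^+ 2 <= vdisc F i.+3 - vdisc F i.
Proof.
have [K K0 KP] := @submean_powR R 2 (ltr0Sn _ 1).
exists (Num.sqrt (K / 64)); first by rewrite sqrtr_gt0 divr_gt0.
move=> i z zl zu; pose r := (1 - normc z) / 2.
have E1 : 2^-1 ^+ i = 2 * 2^-1 ^+ i.+1 :> R by rewrite exprS; field.
have E2 : 2^-1 ^+ i = 4 * 2^-1 ^+ i.+2 :> R by rewrite !exprS; field.
have E3 : 2^-1 ^+ i = 8 * 2^-1 ^+ i.+3 :> R by rewrite !exprS; field.
have i0 := p2 i.
have r0 : 0 < r by rewrite /r; lra.
have sub : ocdisc z r `<=` ocdisc 0 (1 - 2^-1 ^+ i.+3).
  move=> u; rewrite /ocdisc /= subr0 /r => uz.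
  by apply: le_lt_trans (normc_le_dist u z) _; lra.
have disj : [disjoint plane (ocdisc 0 (1 - 2^-1 ^+ i)) & plane (ocdisc z r)].
  apply/disj_setPS => w [ui uz]; pose u : C := w.1 +i* w.2.
  have {}ui : normc u < 1 - 2^-1 ^+ i by rewrite -[u]subr0; exact: ui.
  have {}uz : normc (z - u) < r by rewrite normc_distC; exact: uz.
  by have := normc_le_dist z u; rewrite /r in uz; lra.
have sub' : plane (ocdisc 0 (1 - 2^-1 ^+ i)) `|` plane (ocdisc z r) `<=`
    plane (ocdisc 0 (1 - 2^-1 ^+ i.+3)).
  move=> w [ui|/sub //]; apply: lt_le_trans ui _; lra.
have mw : measurable_fun (plane (ocdisc 0 (1 - 2^-1 ^+ i.+3))) (EFin \o wdens 2 0 F).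
  apply/measurable_EFinP; apply: (measurable_wdens 2 0 (@ocdisc_open R 0 (1 - 2^-1 ^+ i.+3))).
  by move=> u /subn /HF.
have mo c s : measurable (plane (@ocdisc R c s)) by apply: copen_measurable; exact: ocdisc_open.
pose A0 : set (R * R) := plane (ocdisc 0 (1 - 2^-1 ^+ i)).
pose A3 : set (R * R) := plane (ocdisc 0 (1 - 2^-1 ^+ i.+3)).
have : (energy 2 0 F (A0 `|` plane (ocdisc z r)) <= energy 2 0 F A3)%E.
  apply: ge0_subset_integral => //; [by apply: measurableU; exact: mo|exact: mo|].
  by move=> w _; rewrite lee_fin wdens_ge0.
rewrite {1}/energy ge0_integral_setU //; last 4 first.
- exact: mo.
- exact: mo.
- by apply: measurable_funS mw.
- by move=> w _; rewrite lee_fin wdens_ge0.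
rewrite -!/(energy _ _ _ _) !vE => L.
have := KP F z r r0 (fun u uz => HF (subn (sub u uz))) => L2.
have {L} := le_trans (leeD2l (vdisc F i)%:E L2) L.
rewrite -EFinD lee_fin => L.
have -> : (Num.sqrt (K / 64) * normc (F z) * 2^-1 ^+ i) ^+ 2 =
    K * normc (F z) ^+ 2 * (2^-1 ^+ i / 8) ^+ 2.
  by rewrite !exprMn sqr_sqrtr ?divr_ge0 ?(ltW K0) //; field.
rewrite -powR_mulrn ?normc_ge0 // -mulrA.
have : K * (normc (F z) `^ 2 * (2^-1 ^+ i / 8) ^+ 2) <= K * (normc (F z) `^ 2 * r ^+ 2).
  rewrite ler_wpM2l ?(ltW K0) // ler_wpM2l ?powR_ge0 //.
  have r8 : 2^-1 ^+ i / 8 <= r by rewrite /r; lra.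
  have i8 : 0 <= 2^-1 ^+ i / 8 :> R by rewrite divr_ge0 // ltW.
  by rewrite ler_sqr ?nnegrE // ltW.
lra.
Qed.

Lemma vdisc_mono n m : (n <= m)%N -> vdisc F n <= vdisc F m.
Proof.
move=> nm; rewrite -lee_fin -!vE; apply: energy_subset; [exact: ocdisc_open|exact: ocdisc_open| |].
  move=> z; rewrite /ocdisc /= subr0 => zn; apply: lt_le_trans zn _.
  by rewrite lerB // ler_wiXn2l // ?invr_ge0 // invf_le1 // ler1n.
by move=> z /subn /HF.
Qed.

End VDisc.

(** Along a ray, the increment of [f] across a dyadic annulus is bounded by the square root of the
    energy nearby, and Cauchy-Schwarz over [n] annuli bounds the squared total by [n] times the
    energy met. Starting from an annulus [m] beyond which little energy is left makes the factor of
    [n] as small as desired. *)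
Lemma dirichlet_growth f : (forall z, unit_disc z -> holo f z) ->
  (energy 2 0 (D f) (plane (@unit_disc R)) < +oo)%E ->
  forall e, 0 < e -> exists B, forall n z, normc z <= 1 - 2^-1 ^+ n ->
  normc (f z) ^+ 2 <= B + e * n%:R.
Proof.
move=> Hf Ef e e0.
have HF z : unit_disc z -> holo (D f) z.
  move=> /unit_disc_open[r r0 rU]; apply: (holo_derive1 r0) => u ur; exact/Hf/rU.
have p2 n : 0 < (2^-1 : R) ^+ n by rewrite exprn_gt0 // invr_gt0.
have [K K0 KP] := annulus_energy HF Ef.
pose v := vdisc (D f).
have vhs : has_sup (range v).
  split; first by exists (v 0%N), 0%N.
  by exists (fine (energy 2 0 (D f) (plane (@unit_disc R)))) => _ [n _ <-]; exact: vdisc_le.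
have vS n : v n <= sup (range v) by apply: sup_upper_bound => //; exists n.
(* The tail is counted three times, (2 / K)^2 comes from the increments and a last factor 2 from
   squaring a sum; together they turn [e1] into [e]. *)
pose e1 := e * (K / 2) ^+ 2 / 6.
have e10 : 0 < e1 by rewrite !mulr_gt0 // ?invr_gt0.
have [_ [m _ <-] vm] := sup_adherent e10 vhs.
pose rho n : R := 1 - 2^-1 ^+ n.+1.
have rho0 n : 0 < rho n.
  have : 2^-1 ^+ n.+1 <= 2^-1 :> R.
    by rewrite exprS ler_piMr ?invr_ge0 // exprn_ile1 ?invr_ge0 // invf_le1 // ler1n.
  by rewrite /rho; lra.
have rho1 n : rho n < 1 by rewrite /rho; have := p2 n.+1; lra.
have [B0 BP] : exists B, forall z, normc z <= rho m -> normc (f z) <= B.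
  have [k k0 kP] := @bergman_growth 2 0 (ltr0Sn _ 1).
  pose E := fine (energy 2 0 (D f) (plane (@unit_disc R))).
  pose M := Num.sqrt (E / k) / (1 - rho m).
  have DM z : normc (z - 0) <= rho m -> normc (D f z) <= M.
    rewrite subr0 => zm; have z1 := le_lt_trans zm (rho1 m).
    have := kP _ HF z z1; rewrite powRr0 mulr1.
    rewrite -[X in (_ <= X)%E]fineK ?ge0_fin_numE ?energy_ge0 // lee_fin -/E powR_mulrn ?normc_ge0 //.
    rewrite -exprMn mulrC -ler_pdivlMr // => L.
    rewrite /M ler_pdivlMr ?subr_gt0 //.
    apply: (@le_trans _ _ (normc (D f z) * (1 - normc z))).
      by rewrite ler_wpM2l ?normc_ge0 // lerB.
    rewrite -[leLHS]ger0_norm ?mulr_ge0 ?normc_ge0 ?subr_ge0 ?(ltW z1) // -sqrtr_sqr.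
    by rewrite ler_sqrt // (le_trans _ L) // sqr_ge0.
  exists (normc (f 0) + 2 * M) => z zm.
  have M0 : 0 <= M by apply: le_trans (normc_ge0 _) (DM z _); rewrite subr0.
  have L : normc (f z - f 0) <= 2 * M * normc (z - 0).
    apply: (holo_mean_value (z0 := 0) (r := rho m)) => //.
    - by move=> u; rewrite subr0 => um; apply: Hf; apply: le_lt_trans um (rho1 m).
    - by rewrite subrr normc0 ltW.
    - by rewrite subr0.
  rewrite subr0 in L.
  apply: le_trans (normc_le_dist _ (f 0)) _; rewrite lerD2l; apply: le_trans L _.
  by apply: ler_piMr; [exact: mulr_ge0|exact: le_trans zm (ltW (rho1 m))].
pose c i := v (m + i).+3 - v (m + i)%N.
have c0 i : 0 <= c i.
  by rewrite subr_ge0; apply: (vdisc_mono HF Ef); rewrite -[X in (X <= _)%N]addn0 -addn3 leq_add2l.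
pose x i := Num.sqrt (c i).
have x0 i : 0 <= x i by exact: sqrtr_ge0.
have Ff i z : rho (m + i)%N <= normc z -> normc z <= rho (m + i).+1 ->
    normc (D f z) <= x i / K * 2 ^+ (m + i).
  move=> zl zu; have := KP (m + i)%N z; rewrite /rho in zl zu.
  case: leP => [_|]; last by lra.
  case: leP => [_|]; last by lra.
  move=> /(_ isT isT) L.
  have {}L : K * normc (D f z) * 2^-1 ^+ (m + i) <= x i.
    rewrite -[leLHS]ger0_norm ?mulr_ge0 ?normc_ge0 ?(ltW K0) ?(ltW (p2 _)) // -sqrtr_sqr.
    by rewrite ler_sqrt.
  rewrite exprVn ler_pdivrMr ?exprn_gt0 // in L.
  by rewrite mulrAC ler_pdivlMr // mulrC.
have linE (t s : R) (z : C) : t%:C * z + s%:C * (z - t%:C * z) = (t + s * (1 - t))%:C * z.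
  by case: z => a b; apply/eqP; rewrite eq_complex /=; apply/andP; split; apply/eqP; ring.
have step (k : nat) z : normc z <= rho (m + k)%N ->
    normc (f z) <= B0 + 2 / K * \sum_(i < k) x i.
  elim: k z => [|k IH] z; first by rewrite addn0 big_ord0 mulr0 addr0; exact: BP.
  rewrite addnS big_ord_recr /= mulrDr addrA => zk.
  have K20 : 0 <= 2 / K by rewrite divr_ge0 // ltW.
  have [zk'|zk'] := leP (normc z) (rho (m + k)%N).
    by apply: le_trans (IH z zk') _; rewrite lerDl mulr_ge0.
  have z0 : 0 < normc z by apply: lt_trans zk'.
  (* [t%:C * z] is the radial projection of [z] to the previous circle; the segment from it to [z]
     stays in one annulus. *)
  pose t := rho (m + k)%N / normc z.
  have t0 : 0 < t by rewrite divr_gt0.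
  have t1 : t < 1 by rewrite ltr_pdivrMr // mul1r.
  have tz : normc (t%:C * z) = rho (m + k)%N.
    by rewrite normcM normc_real gtr0_norm // /t divfK // gt_eqF.
  have L1 : normc (f z - f (t%:C * z)) <= 2 * (x k / K * 2 ^+ (m + k)) * normc (z - t%:C * z).
    have := @cdiff_mean_value R f (t%:C * z) (z - t%:C * z) (x k / K * 2 ^+ (m + k)).
    rewrite [_ + (z - _)]addrC subrK; apply => s /andP[s0 s1].
    have E : t%:C * z + s%:C * (z - t%:C * z) = (t + s * (1 - t))%:C * z.
      exact: linE.
    have tt0 : 0 <= s * (1 - t) by rewrite mulr_ge0 // subr_ge0 ltW.
    have tt1 : s * (1 - t) <= 1 - t by rewrite ler_piMl // subr_ge0 ltW.
    have N : normc ((t + s * (1 - t))%:C * z) = (t + s * (1 - t)) * normc z.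
      by rewrite normcM normc_real ger0_norm // addr_ge0 // ltW.
    have NL : rho (m + k)%N <= normc ((t + s * (1 - t))%:C * z).
      by rewrite N -tz normcM normc_real gtr0_norm // ler_wpM2r ?normc_ge0 // lerDl.
    have NU : normc ((t + s * (1 - t))%:C * z) <= rho (m + k).+1.
      by rewrite N; apply: le_trans zk; rewrite ler_piMl ?normc_ge0 //; lra.
    rewrite E; exists (D f ((t + s * (1 - t))%:C * z)); last exact: Ff.
    by apply: holo_cdiff; apply: Hf; apply: le_lt_trans NU (rho1 _).
  have L2 : normc (z - t%:C * z) <= 2^-1 ^+ (m + k).+2.
    have -> : z - t%:C * z = (1 - t)%:C * z by rewrite rmorphB rmorph1 /=; ring.
    rewrite normcM normc_real ger0_norm ?subr_ge0 ?(ltW t1) // mulrBl mul1r.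
    rewrite -[t * normc z](_ : rho (m + k)%N = _); last by rewrite /t divfK // gt_eqF.
    have : 2^-1 ^+ (m + k).+1 = 2 * 2^-1 ^+ (m + k).+2 :> R by rewrite (exprS _ (m + k).+1); field.
    by rewrite /rho in zk *; lra.
  have L3 : 2 * (x k / K * 2 ^+ (m + k)) * normc (z - t%:C * z) <= 2 / K * x k.
    have -> : 2 / K * x k = 2 * (x k / K * 2 ^+ (m + k)) * 2^-1 ^+ (m + k).
      by rewrite exprVn; field; rewrite expf_neq0 // gt_eqF.
    rewrite ler_wpM2l //.
      by rewrite mulr_ge0 // mulr_ge0 ?exprn_ge0 // divr_ge0 // ltW.
    apply: le_trans L2 _; apply: ler_wiXn2l; rewrite ?invr_ge0 ?invf_le1 ?ler1n //.
    by rewrite -addn2 leq_addr.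
  have := IH (t%:C * z); rewrite tz lexx => /(_ isT) IHt.
  by apply: le_trans (normc_le_dist _ (f (t%:C * z))) _; lra.
(* Each [c i] spans three consecutive dyadic annuli, so the sum telescopes to three differences,
   each at most [e1] by the choice of [m]. *)
have csum (k : nat) : \sum_(i < k) c i <= 3 * e1.
  have E : \sum_(i < k) c i = v (m + k).+2 + v (m + k).+1 + v (m + k)%N - v m.+2 - v m.+1 - v m.
    elim: k => [|k IH]; first by rewrite big_ord0 addn0; ring.
    by rewrite big_ord_recr /= IH /c addnS; ring.
  rewrite E; have := vS (m + k).+2; have := vS (m + k).+1; have := vS (m + k)%N.
  have := vdisc_mono HF Ef (leqnSn m); have := vdisc_mono HF Ef (leqnSn m.+1).
  rewrite -/v; lra.
have B00 : 0 <= B0 by apply: le_trans (normc_ge0 _) (BP 0 _); rewrite normc0 ltW.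
exists (2 * B0 ^+ 2 + 0) => n z zn.
have zm : normc z <= rho (m + n)%N.
  apply: le_trans zn _; rewrite lerB // ler_wiXn2l ?invr_ge0 ?invf_le1 ?ler1n //.
  by rewrite -addSn leq_addl.
have := step n z zm; set S := \sum_(i < n) x i => fS.
have S2 : S ^+ 2 <= n%:R * (3 * e1).
  apply: le_trans (sqr_sum_le _ x0) _; rewrite ler_wpM2l //.
  by under eq_bigr do rewrite sqr_sqrtr //; exact: csum.
have : normc (f z) ^+ 2 <= (B0 + 2 / K * S) ^+ 2 by rewrite ler_sqr ?nnegrE ?normc_ge0 // (le_trans _ fS) ?normc_ge0.
have : (B0 + 2 / K * S) ^+ 2 <= 2 * B0 ^+ 2 + 2 * ((2 / K) ^+ 2 * S ^+ 2).
  by have := sqr_ge0 (B0 - 2 / K * S); lra.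
have : (2 / K) ^+ 2 * S ^+ 2 <= (2 / K) ^+ 2 * (n%:R * (3 * e1)) by rewrite ler_wpM2l ?sqr_ge0.
have -> : (2 / K) ^+ 2 * (n%:R * (3 * e1)) = e / 2 * n%:R.
  by rewrite /e1; field; rewrite gt_eqF.
lra.
Qed.

End DirichletGrowth.

(** * Integrability of the weights *)

Section WeightIntegral.
Variable R : realType.
Local Notation C := R[i].
Implicit Types (a b p q r e k l s : R) (z u c : C) (U V : set C) (f F G : C -> C) (w : R * R).
Local Notation mu := (@lebesgue_measure R).
Local Notation mu2 := (mu \x mu)%E.

Lemma integral_slices_le (m : R -> \bar R) l : 0 <= l -> measurable_fun setT m ->
  (forall x, 0 <= m x)%E -> (forall x, m x <= (2 * l)%:E)%E ->
  (forall x, ~ (-1 <= x <= 1) -> m x = 0%E) -> (\int[mu]_x m x <= (4 * l)%:E)%E.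
Proof.
move=> l0 mm m0 ml mout.
have -> : (\int[mu]_x m x = \int[mu]_(x in `[(-1)%R, 1%R]) m x)%E.
  rewrite [in RHS]integral_mkcond; apply: eq_integral => x _; rewrite /patch.
  case: ifPn => //; rewrite notin_setE /= in_itv /= => /negP xo; apply: mout.
  exact/negP.
apply: (@le_trans _ _ (\int[mu]_(x in `[(-1)%R, 1%R]) (cst (2 * l)%:E x))%E).
  apply: ge0_le_integral => //; exact: measurable_funS mm.
rewrite integral_cst //; have := @lebesgue_measure_itv R `[(-1 : R), 1 : R].
rewrite /= lte_fin => ->; case: ifP => [_|/negbT]; last by rewrite -leNgt => ?; exfalso; lra.
by rewrite -EFinB -EFinM lee_fin; lra.
Qed.

Lemma mu_small (A : set R) t l : 0 <= l -> measurable A -> (forall y, A y -> `|y - t| <= l) ->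
  (mu A <= (2 * l)%:E)%E.
Proof.
move=> l0 mA AP.
have AI : A `<=` [set` `[t - l, t + l]].
  by move=> y /AP; rewrite /= in_itv /= ler_norml; lra.
apply: (@le_trans _ _ (mu [set` `[t - l, t + l]])); first by apply: le_measure; rewrite ?inE.
have := @lebesgue_measure_itv R `[t - l, t + l]; rewrite /= lte_fin => ->.
case: ifP => _; last by rewrite lee_fin mulr_ge0.
by rewrite -EFinB lee_fin; lra.
Qed.

Lemma mu2_xslices_le (A : set (R * R)) l : 0 <= l -> measurable A ->
  (forall w, A w -> -1 <= w.1 <= 1) ->
  (forall x, exists t, forall y, A (x, y) -> `|y - t| <= l) ->
  (mu2 A <= (4 * l)%:E)%E.
Proof.
move=> l0 mA A1 At.
apply: integral_slices_le => //.
- exact: measurable_fun_xsection.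
- move=> x; have [t tP] := At x; apply: (mu_small (t := t)) => //.
    exact: measurable_xsection.
  by move=> y; rewrite /xsection /= inE; exact: tP.
- move=> x xo /=; rewrite (_ : xsection A x = set0) ?measure0 //.
  by apply/seteqP; split => // y; rewrite /xsection /= inE => /A1.
Qed.

(** Horizontal slices compute the other iterated product measure, which agrees with [mu2] by
    uniqueness. *)
Lemma mu2_yslices_le (A : set (R * R)) l : 0 <= l -> measurable A ->
  (forall w, A w -> -1 <= w.2 <= 1) ->
  (forall y, exists t, forall x, A (x, y) -> `|x - t| <= l) ->
  (mu2 A <= (4 * l)%:E)%E.
Proof.
move=> l0 mA A1 At.
rewrite (@product_measure_unique _ _ _ _ _ mu mu (mu \x^ mu)%E) //; last first.
  by move=> X Y mX mY; exact: product_measure2E.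
apply: integral_slices_le => //.
- exact: measurable_fun_ysection.
- move=> y; have [t tP] := At y; apply: (mu_small (t := t)) => //.
    exact: measurable_ysection.
  by move=> x; rewrite /ysection /= inE; exact: tP.
- move=> y yo /=; rewrite (_ : ysection A y = set0) ?measure0 //.
  by apply/seteqP; split => // x; rewrite /ysection /= inE => /A1.
Qed.

(** At a point of the annulus one coordinate exceeds 1/2 in modulus, because 2 (1/2)^2 < (3/4)^2. On
    each of the four resulting pieces, slices in that coordinate are short: two points [v], [v'] of
    a slice have |v^2 - v'^2| <= 1 - r^2 and |v + v'| >= 1. Four pieces of measure at most [4 * l]
    give the constant 32. *)
Lemma unit_disc_annulus_le r : 3 / 4 <= r -> r <= 1 ->
  (mu2 (plane (@unit_disc R `\` ocdisc 0%R r)) <= (32 * (1 - r))%:E)%E.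
Proof.
move=> r34 r1; pose l := 2 * (1 - r); have l0 : 0 <= l by rewrite /l; lra.
pose A : set (R * R) := plane (@unit_disc R `\` ocdisc 0 r).
have AE w : A w -> r ^+ 2 <= w.1 ^+ 2 + w.2 ^+ 2 < 1.
  move=> [u1 u2]; rewrite -sqr_normc_def; apply/andP; split.
    rewrite ler_sqr ?nnegrE ?normc_ge0 //; last by lra.
    by rewrite leNgt; apply/negP => ur; apply: u2; have : normc (w.1 +i* w.2 - 0) < r by rewrite subr0.
  by rewrite expr_lt1 ?normc_ge0.
have mA : measurable A.
  have -> : A = plane (@unit_disc R) `\` plane (ocdisc 0 r) by [].
  by apply: measurableD; apply: copen_measurable; [exact: unit_disc_open|exact: ocdisc_open].
have half (g : C -> R) : (forall z z', `|g z' - g z| <= normc (z' - z)) ->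
    measurable (A `&` plane [set z | 2^-1 < g z]).
  move=> gL; apply: measurableI => //; apply: copen_measurable => z /= gz.
  exists (g z - 2^-1); first by rewrite subr_gt0.
  by move=> z'; rewrite /ocdisc /= => zz'; have := gL z z'; rewrite ler_norml; lra.
have ReL z z' : `|complex.Re z' - complex.Re z| <= normc (z' - z).
  by have := normc_Re (z' - z); case: z z' => [? ?] [].
have ImL z z' : `|complex.Im z' - complex.Im z| <= normc (z' - z).
  by have := normc_Im (z' - z); case: z z' => [? ?] [].
have mRe := half _ ReL; have mIm := half _ ImL.
have mNRe : measurable (A `&` plane [set z | 2^-1 < - complex.Re z]).
  by apply: half => z z'; rewrite -opprD normrN.
have mNIm : measurable (A `&` plane [set z | 2^-1 < - complex.Im z]).
  by apply: half => z z'; rewrite -opprD normrN.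
have A1 (x y : R) : A (x, y) -> -1 <= x <= 1 /\ -1 <= y <= 1.
  move=> /AE /= /andP[_]; have := sqr_ge0 (1 + x); have := sqr_ge0 (1 - x).
  have := sqr_ge0 (1 + y); have := sqr_ge0 (1 - y); have := sqr_ge0 x; have := sqr_ge0 y.
  by split; nra.
have r2 : 1 - r ^+ 2 <= l by rewrite /l; have := sqr_ge0 (1 - r); lra.
have key (v v' o : R) : r ^+ 2 <= o + v ^+ 2 -> o + v ^+ 2 < 1 ->
   r ^+ 2 <= o + v' ^+ 2 -> o + v' ^+ 2 < 1 ->
   (2^-1 < v /\ 2^-1 < v') \/ (2^-1 < - v /\ 2^-1 < - v') -> `|v - v'| <= l.
  move=> h1 h2 h3 h4 h5; have : `|v ^+ 2 - v' ^+ 2| <= l by rewrite ler_norml; lra.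
  rewrite subr_sqr normrM; apply: le_trans; rewrite ler_peMr //.
  by case: h5 => -[? ?]; [rewrite ger0_norm|rewrite ler0_norm]; lra.
have slice (Q : R -> Prop) : (forall v v', Q v -> Q v' -> `|v - v'| <= l) ->
    exists t, forall v, Q v -> `|v - t| <= l.
  move=> Qv; have [[t Qt]|nQ] := pselect (exists t, Q t); first by exists t => v /Qv; exact.
  by exists 0 => v Qv'; case: nQ; exists v.
pose A1' : set (R * R) := A `&` plane [set z | 2^-1 < complex.Im z].
pose A2' : set (R * R) := A `&` plane [set z | 2^-1 < - complex.Im z].
pose A3' : set (R * R) := A `&` plane [set z | 2^-1 < complex.Re z].
pose A4' : set (R * R) := A `&` plane [set z | 2^-1 < - complex.Re z].
have B1 : (mu2 A1' <= (4 * l)%:E)%E.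
  apply: mu2_xslices_le => // [[x y] [/A1[]] //|x].
  apply: slice => v v' [/AE /= /andP[? ?] ?] [/AE /= /andP[? ?] ?].
  by apply: (key _ _ (x ^+ 2)) => //; left.
have B2 : (mu2 A2' <= (4 * l)%:E)%E.
  apply: mu2_xslices_le => // [[x y] [/A1[]] //|x].
  apply: slice => v v' [/AE /= /andP[? ?] ?] [/AE /= /andP[? ?] ?].
  by apply: (key _ _ (x ^+ 2)) => //; right.
have B3 : (mu2 A3' <= (4 * l)%:E)%E.
  apply: mu2_yslices_le => // [[x y] [/A1[]] //|y].
  apply: slice => v v' [/AE /= /andP[? ?] ?] [/AE /= /andP[? ?] ?].
  by apply: (key _ _ (y ^+ 2)); rewrite 1?addrC //; left.
have B4 : (mu2 A4' <= (4 * l)%:E)%E.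
  apply: mu2_yslices_le => // [[x y] [/A1[]] //|y].
  apply: slice => v v' [/AE /= /andP[? ?] ?] [/AE /= /andP[? ?] ?].
  by apply: (key _ _ (y ^+ 2)); rewrite 1?addrC //; right.
have AU : A `<=` (A1' `|` A2') `|` (A3' `|` A4').
  move=> [x y] Axy; have /AE /= /andP[rxy _] := Axy.
  have [y1|y1] := ltP 2^-1 y; first by left; left.
  have [y2|y2] := ltP 2^-1 (- y); first by left; right.
  have [x1|x1] := ltP 2^-1 x; first by right; left.
  have [x2|x2] := ltP 2^-1 (- x); first by right; right.
  have yy : y ^+ 2 <= 2^-1 ^+ 2.
    by rewrite -[leLHS]real_normK ?num_real // ler_sqr ?nnegrE ?invr_ge0 // ler_norml; lra.
  have xx : x ^+ 2 <= 2^-1 ^+ 2.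
    by rewrite -[leLHS]real_normK ?num_real // ler_sqr ?nnegrE ?invr_ge0 // ler_norml; lra.
  have rr : (3 / 4) ^+ 2 <= r ^+ 2 by rewrite ler_sqr ?nnegrE //; lra.
  exfalso; lra.
have m12 : measurable (A1' `|` A2') by exact: measurableU.
have m34 : measurable (A3' `|` A4') by exact: measurableU.
apply: (@le_trans _ _ (mu2 ((A1' `|` A2') `|` (A3' `|` A4')))).
  by apply: le_measure; rewrite ?inE //; exact: measurableU.
apply: (@le_trans _ _ (mu2 (A1' `|` A2') + mu2 (A3' `|` A4'))%E); first exact: measureU2.
apply: (@le_trans _ _ ((mu2 A1' + mu2 A2') + (mu2 A3' + mu2 A4'))%E).
  by apply: leeD; exact: measureU2.
apply: le_trans (leeD (leeD B1 B2) (leeD B3 B4)) _.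
by rewrite -!EFinD lee_fin /l; lra.
Qed.

Lemma energy_le_area p a F (A : set (R * R)) k : measurable A ->
  measurable_fun A (wdens p a F) -> 0 <= k -> (forall w, A w -> wdens p a F w <= k) ->
  (energy p a F A <= k%:E * mu2 A)%E.
Proof.
move=> mA mF k0 Fk; rewrite -integral_cst //.
apply: ge0_le_integral => //.
  by move=> w _; rewrite lee_fin wdens_ge0.
exact/measurable_EFinP.
Qed.

(** Monotone convergence; it reduces finiteness of an energy to uniform bounds on discs compactly
    contained in the unit disc. *)
Lemma energy_exhaust p a F B : (forall z, unit_disc z -> holo F z) ->
  (forall n, energy p a F (plane (ocdisc 0%R (1 - 2^-1 ^+ n)%R)) <= B%:E)%E ->
  (energy p a F (plane (@unit_disc R)) <= B%:E)%E.
Proof.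
move=> HF EB; pose A n : set (R * R) := plane (ocdisc 0 (1 - 2^-1 ^+ n)).
have p2 n : 0 < (2^-1 : R) ^+ n by rewrite exprn_gt0 // invr_gt0.
have subn n : ocdisc 0 (1 - 2^-1 ^+ n) `<=` @unit_disc R.
  by move=> z; rewrite /ocdisc /unit_disc /= subr0 => zn; have := p2 n; lra.
have -> : plane (@unit_disc R) = \bigcup_n A n.
  apply/seteqP; split => [w wd|w [n _ /subn //]].
  set z : C := w.1 +i* w.2; have d0 : 0 < 1 - normc z by rewrite subr_gt0; exact: wd.
  have [m _ /(_ m (leqnn m)) mP] := near_infty_natSinv_expn_lt (PosNum d0).
  exists m => //; suff : normc (z - 0) < 1 - 2^-1 ^+ m by [].
  rewrite subr0; have {}mP : 1 / 2 ^+ m < 1 - normc z := mP.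
  by move: mP; rewrite div1r -exprVn; lra.
have cv : (\int[mu2]_(x in A i) (wdens p a F x)%:E @[i --> \oo] -->
    \int[mu2]_(x in \bigcup_i A i) (wdens p a F x)%:E)%E.
  apply: ge0_nondecreasing_set_cvg_integral.
  - apply/nondecreasing_seqP => n; rewrite subsetEset => w wn.
    by apply: lt_le_trans wn _; rewrite lerB // exprS ler_piMl ?(ltW (p2 n)) // invf_le1 // ler1n.
  - by move=> n; apply: copen_measurable; exact: ocdisc_open.
  - move=> n; apply/measurable_EFinP.
    by apply: (measurable_wdens p a (@ocdisc_open R 0 (1 - 2^-1 ^+ n))) => z /subn /HF.
  - by move=> n w _; rewrite lee_fin wdens_ge0.
rewrite /energy -(cvg_lim _ cv) //.
by apply: lime_le; [exact: cvgP cv|exact: nearW].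
Qed.

Lemma mu2_unit_disc_le : (mu2 (plane (@unit_disc R)) <= 4%:E)%E.
Proof.
have -> : 4 = 4 * 1 ^+ 2 :> R by rewrite expr1n mulr1.
rewrite -(mu2_box 0 0) //; apply: le_measure; rewrite ?inE.
- exact: copen_measurable (@unit_disc_open R).
- exact: box_measurable.
- move=> [x y] xy; split; rewrite /= in_itv /=.
    by have := le_lt_trans (normc_Re _) xy; rewrite ltr_norml /=; lra.
  by have := le_lt_trans (normc_Im _) xy; rewrite ltr_norml /=; lra.
Qed.

(** The integral of the weight, written as the energy of the constant 1 so that it can be a summand
    in [energy_finite_add]. For [s < 0] the weight is at most 2^(-s n) on the n-th dyadic disc while
    the next annulus has area O(2^-n), and the pieces form a geometric series of ratio 2^(-(1 +
    s)). *)
Lemma weight_energy_bounded s : -1 < s ->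
  (energy 2 s (fun=> 1%R) (plane (@unit_disc R)) < +oo)%E.
Proof.
move=> s1; pose F : C -> C := fun=> 1.
have HF (z : C) : unit_disc z -> holo F z by move=> _; exists 0; exact: cdiff_cst.
have wE w : wdens 2 s F w = (1 - normc (w.1 +i* w.2) ^+ 2) `^ s.
  by rewrite /wdens /F normc1 powR1 mulr1.
have W01 (z : C) : unit_disc z -> 1 - normc z <= 1 - normc z ^+ 2 <= 1.
  rewrite /unit_disc /= => z1; have := sqr_ge0 (normc z); have := normc_ge0 z => z0.
  have z10 : 0 <= 1 - normc z by rewrite subr_ge0 ltW.
  have := mulr_ge0 z0 z10; rewrite mulrBr mulr1 -expr2; lra.
have mo c r : measurable (plane (@ocdisc R c r)).
  by apply: copen_measurable; exact: ocdisc_open.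
have unit4 := mu2_unit_disc_le.
have fin_area (A : set (R * R)) k : measurable A -> A `<=` plane (@unit_disc R) ->
    0 <= k -> (forall w, A w -> wdens 2 s F w <= k) -> (energy 2 s F A <= (4 * k)%:E)%E.
  move=> mA Asub k0 Ak; apply: (@le_trans _ _ (k%:E * mu2 A)%E).
    apply: energy_le_area => //; apply: measurable_funS (measurable_wdens 2 s (@unit_disc_open R) HF) => //.
    exact: copen_measurable (@unit_disc_open R).
  rewrite mulrC EFinM lee_wpmul2l ?lee_fin //; apply: le_trans unit4.
  by apply: le_measure; rewrite ?inE //; exact: copen_measurable (@unit_disc_open R).
have [s0|s0] := leP 0 s.
  apply: (@le_lt_trans _ _ (4 * 1)%:E); last by rewrite ltry.
  apply: fin_area => //; first exact: copen_measurable (@unit_disc_open R).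
  move=> w wd; rewrite wE; have /andP[w1 w2] := W01 _ wd.
  have {}w1 := le_trans _ w1.
  have : (1 - normc (w.1 +i* w.2) ^+ 2) `^ s <= 1 `^ s.
    by apply: ge0_ler_powR; rewrite ?nnegrE // w1 // subr_ge0 ltW.
  by rewrite powR1.
pose A : R := 2^-1 `^ s.
have A0 : 0 < A by rewrite powR_gt0 // invr_gt0.
pose q := 2^-1 * A.
have q0 : 0 < q by rewrite mulr_gt0 // invr_gt0.
have q1 : q < 1.
  have -> : q = 2^-1 `^ (1 + s).
    by rewrite powRD ?powRr1 ?invr_ge0 //; apply/implyP => _; rewrite invr_eq0 pnatr_eq0.
  rewrite -[ltRHS](powRr0 2^-1) /powR invr_eq0 pnatr_eq0 /= ltr_expR mul0r.
  rewrite pmulr_rlt0; last by lra.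
  by apply: ln_lt0; rewrite invr_gt0 ltr0n invf_lt1 // ltr1n.
have p2 n : 0 < (2^-1 : R) ^+ n by rewrite exprn_gt0 // invr_gt0.
have p2le1 n : 2^-1 ^+ n <= 1 :> R by rewrite exprn_ile1 ?invr_ge0 // invf_le1 // ler1n.
have subn n : ocdisc 0 (1 - 2^-1 ^+ n) `<=` @unit_disc R.
  by move=> z; rewrite /ocdisc /unit_disc /= subr0 => zn; have := p2 n; lra.
have dens n w : plane (ocdisc 0 (1 - 2^-1 ^+ n)) w -> wdens 2 s F w <= A ^+ n.
  move=> wn; rewrite wE; set z : C := w.1 +i* w.2.
  have zn : normc z < 1 - 2^-1 ^+ n by rewrite -[z]subr0; exact: wn.
  have /andP[z1 _] := W01 z (subn n z wn).
  have -> : A ^+ n = (2^-1 ^+ n) `^ s.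
    have h0 : 0 <= 2^-1 :> R by rewrite invr_ge0.
    by rewrite powR_expr.
  have : ((1 - normc z ^+ 2) `^ (- s))^-1 <= ((2^-1 ^+ n) `^ (- s))^-1.
    rewrite lef_pV2 ?posrE ?powR_gt0 //; last by have := p2 n; lra.
    by apply: ge0_ler_powR; rewrite ?nnegrE; have := p2 n; lra.
  by rewrite -!powRN !opprK.
pose B := 4 * A ^+ 2; pose c := 32 * A * (1 - q)^-1.
have q10 : 0 < 1 - q by rewrite subr_gt0.
have c0 : 0 <= c by rewrite !mulr_ge0 ?invr_ge0 ?(ltW A0) ?(ltW q10).
have An n : 0 <= A ^+ n by rewrite exprn_ge0 // ltW.
(* The shift by 2 puts the inner radius at 3/4 or more, where the area bound for annuli holds. *)
have step n : (energy 2 s F (plane (ocdisc 0%R (1 - 2^-1 ^+ n.+2)%R)) <=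
               (B + c * (1 - q ^+ n))%:E)%E.
  elim: n => [|n IH].
    rewrite expr0 subrr mulr0 addr0; apply: fin_area => //; first by move=> w /subn.
    exact: dens.
  pose D1 : set (R * R) := plane (ocdisc 0 (1 - 2^-1 ^+ n.+2)).
  pose D2 : set (R * R) := plane (ocdisc 0 (1 - 2^-1 ^+ n.+3)).
  have D12 : D1 `<=` D2.
    move=> w wn; apply: lt_le_trans wn _; rewrite lerB // [leLHS]exprS.
    by rewrite ler_piMl ?(ltW (p2 _)) // invf_le1 // ler1n.
  have mD : measurable (D2 `\` D1) by apply: measurableD; exact: mo.
  have mw : measurable_fun D2 (wdens 2 s F).
    by apply: (measurable_wdens 2 s (@ocdisc_open R 0 (1 - 2^-1 ^+ n.+3))) => z /subn /HF.
  have -> : energy 2 s F D2 = (energy 2 s F D1 + energy 2 s F (D2 `\` D1))%E.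
    rewrite -{1}(setDUK D12) {1}/energy ge0_integral_setU //.
    - exact: mo.
    - by rewrite setDUK //; exact/measurable_EFinP.
    - by move=> w _; rewrite lee_fin wdens_ge0.
    - by apply/disj_setPS => w [? []].
  have L2 : (energy 2 s F (D2 `\` D1) <= (A ^+ n.+3 * (32 * 2^-1 ^+ n.+2))%:E)%E.
    apply: (@le_trans _ _ ((A ^+ n.+3)%:E * mu2 (D2 `\` D1))%E).
      apply: energy_le_area => //; first by apply: measurable_funS mw => //; exact: mo.
      by move=> w [/dens].
    rewrite [X in (_ <= X)%E]EFinM lee_wpmul2l ?lee_fin //.
    have r34 : 3 / 4 <= 1 - 2^-1 ^+ n.+2 :> R.
      have -> : 2^-1 ^+ n.+2 = 4^-1 * 2^-1 ^+ n :> R by rewrite !exprS; field.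
      by have := p2le1 n; lra.
    have r1 : 1 - 2^-1 ^+ n.+2 <= 1 :> R by have := p2 n.+2; lra.
    have := unit_disc_annulus_le r34 r1; rewrite [1 - (1 - _)]subKr; apply: le_trans.
    apply: le_measure; rewrite ?inE //.
      have -> : plane (@unit_disc R `\` ocdisc 0 (1 - 2^-1 ^+ n.+2)) = plane (@unit_disc R) `\` D1 by [].
      by apply: measurableD; [exact: copen_measurable (@unit_disc_open R)|exact: mo].
    by move=> w [/subn ? ?]; split.
  apply: le_trans (leeD IH L2) _; rewrite -EFinD lee_fin.
  have -> : c * (1 - q ^+ n.+1) = c * (1 - q ^+ n) + 32 * A * q ^+ n.
    by rewrite exprS /c; field; rewrite gt_eqF.
  have -> : A ^+ n.+3 * (32 * 2^-1 ^+ n.+2) = 32 * A * (q ^+ n * q ^+ 2).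
    by rewrite /q !exprMn !exprS; ring.
  rewrite addrA lerD2l ler_wpM2l ?mulr_ge0 ?(ltW A0) // ler_piMr ?exprn_ge0 ?(ltW q0) //.
  by rewrite exprn_ile1 ?(ltW q0) ?(ltW q1).
apply: (@le_lt_trans _ _ (B + c)%:E); last by rewrite ltry.
apply: energy_exhaust => // n.
have [n2|n2] := leqP 2 n.
  rewrite -(subnK n2) addn2; apply: le_trans (step _) _; rewrite lee_fin lerD2l.
  by rewrite ler_piMr // gerBl exprn_ge0 // ltW.
apply: (@le_trans _ _ (energy 2 s F (plane (ocdisc 0%R (1 - 2^-1 ^+ 2)%R)))).
  apply: energy_subset; [exact: ocdisc_open|exact: ocdisc_open| |by move=> z /subn /HF].
  move=> z; rewrite /ocdisc /= subr0 => zn; apply: lt_le_trans zn _; rewrite lerB //.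
  by rewrite ler_wiXn2l ?invr_ge0 ?invf_le1 ?ler1n // ltnW.
by apply: le_trans (step 0%N) _; rewrite lee_fin lerD2l expr0 subrr mulr0.
Qed.

End WeightIntegral.

(** * Embeddings and the sufficient condition *)

Section Embedding.
Variable R : realType.
Local Notation C := R[i].
Implicit Types (a b p q r e k s : R) (z u : C) (f F G H phi : C -> C) (w : R * R).
Local Notation mu2 := ((@lebesgue_measure R) \x (@lebesgue_measure R))%E.
Local Notation D f := (derive1 (f : C^o -> C^o)).
Local Notation disc := (@unit_disc R).

Lemma energy_finite_le p a F q b G k : 0 < k ->
  (forall z, disc z -> holo F z) -> (forall z, disc z -> holo G z) ->
  (forall w, plane disc w -> wdens q b G w <= k * wdens p a F w) ->
  (energy p a F (plane disc) < +oo)%E -> (energy q b G (plane disc) < +oo)%E.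
Proof.
move=> k0 HF HG FG fin.
have kV : 0 <= k^-1 by rewrite invr_ge0 ltW.
have L : (k^-1%:E * energy q b G (plane disc) <= energy p a F (plane disc))%E.
  apply: energyZ_le => //; first exact: unit_disc_open.
  by move=> w wd; rewrite mulrC ler_pdivrMr // mulrC FG.
have := le_lt_trans L fin.
have := energy_ge0 q b G (plane disc).
case: (energy q b G (plane disc)) => [x| |] //; rewrite ?ltry //.
by rewrite gt0_muley ?lte_fin ?invr_gt0.
Qed.

Lemma energy_finite_add p a F p' a' F' q b G :
  (forall z, disc z -> holo F z) -> (forall z, disc z -> holo F' z) ->
  (forall z, disc z -> holo G z) ->
  (forall w, plane disc w -> wdens q b G w <= wdens p a F w + wdens p' a' F' w) ->
  (energy p a F (plane disc) < +oo)%E -> (energy p' a' F' (plane disc) < +oo)%E ->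
  (energy q b G (plane disc) < +oo)%E.
Proof.
move=> HF HF' HG FG fin fin'.
have mE p0 a0 F0 : (forall z, disc z -> holo F0 z) ->
    measurable_fun (plane disc) (fun w => (wdens p0 a0 F0 w)%:E).
  by move=> HF0; apply/measurable_EFinP; exact: measurable_wdens (@unit_disc_open R) HF0.
apply: (@le_lt_trans _ _ (energy p a F (plane disc) + energy p' a' F' (plane disc))%E); last first.
  by apply: lte_add_pinfty; [exact: fin|exact: fin'].
rewrite /energy -ge0_integralD //=.
- apply: ge0_le_integral => //=.
  + exact: copen_measurable (@unit_disc_open R).
  + by move=> w _; rewrite lee_fin wdens_ge0.
  + exact: mE.
  + by apply: emeasurable_funD; exact: mE.
- exact: copen_measurable (@unit_disc_open R).
- by move=> w _; rewrite lee_fin wdens_ge0.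
- exact: mE.
- by move=> w _; rewrite lee_fin wdens_ge0.
- exact: mE.
Qed.

Lemma unit_disc_weight z : disc z ->
  [/\ 0 < 1 - normc z ^+ 2, 1 - normc z <= 1 - normc z ^+ 2,
      1 - normc z ^+ 2 <= 1 & 1 - normc z ^+ 2 <= 2 * (1 - normc z)].
Proof.
rewrite /unit_disc /= => z1; have z0 := normc_ge0 z.
have z10 : 0 <= 1 - normc z by rewrite subr_ge0 ltW.
have := sqr_ge0 (1 - normc z); have := mulr_ge0 z0 z10; have := sqr_ge0 (normc z).
by split; lra.
Qed.

(** In terms of [A] and [b] this is A^p b <= A^2 + b^(2 / (2 - p)), where A^2 is the energy density:
    if b <= A^(2 - p) the first term dominates, otherwise the second. *)
Lemma young_powR p c (X W : R) : 0 < p -> p < 2 -> 0 < X -> 0 < W ->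
  W `^ (p - 1) * X `^ p <=
  W `^ c * X `^ 2 + W `^ ((p - 1 - c * p / 2) * (2 / (2 - p))).
Proof.
move=> p0 p2 X0 W0.
have Xn : X != 0 by rewrite gt_eqF.
have Wn : W != 0 by rewrite gt_eqF.
pose A := X * W `^ (c / 2); pose b := W `^ (p - 1 - c * p / 2).
have A0 : 0 < A by rewrite mulr_gt0 // powR_gt0.
have b0 : 0 < b by rewrite powR_gt0.
have An : A != 0 by rewrite gt_eqF.
have bn : b != 0 by rewrite gt_eqF.
have D0 r r' : W `^ (r + r') = W `^ r * W `^ r'.
  by rewrite powRD //; apply/implyP.
have DA r r' : A `^ (r + r') = A `^ r * A `^ r'.
  by rewrite powRD //; apply/implyP.
have Db r r' : b `^ (r + r') = b `^ r * b `^ r'.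
  by rewrite powRD //; apply/implyP.
have p2' : 2 - p != 0 by rewrite gt_eqF // subr_gt0.
have E1 : W `^ (p - 1) * X `^ p = A `^ p * b.
  rewrite /A powRM ?powR_ge0 ?(ltW X0) // -powRrM -mulrA -D0 mulrC.
  by congr (_ * W `^ _); field.
have E2 : W `^ c * X `^ 2 = A `^ 2.
  rewrite /A powRM ?powR_ge0 ?(ltW X0) // -powRrM mulrC.
  by congr (_ * W `^ _); field.
have E3 : W `^ ((p - 1 - c * p / 2) * (2 / (2 - p))) = b `^ (2 / (2 - p)).
  by rewrite powRrM.
rewrite E1 E2 E3.
have [bA|Ab] := leP b (A `^ (2 - p)).
  apply: (@le_trans _ _ (A `^ 2)); last by rewrite lerDl powR_ge0.
  have -> : A `^ 2 = A `^ p * A `^ (2 - p) by rewrite -DA; congr (_ `^ _); ring.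
  by rewrite ler_wpM2l ?powR_ge0.
apply: (@le_trans _ _ (b `^ (2 / (2 - p)))); last by rewrite lerDr powR_ge0.
have -> : b `^ (2 / (2 - p)) = b `^ (p / (2 - p)) * b.
  by rewrite -[X in _ = _ * X]powRr1 ?(ltW b0) // -Db; congr (_ `^ _); field.
rewrite ler_wpM2r ?(ltW b0) //.
have -> : A `^ p = (A `^ (2 - p)) `^ (p / (2 - p)).
  by rewrite -powRrM; congr (_ `^ _); field.
by apply: ge0_ler_powR; rewrite ?nnegrE ?powR_ge0 ?(ltW b0) ?(ltW Ab) // divr_ge0 ?(ltW p0) // subr_ge0 ltW.
Qed.

(** The pointwise bound trades the surplus X^(p - 2) for a power of [W]; what is left is W^(1 - c p
    / 2), at most 1 since [c * p <= 2]. *)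
Lemma bloch_powR p c (X W B : R) : 2 <= p -> 0 <= c -> c * p <= 2 -> 0 < X -> 0 < W -> W <= 1 ->
  X `^ 2 * W `^ (2 + c) <= B ->
  W `^ (p - 1) * X `^ p <= B `^ ((p - 2) / 2) * (W `^ c * X `^ 2).
Proof.
move=> p2 c0 cp X0 W0 W1 XB.
have Xn : X != 0 by rewrite gt_eqF.
have Wn : W != 0 by rewrite gt_eqF.
have D0 r r' : W `^ (r + r') = W `^ r * W `^ r'.
  by rewrite powRD //; apply/implyP.
have DX r r' : X `^ (r + r') = X `^ r * X `^ r'.
  by rewrite powRD //; apply/implyP.
have -> : W `^ (p - 1) * X `^ p =
  (X `^ 2 * W `^ (2 + c)) `^ ((p - 2) / 2) * (W `^ c * X `^ 2) * W `^ (1 - c * p / 2).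
  rewrite powRM ?powR_ge0 // -!powRrM.
  have -> : W `^ (p - 1) = W `^ ((2 + c) * ((p - 2) / 2)) * W `^ c * W `^ (1 - c * p / 2).
    by rewrite -!D0; congr (_ `^ _); field.
  have -> : X `^ p = X `^ (2 * ((p - 2) / 2)) * X `^ 2.
    by rewrite -!DX; congr (_ `^ _); field.
  ring.
have B0 : 0 <= B by apply: le_trans XB; rewrite mulr_ge0 ?powR_ge0.
have le1 : W `^ (1 - c * p / 2) <= 1.
  have : W `^ (1 - c * p / 2) <= 1 `^ (1 - c * p / 2).
    by apply: ge0_ler_powR; rewrite ?nnegrE ?(ltW W0) //; lra.
  by rewrite powR1.
apply: (@le_trans _ _ ((X `^ 2 * W `^ (2 + c)) `^ ((p - 2) / 2) * (W `^ c * X `^ 2))).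
  by rewrite ler_piMr // !mulr_ge0 ?powR_ge0.
rewrite ler_wpM2r ?mulr_ge0 ?powR_ge0 //.
by apply: ge0_ler_powR; rewrite ?nnegrE ?mulr_ge0 ?powR_ge0 //; lra.
Qed.

Lemma dirichlet_embedding p c F : 0 < p -> 0 <= c -> c < 1 -> c * p <= 2 ->
  (forall z, disc z -> holo F z) -> (energy 2 c F (plane disc) < +oo)%E ->
  (energy p (p - 1) F (plane disc) < +oo)%E.
Proof.
move=> p0 c0 c1 cp HF fin.
have wdens0 q b w : 0 < q -> normc (F (w.1 +i* w.2)) = 0 -> wdens q b F w = 0.
  by move=> q0 E; rewrite /wdens E powR0 ?gt_eqF // mulr0.
have pos w : normc (F (w.1 +i* w.2)) <> 0 -> 0 < normc (F (w.1 +i* w.2)).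
  by move=> E; rewrite lt_def normc_ge0 andbT; exact/eqP.
have [p2|p2] := leP 2 p.
  have [k k0 kP] := @bergman_growth R 2 c (ltr0Sn _ 1).
  pose E := fine (energy 2 c F (plane disc)).
  pose B := E / k * 2 `^ (2 + c) + 1.
  have E0 : 0 <= E by rewrite fine_ge0 // energy_ge0.
  have B0 : 0 < B by rewrite ltr_wpDl // mulr_ge0 ?powR_ge0 // divr_ge0 // ltW.
  have bound z : disc z -> normc (F z) `^ 2 * (1 - normc z ^+ 2) `^ (2 + c) <= B.
    move=> zd; have := kP F HF z zd; have [W0 W1 W2 W3] := unit_disc_weight zd.
    rewrite -[X in (_ <= X)%E]fineK ?ge0_fin_numE ?energy_ge0 // lee_fin -/E => L.
    have d0 : 0 < 1 - normc z by rewrite subr_gt0.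
    have {}L : normc (F z) `^ 2 * (1 - normc z) `^ (2 + c) <= E / k.
      rewrite ler_pdivlMr // mulrC [(1 - normc z) `^ (2 + c)]powRD; last first.
        by apply/implyP => _; rewrite gt_eqF.
      by rewrite [(1 - normc z) `^ 2]powR_mulrn ?(ltW d0) // [normc (F z) `^ 2 * (_ * _)]mulrA.
    apply: (@le_trans _ _ (E / k * 2 `^ (2 + c))); last by rewrite lerDl.
    apply: (@le_trans _ _ (normc (F z) `^ 2 * (1 - normc z) `^ (2 + c) * 2 `^ (2 + c))).
      rewrite -mulrA ler_wpM2l ?powR_ge0 // -powRM ?(ltW d0) // [_ * 2]mulrC.
      by apply: ge0_ler_powR; rewrite ?nnegrE ?(ltW W0) ?mulr_ge0 ?(ltW d0) // addr_ge0.
    by rewrite ler_wpM2r ?powR_ge0.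
  apply: (@energy_finite_le 2 c F _ _ _ (B `^ ((p - 2) / 2))) => //.
    exact: powR_gt0.
  move=> w wd; have [/wdens0 wE|/pos X0] := pselect (normc (F (w.1 +i* w.2)) = 0).
    by rewrite !wE ?mulr0.
  have [W0 W1 W2 W3] := unit_disc_weight wd.
  by apply: bloch_powR => //; exact: bound.
(* The exponent that Young's inequality leaves on the weight; here [s > -1] amounts to [c < 1]. *)
pose s := (p - 1 - c * p / 2) * (2 / (2 - p)).
have s1 : -1 < s.
  have p2' : 0 < 2 - p by rewrite subr_gt0.
  rewrite /s mulrA ltr_pdivlMr //; have : c * p < p by rewrite gtr_pMl.
  lra.
apply: (@energy_finite_add 2 c F 2 s (fun=> 1)); [exact: HF| |exact: HF| |exact: fin|].
- by move=> z _; exists 0; exact: cdiff_cst.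
- move=> w wd; have [/wdens0 wE|/pos X0] := pselect (normc (F (w.1 +i* w.2)) = 0).
    by rewrite !wE // add0r wdens_ge0.
  have [W0 W1 W2 W3] := unit_disc_weight wd.
  by rewrite {3}/wdens normc1 powR1 mulr1; exact: young_powR.
- exact: weight_energy_bounded.
Qed.

Lemma dyadic_bracket (d : R) : 0 < d -> d <= 1 -> exists n, 2^-1 ^+ n.+1 <= d <= 2^-1 ^+ n.
Proof.
move=> d0 d1; have ex : exists n, 2^-1 ^+ n.+1 <= d.
  have [m _ /(_ m (leqnn m)) mP] := near_infty_natSinv_expn_lt (PosNum d0).
  have {}mP : 1 / 2 ^+ m < d := mP.
  exists m; apply: le_trans (ltW mP); rewrite div1r -exprVn exprS ler_piMl ?exprn_ge0 ?invr_ge0 //.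
  by rewrite invf_le1 // ler1n.
case: (ex_minnP ex) => -[|n] nd nmin; first by exists 0%N; rewrite nd expr0 d1.
exists n.+1; rewrite nd ltW // ltNge; apply/negP => /nmin; by rewrite ltnn.
Qed.

Lemma comp_holo phi f z : holo f z -> holo phi (f z) ->
  holo (phi \o f) z /\ D (phi \o f) z = D phi (f z) * D f z.
Proof.
move=> /holo_cdiff fz /holo_cdiff pz; have := cdiff_comp fz pz => H.
by split; [exists (D phi (f z) * D f z)|exact: cdiff_derive1].
Qed.

Lemma superposition_finite_type phi f A B c : (forall z, holo phi z) -> 0 <= A -> 0 <= B ->
  (forall z, normc (phi z) <= A * expR (B * normc z ^+ 2)) ->
  (forall z, disc z -> holo f z) -> (energy 2 0 (D f) (plane disc) < +oo)%E -> 0 < c ->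
  (energy 2 c (D (phi \o f)) (plane disc) < +oo)%E.
Proof.
move=> Hphi A0 B0 phiAB Hf fin c0.
(* Cauchy's estimate is taken on discs of radius 1, and (|z| + 1)^2 <= 2 |z|^2 + 2 doubles [B]. *)
pose B' := 2 * B; pose A' := 2 * A * expR B'.
have Dphi z : normc (D phi z) <= A' * expR (B' * normc z ^+ 2).
  have zs u : normc (u - z) <= 1 -> normc (phi u) <= A * expR (B' * normc z ^+ 2 + B').
    move=> uz; apply: le_trans (phiAB u) _; rewrite ler_wpM2l // ler_expR /B'.
    have uz1 : normc u <= normc z + 1 by apply: le_trans (normc_le_dist u z) _; rewrite lerD2l.
    have : normc u ^+ 2 <= (normc z + 1) ^+ 2.
      by rewrite ler_sqr ?nnegrE ?normc_ge0 // addr_ge0 ?normc_ge0.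
    have := sqr_ge0 (normc z - 1) => h1 h2.
    have : normc u ^+ 2 <= 2 * normc z ^+ 2 + 2 by lra.
    by move=> /(ler_wpM2l B0); lra.
  have := cauchy_estimate ltr01 (fun u _ => Hphi u) zs (holo_cdiff (Hphi z)).
  rewrite divr1 expRD /A' => L; apply: le_trans L _; rewrite le_eqVlt; apply/orP; left; apply/eqP; ring.
have A'0 : 0 <= A' by rewrite !mulr_ge0 ?expR_ge0.
have B'0 : 0 <= B' by rewrite mulr_ge0.
have ln20 : 0 < ln 2 :> R by rewrite ln_gt0 // ltr1n.
(* With this [e], the factor |phi'(f z)|^2 grows at most like exp(2 B' e n) <= 2^(c n) at distance
   about 2^-n from the circle, and the weight cancels it. The added 1 covers [B' = 0]. *)
pose e := c * ln 2 / (2 * B' + 1).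
have e0 : 0 < e by rewrite divr_gt0 ?mulr_gt0 // ltr_wpDl ?mulr_ge0.
have [M MP] := dirichlet_growth Hf fin e0.
have eB : 2 * B' * e <= c * ln 2.
  rewrite /e mulrA ler_pdivrMr ?ltr_wpDl ?mulr_ge0 // mulrC ler_wpM2l //; last by lra.
  by rewrite mulr_ge0 ?(ltW c0) ?(ltW ln20).
pose K := A' ^+ 2 * 2 `^ c * expR (2 * B' * (M + e)) + 1.
have K0 : 0 < K by rewrite ltr_wpDl // !mulr_ge0 ?sqr_ge0 ?powR_ge0 ?expR_ge0.
have HDf z : disc z -> holo (D f) z.
  move=> /unit_disc_open[r r0 rU]; apply: (holo_derive1 r0) => u ur; exact/Hf/rU.
have HDg z : disc z -> holo (D (phi \o f)) z.
  move=> /unit_disc_open[r r0 rU]; apply: (holo_derive1 r0) => u ur.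
  by have [] := comp_holo (Hf u (rU u ur)) (Hphi (f u)).
apply: (@energy_finite_le 2 0 (D f) _ _ _ K) => // w wd.
rewrite /wdens powRr0 mul1r; set z : C := w.1 +i* w.2.
have {}wd : disc z := wd.
have [_ ->] := comp_holo (Hf z wd) (Hphi (f z)).
rewrite normcM powRM ?normc_ge0 // mulrA ler_wpM2r ?powR_ge0 //.
have [W0 W1 W2 W3] := unit_disc_weight wd.
have d0 : 0 < 1 - normc z by rewrite subr_gt0.
have d1 : 1 - normc z <= 1 by rewrite gerBl normc_ge0.
have [n /andP[nl nu]] := dyadic_bracket d0 d1.
have fz : normc (f z) ^+ 2 <= M + e * n.+1%:R by apply: MP; lra.
have Wc : (1 - normc z ^+ 2) `^ c <= 2 `^ c * expR (- (n%:R * (c * ln 2))).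
  have -> : expR (- (n%:R * (c * ln 2))) = (2^-1 ^+ n) `^ c.
    rewrite /powR expf_eq0 invr_eq0 pnatr_eq0 andbF lnXn ?invr_gt0 // lnV ?posrE //.
    by congr expR; rewrite -mulr_natl; ring.
  rewrite -powRM ?exprn_ge0 ?invr_ge0 //.
  by apply: ge0_ler_powR; rewrite ?nnegrE ?(ltW c0) ?(ltW W0) ?mulr_ge0 ?exprn_ge0 ?invr_ge0 //; lra.
have P2 : normc (D phi (f z)) `^ 2 <= A' ^+ 2 * expR (2 * B' * (M + e * n.+1%:R)).
  rewrite powR_mulrn ?normc_ge0 //.
  apply: (@le_trans _ _ ((A' * expR (B' * normc (f z) ^+ 2)) ^+ 2)).
    by rewrite ler_sqr ?nnegrE ?normc_ge0 ?mulr_ge0 ?expR_ge0.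
  rewrite exprMn ler_wpM2l ?sqr_ge0 // -expRM_natl ler_expR.
  by have := ler_wpM2l B'0 fz; lra.
apply: (@le_trans _ _ (2 `^ c * expR (- (n%:R * (c * ln 2))) * (A' ^+ 2 * expR (2 * B' * (M + e * n.+1%:R))))).
  by apply: ler_pM => //; exact: powR_ge0.
have -> : 2 `^ c * expR (- (n%:R * (c * ln 2))) * (A' ^+ 2 * expR (2 * B' * (M + e * n.+1%:R))) =
   A' ^+ 2 * 2 `^ c * (expR (2 * B' * (M + e * n.+1%:R) - n%:R * (c * ln 2))).
  by rewrite expRD; ring.
apply: (@le_trans _ _ (A' ^+ 2 * 2 `^ c * expR (2 * B' * (M + e)))); last by rewrite lerDl.
rewrite ler_wpM2l ?mulr_ge0 ?sqr_ge0 ?powR_ge0 // ler_expR.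
have := ler_wpM2l (ler0n R n) eB; rewrite -natr1; lra.
Qed.

End Embedding.

(** * Truncated logarithms *)

Section LogKernel.
Variable R : realType.
Local Notation C := R[i].
Implicit Types (a c r e s : R) (z u : C) (w : R * R).
Local Notation mu2 := ((@lebesgue_measure R) \x (@lebesgue_measure R))%E.
Local Notation D f := (derive1 (f : C^o -> C^o)).
Local Notation disc := (@unit_disc R).

(* A partial sum of [- ln (1 - z) / n]: it is at least 1/8 at [1 - 2^-n], while
   its Dirichlet integral is O(1/n). *)
Definition log_kernel n z : C :=
  (n%:R^-1)%:C * \sum_(k < 2 ^ n) (k.+1%:R^-1)%:C * z ^+ k.+1.

(** The derivative of [log_kernel n], up to the factor [n%:R^-1]. *)
Definition geom_sum n z : C := \sum_(k < 2 ^ n) z ^+ k.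

Lemma cdiff_expr n z : cdiff (fun z => z ^+ n) z (n%:R * z ^+ n.-1).
Proof.
elim: n => [|n IH].
  rewrite mul0r; apply: (cdiff_ext_near ltr01 _ (cdiff_cst 1 z)) => u _.
  by rewrite expr0.
have := cdiffM (cdiff_id z) IH; have -> : 1 * z ^+ n + id z * (n%:R * z ^+ n.-1) = n.+1%:R * z ^+ n.
  case: n {IH} => [|n]; first by rewrite mul0r mulr0 addr0.
  by rewrite /= -natr1 exprS; ring.
by apply: (cdiff_ext_near ltr01) => u _; rewrite exprS.
Qed.

Lemma cdiff_sum (n : nat) (f : nat -> C -> C) (l : nat -> C) z :
  (forall k, cdiff (f k) z (l k)) ->
  cdiff (fun z => \sum_(k < n) f k z) z (\sum_(k < n) l k).
Proof.
move=> fl; elim: n => [|n IH].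
  rewrite big_ord0; apply: (cdiff_ext_near ltr01 _ (cdiff_cst 0 z)) => u _.
  by rewrite big_ord0.
rewrite big_ord_recr /=; have := cdiffD IH (fl n).
by apply: (cdiff_ext_near ltr01) => u _; rewrite big_ord_recr.
Qed.

Lemma cdiff_log_kernel n z : cdiff (log_kernel n) z ((n%:R^-1)%:C * geom_sum n z).
Proof.
apply: cdiffZ; apply: (@cdiff_sum _ (fun k z => (k.+1%:R^-1)%:C * z ^+ k.+1)) => k.
have := cdiffZ (k.+1%:R^-1)%:C (@cdiff_expr k.+1 z).
rewrite mulrA fmorphV rmorph_nat mulVf ?mul1r //= ?pnatr_eq0 //.
Qed.

Lemma geom_sum_le_pow n z : normc z <= 1 -> normc (geom_sum n z) <= 2 ^+ n.
Proof.
move=> z1; rewrite /geom_sum; have -> : 2 ^+ n = \sum_(k < 2 ^ n) 1 :> R.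
  by rewrite big_const_ord iter_addr_0 -natrX.
elim/big_rec2: _ => [|k x y _ IH]; first by rewrite normc0.
by apply: le_trans (normcD _ _) _; rewrite lerD // normcX exprn_ile1 // normc_ge0.
Qed.

Lemma geom_sum_le_inv n z : normc z <= 1 -> normc (1 - z) * normc (geom_sum n z) <= 2.
Proof.
move=> z1; rewrite -normcM -opprB mulNr -subrX1 normc_opp.
apply: le_trans (normcB _ _) _; rewrite normc1 normcX.
by have := exprn_ile1 (2 ^ n) (normc_ge0 z) z1; lra.
Qed.

Lemma log_kernel_le n z : normc z < 1 -> normc (log_kernel n z) <= n%:R^-1 / (1 - normc z).
Proof.
move=> z1; rewrite /log_kernel normcM normc_real ger0_norm ?invr_ge0 // ler_wpM2l ?invr_ge0 //.
have d0 : 0 < 1 - normc z by rewrite subr_gt0.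
have z0 := normc_ge0 z.
apply: (@le_trans _ _ (\sum_(k < 2 ^ n) normc z ^+ k)).
  elim/big_rec2: _ => [|k x y _ IH]; first by rewrite normc0.
  apply: le_trans (normcD _ _) _; rewrite lerD // normcM normcX normc_real.
  rewrite ger0_norm ?invr_ge0 // exprS mulrA ler_piMl ?exprn_ge0 // mulr_ile1 ?invr_ge0 ?(ltW z1) //.
  by rewrite invf_le1 // ler1n.
rewrite -div1r ler_pdivlMr // mulrC.
have := subrX1 (normc z) (2 ^ n); rewrite -[normc z - 1]opprB mulNr => /(congr1 -%R).
rewrite opprK => <-; rewrite opprB gerBl exprn_ge0 //.
Qed.

(** Each dyadic block of the harmonic series contributes at least 1/2. *)
Lemma harmonic_dyadic_ge n : n%:R / 2 <= \sum_(k < 2 ^ n) k.+1%:R^-1 :> R.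
Proof.
elim: n => [|n IH]; first by rewrite mul0r sumr_ge0 // => k _; rewrite invr_ge0.
have -> : (2 ^ n.+1 = 2 ^ n + 2 ^ n)%N by rewrite expnS mul2n addnn.
rewrite big_split_ord /= -natr1 mulrDl lerD //.
apply: (@le_trans _ _ (\sum_(k < 2 ^ n) (2 ^+ n.+1)^-1)).
  rewrite big_const_ord iter_addr_0 -[leRHS]mulr_natl natrX exprS invfM mulrCA.
  by rewrite mulfV ?expf_neq0 // mulr1 mul1r.
apply: ler_sum => k _; rewrite lef_pV2 ?posrE ?exprn_gt0 //.
rewrite -natrX ler_nat expnS mul2n -addnn -addnS leq_add2l //.
Qed.

(** Bernoulli's inequality with exponent 2^n gives 1/2, and the remaining factor 2 of the exponent
    squares it. At [dpoint] the powers in the truncated logarithm therefore cost at most a factor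
    4. *)
Lemma bernoulli_half n : 4^-1 <= (1 - 2^-1 ^+ n.+1) ^+ (2 ^ n.+1) :> R.
Proof.
have bern (x : R) (m : nat) : 0 <= x <= 1 -> 1 - m%:R * x <= (1 - x) ^+ m.
  move=> /andP[x0 x1]; elim: m => [|m IH]; first by rewrite mul0r subr0 expr0.
  rewrite exprS -natr1; have x1' : 0 <= 1 - x by rewrite subr_ge0.
  have := ler_wpM2l x1' IH; have := mulr_ge0 (ler0n R m) (mulr_ge0 x0 x0); lra.
have x0 : 0 < 2^-1 ^+ n.+1 :> R by rewrite exprn_gt0 // invr_gt0.
have x1 : 2^-1 ^+ n.+1 <= 1 :> R by rewrite exprn_ile1 ?invr_ge0 // invf_le1 // ler1n.
have := bern (2^-1 ^+ n.+1) (2 ^ n)%N; rewrite (ltW x0) x1 => /(_ isT).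
have -> : (2 ^ n)%:R * 2^-1 ^+ n.+1 = 2^-1 :> R.
  by rewrite natrX exprS mulrCA exprVn mulfV ?mulr1 // expf_neq0.
move=> L; rewrite expnS mulnC exprM.
have h : 2^-1 <= (1 - 2^-1 ^+ n.+1) ^+ (2 ^ n) :> R by lra.
have -> : 4^-1 = 2^-1 ^+ 2 :> R by rewrite expr2 -invfM -natrM.
by rewrite ler_sqr ?nnegrE ?invr_ge0 // exprn_ge0 // subr_ge0.
Qed.

Definition dpoint n : C := (1 - 2^-1 ^+ n)%:C.

Lemma normc_dpoint n : normc (dpoint n) = 1 - 2^-1 ^+ n.
Proof.
rewrite normc_real ger0_norm // subr_ge0 exprn_ile1 ?invr_ge0 //.
by rewrite invf_le1 // ler1n.
Qed.

Lemma log_kernel_dpoint n : (0 < n)%N -> 8^-1 <= normc (log_kernel n (dpoint n)).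
Proof.
case: n => // n _; set x : R := 1 - 2^-1 ^+ n.+1.
have x0 : 0 <= x by rewrite /x -normc_dpoint normc_ge0.
have x1 : x <= 1 by rewrite gerBl exprn_ge0 // invr_ge0.
have -> : log_kernel n.+1 (dpoint n.+1) =
    (n.+1%:R^-1 * \sum_(k < 2 ^ n.+1) k.+1%:R^-1 * x ^+ k.+1)%:C.
  rewrite /log_kernel rmorphM rmorph_sum /=; congr (_ * _).
  by apply: eq_bigr => k _; rewrite rmorphM rmorphXn.
rewrite normc_real ger0_norm; last first.
  by rewrite mulr_ge0 ?invr_ge0 // sumr_ge0 // => k _; rewrite mulr_ge0 ?invr_ge0 ?exprn_ge0.
have : n.+1%:R / 2 * 4^-1 <= \sum_(k < 2 ^ n.+1) k.+1%:R^-1 * x ^+ k.+1.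
  apply: (@le_trans _ _ (\sum_(k < 2 ^ n.+1) k.+1%:R^-1 * 4^-1)).
    by rewrite -mulr_suml ler_wpM2r ?invr_ge0 // harmonic_dyadic_ge.
  apply: ler_sum => k _; rewrite ler_wpM2l ?invr_ge0 //.
  apply: le_trans (bernoulli_half n) _; apply: ler_wiXn2l => //.
rewrite -(ler_pM2l (_ : 0 < n.+1%:R^-1)) ?invr_gt0 //; apply: le_trans.
by rewrite le_eqVlt; apply/orP; left; apply/eqP; field; rewrite ?nat1r ?natr1 pnatr_eq0.
Qed.

(** [i] is the dyadic scale of |1 - z|, stopped at [n]: away from 1 the bound 2 / |1 - z| is used,
    and within 2^-n of 1 the trivial bound 2^n. *)
Lemma geom_sum_sqr_le n z : normc z < 1 -> exists2 i, (i < n.+1)%N &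
  normc (1 - z) < 2 * 2^-1 ^+ i /\ normc (geom_sum n z) ^+ 2 <= 4 * 4 ^+ i.
Proof.
move=> z1; set t := normc (1 - z).
have t2 : t < 2 by have := normcB 1 z; rewrite normc1 -/t; lra.
have E4 m : 4 ^+ m = (2 ^+ m) ^+ 2 :> R by rewrite exprAC; congr (_ ^+ _); rewrite -natrX.
have [tn|tn] := ltP t (2^-1 ^+ n).
  exists n => //; split.
    by apply: lt_le_trans tn _; rewrite ler_peMl ?exprn_ge0 ?invr_ge0 // ler1n.
  have := geom_sum_le_pow n (ltW z1) => G.
  apply: (@le_trans _ _ (4 ^+ n)); last by rewrite ler_peMl ?exprn_ge0 // ler1n.
  by rewrite E4 ler_sqr ?nnegrE ?normc_ge0 ?exprn_ge0.
have ex : exists i, 2^-1 ^+ i <= t by exists n.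
case: (ex_minnP ex) => i it imin.
have i_n : (i < n.+1)%N by rewrite ltnS imin.
exists i => //; split.
  case: i it imin {i_n} => [|i] it imin; first by rewrite expr0 mulr1.
  rewrite exprS mulrA mulfV // mul1r ltNge; apply/negP => /imin.
  by rewrite ltnn.
have t0 : 0 < t by apply: lt_le_trans it; rewrite exprn_gt0 // invr_gt0.
have G : normc (geom_sum n z) <= 2 * 2 ^+ i.
  have := geom_sum_le_inv n (ltW z1); rewrite -/t mulrC -ler_pdivlMr // => G.
  apply: le_trans G _; rewrite ler_wpM2l //.
  by rewrite -[leRHS]invrK -exprVn lef_pV2 ?posrE // exprn_gt0 // invr_gt0.
have -> : 4 * 4 ^+ i = (2 * 2 ^+ i) ^+ 2 :> R by rewrite exprMn -E4; congr (_ * _); rewrite -natrX.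
by rewrite ler_sqr ?nnegrE ?normc_ge0 ?mulr_ge0 ?exprn_ge0.
Qed.

(** At each point the term of its own scale already dominates; summing over all scales makes the
    bound explicit in [w] and integrable as areas of squares. The weight is at most 2 |1 - z| before
    the power [c], hence the factor 4^c 2^(-c i). *)
Lemma log_kernel_wdens n c w : 0 <= c -> plane disc w ->
  wdens 2 c (D (log_kernel n)) w <= \sum_(i < n.+1)
    n%:R^-1 ^+ 2 * (4 * 4 ^+ i) * (4 `^ c * (2^-1 `^ c) ^+ i) * \1_(box 1 0 (2 * 2^-1 ^+ i)) w.
Proof.
move=> c0 wd; set z : C := w.1 +i* w.2.
have {wd}zd : disc z := wd.
have [W0 W1 W2 W3] := unit_disc_weight zd.
have [i i_n [zi Gi]] := geom_sum_sqr_le n zd.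
rewrite (bigD1 (Ordinal i_n)) //= -[leLHS]addr0; apply: lerD; last first.
  by apply: sumr_ge0 => j _; rewrite !mulr_ge0 ?powR_ge0 ?exprn_ge0 ?powR_ge0 ?invr_ge0.
have wbox : box 1 0 (2 * 2^-1 ^+ i) w.
  have ReE : `|1 - w.1| < 2 * 2^-1 ^+ i by apply: le_lt_trans (normc_Re (1 - z)) zi.
  have ImE : `|0 - w.2| < 2 * 2^-1 ^+ i by apply: le_lt_trans (normc_Im (1 - z)) zi.
  by split; rewrite /= in_itv /=; [move: ReE|move: ImE]; rewrite ltr_norml; lra.
rewrite indicE mem_set // mulr1 /wdens -/z (cdiff_derive1 (cdiff_log_kernel n z)).
rewrite normcM normc_real ger0_norm ?invr_ge0 // powR_mulrn ?mulr_ge0 ?normc_ge0 ?invr_ge0 //.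
rewrite exprMn mulrC; apply: ler_pM; rewrite ?powR_ge0 ?mulr_ge0 ?sqr_ge0 ?normc_ge0 //.
  by rewrite ler_wpM2l ?sqr_ge0.
have h0 : 0 <= 2^-1 :> R by rewrite invr_ge0.
rewrite -(powR_expr c i h0) -powRM ?exprn_ge0 ?invr_ge0 //.
apply: ge0_ler_powR; rewrite ?nnegrE ?mulr_ge0 ?exprn_ge0 ?invr_ge0 ?(ltW W0) //.
have : 1 - normc z <= normc (1 - z) by have := normc_le_dist 1 z; rewrite normc1; lra.
lra.
Qed.

Lemma log_kernel_holo n z : holo (log_kernel n) z.
Proof. by eexists; exact: cdiff_log_kernel. Qed.

Lemma holo_derive1_disc f z : (forall z, disc z -> holo f z) -> disc z -> holo (D f) z.
Proof.
by move=> Hf /unit_disc_open[r r0 rU]; apply: (holo_derive1 r0) => u ur; exact/Hf/rU.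
Qed.

(** At scale [i] the unweighted density is of order 4^i on a square of area 16 / 4^i, so all scales
    weigh the same up to the factor 2^(-c i). The remaining sum is n + 1 for [c = 0] and bounded for
    [c > 0]: this is the gap between 1/n and 1/n^2 that separates the two converses. *)
Lemma log_kernel_energy n c : 0 <= c ->
  (energy 2 c (D (log_kernel n)) (plane disc) <=
   (64 * 4 `^ c * n%:R^-1 ^+ 2 * \sum_(i < n.+1) (2^-1 `^ c) ^+ i)%:E)%E.
Proof.
move=> c0.
pose k (i : nat) : R := n%:R^-1 ^+ 2 * (4 * 4 ^+ i) * (4 `^ c * (2^-1 `^ c) ^+ i).
have k0 i : 0 <= k i by rewrite !mulr_ge0 ?powR_ge0 ?exprn_ge0 ?powR_ge0 ?invr_ge0.
have md := copen_measurable (@unit_disc_open R).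
have mb i : measurable (box (1 : R) 0 (2 * 2^-1 ^+ i)) by exact: box_measurable.
have mi i : measurable_fun (plane disc) (fun w => (\1_(box 1 0 (2 * 2^-1 ^+ i)) w)%:E : \bar R).
  apply/measurable_EFinP; apply: measurable_funTS; exact: measurable_indic.
apply: (@le_trans _ _ (\int[mu2]_(w in plane disc)
   \sum_(i < n.+1) ((k i)%:E * (\1_(box 1%R 0%R (2 * 2^-1 ^+ i)) w)%:E))%E).
  apply: ge0_le_integral => //.
  - by move=> w _; rewrite lee_fin wdens_ge0.
  - apply/measurable_EFinP; apply: (measurable_wdens 2 c (@unit_disc_open R)) => z.
    by apply: holo_derive1_disc => u _; exact: log_kernel_holo.
  - by apply: emeasurable_sum => i; exact: (measurable_funeM _ (mi i)).
  - move=> w wd; under eq_bigr do rewrite -EFinM.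
    by rewrite sumEFin lee_fin; exact: log_kernel_wdens.
rewrite ge0_integral_sum //; last 2 first.
- by move=> i; exact: (measurable_funeM _ (mi i)).
- by move=> i w _; rewrite -EFinM lee_fin mulr_ge0.
rewrite mulr_sumr -sumEFin; apply: lee_sum => i _.
rewrite ge0_integralZl_EFin //; last exact: mi.
rewrite integral_indic //; last exact: mb.
apply: (@le_trans _ _ ((k i)%:E * mu2 (box (1 : R)%R 0%R (2 * 2^-1 ^+ i)%R))%E).
  rewrite lee_wpmul2l ?lee_fin //; apply: le_measure; rewrite ?inE.
  - exact: measurableI (mb i) md.
  - exact: mb.
  - by move=> ? [].
rewrite mu2_box ?mulr_ge0 ?exprn_ge0 ?invr_ge0 // -EFinM lee_fin /k.
have -> : (2 * 2^-1 ^+ i) ^+ 2 = 4 * (4 ^+ i)^-1 :> R.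
  have E : 2^-1 ^+ 2 = 4^-1 :> R by rewrite expr2 -invfM -natrM.
  by rewrite exprMn [(2^-1 ^+ i) ^+ 2]exprAC E exprVn; congr (_ * _); rewrite -natrX.
rewrite le_eqVlt; apply/orP; left; apply/eqP.
by move: (n%:R^-1 ^+ 2) => m; field; rewrite expf_neq0 // pnatr_eq0.
Qed.

End LogKernel.

(** * Gliding humps *)

Section GlidingHump.
Variable R : realType.
Local Notation C := R[i].
Implicit Types (c d e r M : R) (z u w a : C) (F G f : C -> C).
Local Notation mu2 := ((@lebesgue_measure R) \x (@lebesgue_measure R))%E.
Local Notation D f := (derive1 (f : C^o -> C^o)).
Local Notation disc := (@unit_disc R).

(** The inequality (x + y)^2 <= 2 x^2 + 2 y^2 under the integral. Its factor 2, repeated at every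
    hump, is beaten by the decay of the tolerances by a factor 4. *)
Lemma energy2_combination c a F1 F2 G (U : set C) : copen U ->
  (forall z, U z -> holo F1 z) -> (forall z, U z -> holo F2 z) -> (forall z, U z -> holo G z) ->
  (forall z, U z -> G z = a * F1 z + F2 z) ->
  (energy 2 c G (plane U) <= (2 * normc a ^+ 2)%:E * energy 2 c F1 (plane U)
                             + 2%:E * energy 2 c F2 (plane U))%E.
Proof.
move=> oU H1 H2 HG GE; have mU := copen_measurable oU.
have mE F0 : (forall z, U z -> holo F0 z) ->
    measurable_fun (plane U) (fun w : R * R => (wdens 2 c F0 w)%:E).
  by move=> HF0; apply/measurable_EFinP; exact: measurable_wdens.
have a0 : 0 <= 2 * normc a ^+ 2 by rewrite mulr_ge0 ?sqr_ge0.
have w0 F0 (w : R * R) : plane U w -> (0 <= (wdens 2 c F0 w)%:E)%E by rewrite lee_fin wdens_ge0.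
rewrite /energy -!ge0_integralZl_EFin //; [|exact: w0|exact: mE|exact: w0|exact: mE].
rewrite -ge0_integralD //; last 4 first.
- by move=> w _; rewrite -EFinM lee_fin mulr_ge0 // wdens_ge0.
- by apply: measurable_funeM; exact: mE.
- by move=> w _; rewrite -EFinM lee_fin mulr_ge0 // wdens_ge0.
- by apply: measurable_funeM; exact: mE.
apply: ge0_le_integral => //.
- exact: w0.
- exact: mE.
- by apply: emeasurable_funD; apply: measurable_funeM; exact: mE.
- move=> w Uw /=; rewrite -!EFinM -EFinD lee_fin /wdens; set z := _ +i* _.
  have -> : G z = a * F1 z + F2 z by exact: GE.
  rewrite !powR_mulrn ?normc_ge0 // [X in _ <= X](_ : _ =
    (1 - normc z ^+ 2) `^ c * (2 * (normc a * normc (F1 z)) ^+ 2 + 2 * normc (F2 z) ^+ 2)).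
    rewrite ler_wpM2l ?powR_ge0 // -normcM.
    apply: (@le_trans _ _ ((normc (a * F1 z) + normc (F2 z)) ^+ 2)).
      by rewrite ler_sqr ?nnegrE ?addr_ge0 ?normc_ge0 // normcD.
    by have := sqr_ge0 (normc (a * F1 z) - normc (F2 z)); lra.
  by rewrite exprMn; ring.
Qed.

Lemma log_kernel_bounded n z : normc z <= 1 -> normc (log_kernel n z) <= 2 ^+ n.
Proof.
move=> z1; rewrite /log_kernel normcM normc_real ger0_norm ?invr_ge0 //.
have S : normc (\sum_(k < 2 ^ n) (k.+1%:R^-1)%:C * z ^+ k.+1) <= 2 ^+ n.
  have -> : 2 ^+ n = \sum_(k < 2 ^ n) 1 :> R.
    by rewrite big_const_ord iter_addr_0 -natrX.
  elim/big_rec2: _ => [|k x y _ IH]; first by rewrite normc0.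
  apply: le_trans (normcD _ _) _; rewrite lerD // normcM normc_real normcX.
  by rewrite ger0_norm ?invr_ge0 // mulr_ile1 ?invr_ge0 ?exprn_ge0 ?normc_ge0 ?invf_le1 ?ler1n ?exprn_ile1 ?normc_ge0.
apply: le_trans S; rewrite ler_piMl ?normc_ge0 //.
by case: n => [|n]; rewrite ?invr0 // invf_le1 // ler1n.
Qed.

Record hump_state := HumpState {
  hump_sum : C -> C; hump_tol : R; hump_index : nat; hump_coef : C }.

Section Construction.
Variables (c k0 : R) (E : nat -> R) (Q Q' : nat -> C -> Prop).
Hypotheses (c0 : 0 <= c) (k00 : 0 < k0).
Hypothesis kernelE : forall n, (0 < n)%N ->
  (energy 2 c (D (log_kernel n)) (plane disc) <= (E n)%:E)%E.
Hypothesis E_ge : forall n, k0 * n%:R^-1 ^+ 2 <= E n.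
Hypothesis Q_open : forall n w, Q n w -> exists2 d, 0 < d &
  forall w', normc (w' - w) <= d -> Q' n w'.
Hypothesis Q_target : forall e N, 0 < e -> exists n w,
  [/\ (N < n)%N, 1 <= normc w, normc w ^+ 2 * E n <= e & Q n w].

(* [w] in [Q n] is a target for the value at [dpoint n], [Q' n] its enlargement,
   and [hump_tol] bounds what all later humps may add: their coefficients decay
   fast enough that the values already reached stay in [Q']. *)
Definition hump_valid s := [/\ forall z, holo (hump_sum s) z,
  exists M, forall z, disc z -> normc (hump_sum s z) <= M & 0 < hump_tol s].

Definition hump_step s s' := hump_valid s -> [/\ hump_valid s',
  forall z, hump_sum s' z = hump_coef s' * log_kernel (hump_index s') z + hump_sum s z,
  hump_tol s' <= hump_tol s / 4 /\ (hump_index s < hump_index s')%N,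
  normc (hump_coef s') / (hump_index s')%:R <= hump_tol s /\
  normc (hump_coef s') ^+ 2 * E (hump_index s') <= hump_tol s &
  forall w, normc (w - hump_sum s' (dpoint R (hump_index s'))) <=
     4 * hump_tol s' * 2 ^+ (hump_index s') -> Q' (hump_index s') w].

Lemma dpoint_in_disc n : disc (dpoint R n).
Proof.
suff : normc (dpoint R n) < 1 by [].
by rewrite normc_dpoint ltrBlDr ltrDl exprn_gt0 // invr_gt0.
Qed.

(** The coefficient [a] makes the new sum take the value [w] at [dpoint n]. As the kernel is at
    least 1/8 there and [1 <= normc w], it is at most [L * normc w]. *)
Lemma hump_step_exists s : {s' | hump_step s s'}.
Proof.
apply: cid; have [[HS [M MP] t0]|nv] := pselect (hump_valid s); last by exists s.
pose t := hump_tol s; pose L := 8 * (1 + M).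
have M0 : 0 <= M by apply: le_trans (normc_ge0 _) (MP _ (dpoint_in_disc 0)).
have L0 : 0 < L by rewrite mulr_gt0 // ltr_pwDl.
(* The first bound keeps the energy of the hump below [t]; the second, through [E_ge], keeps
   [normc a / n%:R] below [t], which controls the hump pointwise. *)
pose e := Num.min (t / L ^+ 2) (k0 * (t / L) ^+ 2).
have tL0 : 0 < t / L by exact: divr_gt0.
have e0 : 0 < e.
  by rewrite lt_min; apply/andP; split; [rewrite divr_gt0 ?exprn_gt0|rewrite mulr_gt0 ?exprn_gt0].
have [n [w [Nn w1 wE Qw]]] := Q_target (hump_index s) e0.
have n0 : (0 < n)%N by apply: leq_trans Nn.
set P := log_kernel n (dpoint R n).
have P8 : 8^-1 <= normc P by exact: log_kernel_dpoint.
have Pn0 : P != 0 by rewrite -normc_gt0; apply: lt_le_trans P8; rewrite invr_gt0.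
pose a := (w - hump_sum s (dpoint R n)) / P.
have aL : normc a <= L * normc w.
  rewrite /a normcM normcV ler_pdivrMr ?normc_gt0 //.
  have A1 : normc (w - hump_sum s (dpoint R n)) <= normc w + M.
    by apply: le_trans (normcB _ _) _; rewrite lerD2l MP //; exact: dpoint_in_disc.
  have A2 : L * normc w * 8^-1 <= L * normc w * normc P.
    by rewrite ler_wpM2l // mulr_ge0 ?normc_ge0 // ltW.
  have A3 := ler_wpM2l M0 w1.
  by rewrite /L in A2 *; lra.
have En0 : 0 <= E n by apply: le_trans (E_ge n); rewrite mulr_ge0 ?sqr_ge0 // ltW.
have a2 : normc a ^+ 2 * E n <= t.
  apply: (@le_trans _ _ ((L * normc w) ^+ 2 * E n)).
    by rewrite ler_wpM2r // ler_sqr ?nnegrE ?normc_ge0 // (le_trans (normc_ge0 _) aL).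
  rewrite exprMn -mulrA mulrC -ler_pdivlMr ?exprn_gt0 //.
  by apply: le_trans wE _; rewrite ge_min lexx.
have a1 : normc a / n%:R <= t.
  have X0 : 0 <= normc a / n%:R by rewrite divr_ge0 ?normc_ge0.
  rewrite -ler_sqr ?nnegrE ?(ltW t0) //.
  apply: (@le_trans _ _ ((L * normc w) ^+ 2 * n%:R^-1 ^+ 2)).
    by rewrite -exprMn ler_sqr ?nnegrE ?ler_wpM2r ?invr_ge0 // mulr_ge0 ?invr_ge0 // (le_trans (normc_ge0 _) aL).
  rewrite -(ler_pM2l k00).
  have S1 : normc w ^+ 2 * (k0 * n%:R^-1 ^+ 2) <= k0 * (t / L) ^+ 2.
    apply: le_trans (_ : _ <= normc w ^+ 2 * E n) _; first by rewrite ler_wpM2l ?sqr_ge0.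
    by apply: le_trans wE _; rewrite ge_min lexx orbT.
  have -> : k0 * ((L * normc w) ^+ 2 * n%:R^-1 ^+ 2) = L ^+ 2 * (normc w ^+ 2 * (k0 * n%:R^-1 ^+ 2)) by ring.
  apply: le_trans (ler_wpM2l (sqr_ge0 L) S1) _.
  by rewrite le_eqVlt; apply/orP; left; apply/eqP; field; rewrite gt_eqF.
have [d d0 dP] := Q_open Qw.
have p2 : 0 < (2 : R) ^+ n by rewrite exprn_gt0.
(* Since [dpoint n] is at distance 2^-n from the circle, later humps move the value there by at most
   [4 * t' * 2 ^+ n], hence by at most [d]. *)
pose t' := Num.min (t / 4) (d / (4 * 2 ^+ n)).
have t'0 : 0 < t' by rewrite lt_min !divr_gt0 // mulr_gt0.
exists (HumpState (fun z => a * log_kernel n z + hump_sum s z) t' n a) => _.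
split => //=.
- split => //=.
  + move=> z; have [l fl] := HS z; eexists.
    by apply: cdiffD fl; apply: cdiffZ; exact: cdiff_log_kernel.
  + exists (normc a * 2 ^+ n + M) => z zd.
    apply: le_trans (normcD _ _) _; rewrite lerD ?MP // normcM ler_wpM2l ?normc_ge0 //.
    by apply: log_kernel_bounded; exact: ltW.
- by split => //; rewrite ge_min lexx.
- move=> w'; rewrite -/P /a divfK // subrK => w't; apply: dP; apply: le_trans w't _.
  have : t' * (4 * 2 ^+ n) <= d by rewrite -ler_pdivlMr ?mulr_gt0 // ge_min lexx orbT.
  lra.
Qed.

(** Pointwise control comes from |log_kernel n| <= 1 / (n (1 - |z|)): the sums and their derivatives
    converge locally uniformly, with explicit errors. The energy of the limit is then bounded on
    each smaller disc by comparison with a partial sum. *)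
Lemma gliding_hump : exists f, [/\ forall z, disc z -> holo f z,
  (energy 2 c (D f) (plane disc) < +oo)%E &
  forall N, exists2 n, (N <= n)%N & Q' n (f (dpoint R n))].
Proof.
have [s [s0 sS]] := dependent_choice hump_step_exists (HumpState (fun=> 0) 1 0%N 0).
have valid k : hump_valid (s k).
  elim: k => [|k IH]; last by have [? _ _ _ _] := sS k IH.
  rewrite s0; split => //=; first by move=> z; exists 0; exact: cdiff_cst.
  exists 0 => z _; suff : normc (0 : C) <= 0 by [].
  by rewrite normc0.
pose S k := hump_sum (s k); pose t k := hump_tol (s k).
pose n k := hump_index (s k); pose a k := hump_coef (s k).
have SS k z : S k.+1 z = a k.+1 * log_kernel (n k.+1) z + S k z by have [_ H _ _ _] := sS k (valid k); exact: H.
have tS k : t k.+1 <= t k / 4 by have [_ _ [H _] _ _] := sS k (valid k); exact: H.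
have nS k : (n k < n k.+1)%N by have [_ _ [_ H] _ _] := sS k (valid k); exact: H.
have aS1 k : normc (a k.+1) / (n k.+1)%:R <= t k by have [_ _ _ [H _] _] := sS k (valid k); exact: H.
have aS2 k : normc (a k.+1) ^+ 2 * E (n k.+1) <= t k by have [_ _ _ [_ H] _] := sS k (valid k); exact: H.
have QS k w : normc (w - S k.+1 (dpoint R (n k.+1))) <= 4 * t k.+1 * 2 ^+ (n k.+1) ->
    Q' (n k.+1) w by have [_ _ _ _ H] := sS k (valid k); exact: H.
have t0 k : 0 < t k by have [] := valid k.
have HS k z : holo (S k) z by have [] := valid k.
have t_small d : 0 < d -> exists k, t k <= d.
  move=> d0; have [m _ /(_ m (leqnn m)) mP] := near_infty_natSinv_expn_lt (PosNum d0).
  have {}mP : 1 / 2 ^+ m < d := mP.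
  exists m; apply: le_trans (ltW mP); rewrite div1r.
  elim: m {mP} => [|m IH]; first by rewrite /t s0 expr0 invr1.
  by apply: le_trans (tS m) _; rewrite exprS invfM; have := t0 m; lra.
(* Subtracting [t (k + j)%N] lets the induction close: a step costs [t (k + j)%N], at most twice the
   drop to the next tolerance. *)
have S_incr k j z : disc z -> normc (S (k + j)%N z - S k z) <=
    2 * (t k - t (k + j)%N) / (1 - normc z).
  move=> zd; have d0 : 0 < 1 - normc z by rewrite subr_gt0.
  elim: j => [|j IH]; first by rewrite addn0 !subrr normc0 mulr0 mul0r.
  rewrite addnS; apply: le_trans (normc_dist_trans _ (S (k + j)%N z) _) _.
  have st : normc (S (k + j).+1 z - S (k + j)%N z) <= t (k + j)%N / (1 - normc z).
    rewrite SS addrK normcM.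
    apply: le_trans (ler_wpM2l (normc_ge0 _) (log_kernel_le _ zd)) _.
    by rewrite mulrA ler_wpM2r ?invr_ge0 ?(ltW d0) // aS1.
  apply: le_trans (lerD st IH) _; rewrite -mulrDl ler_wpM2r ?invr_ge0 ?(ltW d0) //.
  by have := tS (k + j)%N; have := t0 (k + j)%N; lra.
have S_cauchy k j z : disc z -> normc (S (k + j)%N z - S k z) <= 2 * t k / (1 - normc z).
  move=> zd; have d0 : 0 < 1 - normc z by rewrite subr_gt0.
  apply: le_trans (S_incr k j z zd) _; rewrite ler_wpM2r ?invr_ge0 ?(ltW d0) //.
  by have := t0 (k + j)%N; lra.
have lim z : exists l, disc z -> forall k, normc (S k z - l) <= 4 * t k / (1 - normc z).
  have [zd|] := pselect (disc z); last by exists 0.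
  have d0 : 0 < 1 - normc z by rewrite subr_gt0.
  have e0 k : 0 <= 2 * t k / (1 - normc z) by rewrite !mulr_ge0 ?invr_ge0 ?(ltW d0) ?(ltW (t0 k)).
  have [k m|l lP] := @cauchy_limit R (fun k => S k z) (fun k => 2 * t k / (1 - normc z)).
    have [km|/ltnW mk] := leqP k m.
      rewrite -(subnKC km) normc_distC; apply: le_trans (S_cauchy _ _ _ zd) _.
      by rewrite lerDl.
    by rewrite -(subnKC mk); apply: le_trans (S_cauchy _ _ _ zd) _; rewrite lerDr.
  exists l => _ k; apply: le_trans (lP k) _.
  by rewrite le_eqVlt; apply/orP; left; apply/eqP; ring.
have [f fP] := choice lim.
have Df z : disc z -> holo f z /\
    forall k, normc (D (S k) z - D f z) <= 256 * t k / (1 - normc z) ^+ 2.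
  move=> zd; have d0 : 0 < 1 - normc z by rewrite subr_gt0.
  pose r := (1 - normc z) / 2; have r0 : 0 < r by rewrite divr_gt0.
  have sub u : ocdisc z r u -> disc u /\ r <= 1 - normc u.
    rewrite /ocdisc /unit_disc /= => uz; have := normc_le_dist u z.
    by rewrite /r in r0 uz *; split; lra.
  have fS k u : normc (u - z) < r -> normc (S k u - f u) <= 4 * t k / r.
    move=> /sub[ud ru]; apply: le_trans (fP u ud k) _.
    rewrite ler_wpM2l ?mulr_ge0 ?(ltW (t0 k)) // lef_pV2 ?posrE //.
    exact: lt_le_trans ru.
  have e_small d : 0 < d -> exists k, 4 * t k / r <= d.
    move=> d0'; have [|k kP] := t_small (d * r / 4); first by rewrite !mulr_gt0 // invr_gt0.
    by exists k; rewrite ler_pdivrMr //; lra.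
  have [l fl lP] := holo_uniform_limit r0 (fun k u _ => HS k u) fS e_small.
  split; first by exists l.
  move=> k; rewrite (cdiff_derive1 fl); apply: le_trans (lP k) _.
  by rewrite le_eqVlt; apply/orP; left; apply/eqP; rewrite /r; field; rewrite gt_eqF.
exists f; split.
- by move=> z /Df[].
- have HDf z : disc z -> holo (D f) z by apply: holo_derive1_disc => u /Df[].
  have HDS k z : disc z -> holo (D (S k)) z by apply: holo_derive1_disc => u _; exact: HS.
  have HT k j z : disc z -> holo (fun z => D (S (k + j)%N) z - D (S k) z) z.
    move=> zd; have [l1 h1] := HDS (k + j)%N z zd; have [l2 h2] := HDS k z zd.
    by exists (l1 - l2); exact: cdiffB.
  have HK m z : disc z -> holo (D (@log_kernel R m)) z.
    by apply: holo_derive1_disc => u _; exact: log_kernel_holo.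
  have DSS k z : D (S k.+1) z = a k.+1 * D (log_kernel (n k.+1)) z + D (S k) z.
    apply: cdiff_derive1; have -> : S k.+1 = fun z => a k.+1 * log_kernel (n k.+1) z + S k z.
      by apply/funext => u; exact: SS.
    by apply: cdiffD; [apply: cdiffZ; apply: holo_cdiff; exact: log_kernel_holo|apply: holo_cdiff; exact: HS].
  (* The next hump contributes at most [2 * t k], the later ones [2 * (4 * t k.+1)], which is again
     at most [2 * t k]. *)
  have ET j k : (energy 2 c (fun z => (D (S (k + j)%N) z - D (S k) z)%R) (plane disc) <= (4 * t k)%:E)%E.
    elim: j k => [|j IH] k.
      have m := @copen_measurable R disc (@unit_disc_open R).
      rewrite addn0 /energy (eq_integral (cst 0%E)).
        by rewrite integral0 lee_fin mulr_ge0 // ltW.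
      by move=> w _; rewrite /wdens subrr normc0 powR0 ?mulr0.
    have n0 : (0 < n k.+1)%N by exact: leq_trans (nS k).
    apply: le_trans (energy2_combination (a := a k.+1) c (@unit_disc_open R)
      (HK (n k.+1)) (HT k.+1 j) (HT k j.+1) _) _.
      move=> z _; rewrite addnS -addSn [D (S k.+1) z]DSS.
      by move: (D (S (k.+1 + j)%N) z) (D (S k) z) (a k.+1 * _) => x y b; ring.
    apply: le_trans (leeD (lee_wpmul2l _ (kernelE n0)) (lee_wpmul2l _ (IH k.+1))) _.
    - by rewrite lee_fin mulr_ge0 ?sqr_ge0.
    - by rewrite lee_fin.
    rewrite -!EFinM -EFinD lee_fin.
    by have := aS2 k; have := tS k; lra.
  (* On the m-th disc, a partial sum chosen far enough for [m] has derivative within 1 of [D f].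
     Both it and the error have energy at most 4 there, so 2 * 4 + 2 * 4 bounds the energy for every
     [m]. *)
  apply: (@le_lt_trans _ _ 16%:E); last by rewrite ltry.
  apply: energy_exhaust => // m.
  have p2 : 0 < (2^-1 : R) ^+ m by rewrite exprn_gt0 // invr_gt0.
  have [|k kP] := t_small ((2^-1 ^+ m) ^+ 2 / 256); first by rewrite divr_gt0 ?ltr0n // exprn_gt0.
  have subm : ocdisc 0 (1 - 2^-1 ^+ m) `<=` disc.
    by move=> z; rewrite /ocdisc /unit_disc /= subr0 => zn; lra.
  have om := @ocdisc_open R 0 (1 - 2^-1 ^+ m).
  have HEr z : disc z -> holo (fun z => D f z - D (S k) z) z.
    move=> zd; have [l1 h1] := HDf z zd; have [l2 h2] := HDS k z zd.
    by exists (l1 - l2); exact: cdiffB.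
  have HT0 z : disc z -> holo (fun z => D (S (0 + k)%N) z - D (S 0%N) z) z by exact: HT.
  have S00 z : D (S 0%N) z = 0.
    by apply: cdiff_derive1; rewrite /S s0 /=; exact: cdiff_cst.
  apply: le_trans (energy2_combination (a := 1) (F1 := fun z => D (S (0 + k)%N) z - D (S 0%N) z)
    (F2 := fun z => D f z - D (S k) z) c om _ _ _ _) _.
  - by move=> z /subm /HT0.
  - by move=> z /subm /HEr.
  - by move=> z /subm /HDf.
  - by move=> z _; rewrite add0n S00; move: (D f z) (D (S k) z) => x y; ring.
  have E1 : (energy 2 c (fun z => (D (S (0 + k)%N) z - D (S 0%N) z)%R)
       (plane (ocdisc 0%R (1 - 2^-1 ^+ m)%R)) <= 4%:E)%E.
    apply: le_trans (energy_subset 2 c (@unit_disc_open R) om subm HT0) _.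
    by apply: le_trans (ET k 0%N) _; rewrite /t s0 /= mulr1.
  have E2 : (energy 2 c (fun z => (D f z - D (S k) z)%R)
       (plane (ocdisc 0%R (1 - 2^-1 ^+ m)%R)) <= 4%:E)%E.
    have mm : measurable (plane (ocdisc (0 : C) (1 - 2^-1 ^+ m))) := copen_measurable om.
    apply: (@le_trans _ _ (1%:E * mu2 (plane (ocdisc (0 : C)%R (1 - 2^-1 ^+ m)%R)))%E).
      apply: energy_le_area => //.
        by apply: (measurable_wdens 2 c om) => z /subm /HEr.
      move=> w wm; rewrite /wdens; set z : C := w.1 +i* w.2.
      have zm : normc z < 1 - 2^-1 ^+ m by rewrite -[z]subr0; exact: wm.
      have zd : disc z by exact: subm.
      have [W0 W1 W2 W3] := unit_disc_weight zd.
      rewrite powR_mulrn ?normc_ge0 // mulr_ile1 ?powR_ge0 ?sqr_ge0 //.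
        have : (1 - normc z ^+ 2) `^ c <= 1 `^ c.
          by apply: ge0_ler_powR; rewrite ?nnegrE ?(ltW W0).
        by rewrite powR1.
      rewrite exprn_ile1 ?normc_ge0 // normc_distC; have [_ /(_ k) L] := Df z zd.
      apply: le_trans L _; rewrite ler_pdivrMr ?exprn_gt0 ?subr_gt0 // mul1r.
      apply: (@le_trans _ _ ((2^-1 ^+ m) ^+ 2)); first by lra.
      by rewrite ler_sqr ?nnegrE; lra.
    rewrite mul1e; apply: le_trans (@mu2_unit_disc_le R); apply: le_measure; rewrite ?inE //.
      exact: copen_measurable (@unit_disc_open R).
    by move=> w /subm.
  apply: le_trans (leeD (lee_wpmul2l _ E1) (lee_wpmul2l _ E2)) _.
  - by rewrite lee_fin mulr_ge0 ?sqr_ge0.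
  - by rewrite lee_fin.
  by rewrite -!EFinM -EFinD lee_fin normc1; lra.
- move=> N; have nN k : (k <= n k)%N.
    by elim: k => // k IH; apply: leq_ltn_trans IH (nS k).
  exists (n N.+1); first by apply: leq_trans (nN N.+1).
  apply: QS; rewrite normc_distC; apply: le_trans (fP _ (dpoint_in_disc _) N.+1) _.
  by rewrite normc_dpoint subKr exprVn invrK.
Qed.

End Construction.
End GlidingHump.

(** * Order and type *)

Section GrowthOrder.
Variable R : realType.
Local Notation C := R[i].
Implicit Types (r e A B : R) (z w : C) (phi f : C -> C).
Local Notation D f := (derive1 (f : C^o -> C^o)).
Local Notation disc := (@unit_disc R).

Lemma limf_esup_pinfty_lt (g : R -> R) (b : \bar R) :
  (limf_esup (fun r => (g r)%:E) (pinfty_nbhs R) < b)%E ->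
  exists r0, forall r, r0 < r -> ((g r)%:E < b)%E.
Proof.
move=> /ereal_inf_lt[_ [V [r0 [_ r0V]] <-] Vb]; exists r0 => r /r0V Vr.
by apply: le_lt_trans Vb; apply: ereal_sup_ubound; exists r.
Qed.

Lemma limf_esup_pinfty_le (g : R -> R) (b r0 : R) : (forall r, r0 < r -> g r <= b) ->
  (limf_esup (fun r => (g r)%:E) (pinfty_nbhs R) <= b%:E)%E.
Proof.
move=> gb; apply: ge_ereal_inf.
exists (ereal_sup ((fun r => (g r)%:E) @` [set r | r0 < r])).
  by exists [set r | r0 < r] => //; exists r0; split => //; exact: num_real.
by apply: ge_ereal_sup => _ [r rr <-]; rewrite lee_fin gb.
Qed.

Section Entire.
Variable phi : C -> C.
Hypothesis Hphi : forall z, holo phi z.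

Lemma entire_bounded r : exists M, forall z, normc z <= r -> normc (phi z) <= M.
Proof.
have [r0|r0] := leP 0 r; last first.
  by exists 0 => z zr; have := normc_ge0 z; lra.
have [|M MP] := @ccont_box_bounded R (fun z => normc (phi z)) 0 r r0.
  by move=> z _; exact: holo_ccont.
by exists M => z zr; apply: MP; rewrite subr0.
Qed.

Lemma max_modulus_ub z : normc (phi z) <= max_modulus phi (normc z).
Proof.
have [M MP] := entire_bounded (normc z).
apply: ub_le_sup; last by exists z.
by exists M => _ [w wz <-]; apply: MP; rewrite wz.
Qed.

Lemma max_modulus_le r b : 0 <= r -> (forall z, normc z = r -> normc (phi z) <= b) ->
  max_modulus phi r <= b.
Proof.
move=> r0 H; apply: ge_sup; last by move=> _ [z zr <-]; exact: H.
by exists (normc (phi r%:C)), r%:C => //=; rewrite -[LHS]/(normc r%:C) normc_real ger0_norm.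
Qed.

(** For [M <= 1] the inner logarithm is nonpositive and the outer one takes its default value 0, so
    the hypothesis carries no information; the bound is then trivial. *)
Lemma ln_le_pow_growth (M r : R) : 1 < r -> ln (ln M) / ln r < 2 -> M <= expR (r ^+ 2).
Proof.
move=> r1; have lr : 0 < ln r by rewrite ln_gt0.
rewrite ltr_pdivrMr // => L.
have [M0|M0] := leP M 1.
  by apply: le_trans M0 _; rewrite -expR0 ler_expR sqr_ge0.
have lM : 0 < ln M by rewrite ln_gt0.
have Mp : 0 < M by lra.
rewrite -[leLHS]lnK ?posrE // ler_expR -[leLHS]lnK ?posrE //.
have -> : r ^+ 2 = expR (2 * ln r).
  by rewrite mulrC expRM_natr lnK // posrE; lra.
by rewrite ler_expR ltW.
Qed.

(** Order below 2 gives |phi z| <= exp(|z|^2) for large |z|, so both alternatives lead to one kind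
    of bound; [A] absorbs the disc where it does not yet hold. *)
Lemma growth_bound :
  (growth_order phi < 2%:E)%E \/ (growth_order phi = 2%:E /\ (growth_type phi < +oo)%E) ->
  exists A B, [/\ 0 <= A, 0 <= B & forall z, normc (phi z) <= A * expR (B * normc z ^+ 2)].
Proof.
rewrite /growth_type /growth_order; case: asboolP => [[c pc] _|nc H].
  exists (normc c), 0; split; rewrite ?normc_ge0 // => z.
  by rewrite pc mul0r expR0 mulr1.
suff [r0 [B [B0 HB]]] : exists r0 B, 0 <= B /\
    forall z, r0 < normc z -> normc (phi z) <= expR (B * normc z ^+ 2).
  have [M MP] := entire_bounded r0.
  exists (1 + `|M|), B; split => // z.
  have E1 : 1 <= expR (B * normc z ^+ 2) by rewrite -expR0 ler_expR mulr_ge0 ?sqr_ge0.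
  have [zr|zr] := leP (normc z) r0.
    apply: le_trans (MP z zr) _; apply: le_trans (ler_norm M) _.
    have M0 := normr_ge0 M.
    apply: (@le_trans _ _ ((1 + `|M|) * 1)); first by lra.
    by rewrite ler_wpM2l // addr_ge0.
  by apply: le_trans (HB z zr) _; rewrite ler_peMl ?expR_ge0 // lerDl.
case: H => [/limf_esup_pinfty_lt[r0 r0P]|[E2]].
  exists (Num.max r0 1), 1; split => // z; rewrite gt_max => /andP[/r0P + z1].
  rewrite lte_fin => L; rewrite mul1r; apply: le_trans (max_modulus_ub z) _.
  exact: ln_le_pow_growth.
rewrite E2 /= => /ereal_inf_lt[_ [V [r0 [_ r0V]] <-] Vb].
have [b bP] : exists b : R, forall r, r0 < r -> ln (max_modulus phi r) / r `^ 2 <= b.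
  have Sub r : r0 < r -> ((ln (max_modulus phi r) / r `^ 2)%:E <=
      ereal_sup [set (ln (max_modulus phi r) / r `^ 2)%:E | r in V])%E.
    by move=> /r0V Vr; apply: ereal_sup_ubound; exists r.
  case: (ereal_sup _) Vb Sub => [b| |] // _ Sub; first by exists b => r /Sub.
  by exists 0 => r /Sub.
exists (Num.max r0 0), `|b|; split => // z; rewrite gt_max => /andP[zr z0].
apply: le_trans (max_modulus_ub z) _.
have := bP _ zr; rewrite powR_mulrn ?(ltW z0) // ler_pdivrMr ?exprn_gt0 // => L.
have [M0|M0] := leP (max_modulus phi (normc z)) 0.
  by apply: le_trans M0 _; exact: expR_ge0.
rewrite -[leLHS]lnK ?posrE // ler_expR; apply: le_trans L _.
by rewrite ler_wpM2r ?sqr_ge0 // ler_norm.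
Qed.

(** By contraposition: a bound exp(B r^2) for large [r] gives ln ln M <= ln B + 2 ln r, hence order
    at most 2, and type at most [B] when the order is 2. [B] is first raised above 1 so that ln B >=
    0. *)
Lemma growth_unbounded :
  ~ ((growth_order phi < 2%:E)%E \/ (growth_order phi = 2%:E /\ (growth_type phi < +oo)%E)) ->
  forall B r, exists2 z, r <= normc z & expR (B * normc z ^+ 2) < normc (phi z).
Proof.
move=> H B0 r0; apply: contrapT => nz; apply: H.
pose B := `|B0| + 1; pose r1 := `|r0| + 1.
have B1 : 1 <= B by rewrite lerDr.
have r11 : 1 <= r1 by rewrite lerDr.
have HB z : r1 <= normc z -> normc (phi z) <= expR (B * normc z ^+ 2).
  move=> zr; rewrite leNgt; apply/negP => L; apply: nz; exists z.
    by apply: le_trans zr; apply: le_trans (ler_norm r0) _; rewrite lerDl.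
  apply: le_lt_trans L; rewrite ler_expR ler_wpM2r ?sqr_ge0 //.
  by apply: le_trans (ler_norm B0) _; rewrite lerDl.
have MB r : r1 <= r -> ln (max_modulus phi r) <= B * r ^+ 2.
  move=> rr; have r0' : 0 <= r by lra.
  have B20 : 0 <= B * r ^+ 2 by rewrite mulr_ge0 ?sqr_ge0 //; lra.
  have : max_modulus phi r <= expR (B * r ^+ 2).
    by apply: max_modulus_le => // z zr; rewrite -zr; apply: HB; rewrite zr.
  have [M0|M0] := leP (max_modulus phi r) 0; first by rewrite ln0.
  by rewrite -[X in X <= _ -> _]lnK ?posrE // ler_expR.
rewrite /growth_type /growth_order; case: asboolP => [_|nc]; first by left; rewrite lte_fin.
have ord2 : (limf_esup (fun r : R => (ln (ln (max_modulus phi r)) / ln r)%:E) (pinfty_nbhs R)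
    <= 2%:E)%E.
  apply/lee_addgt0Pr => e e0; rewrite -EFinD.
  (* Beyond exp(ln B / e) the constant [ln B] is at most [e * ln r]. *)
  apply: (@limf_esup_pinfty_le _ _ (Num.max r1 (expR (ln B / e)))) => r.
  rewrite gt_max => /andP[rr re].
  have rgt1 : 1 < r by lra.
  have lr : 0 < ln r by rewrite ln_gt0.
  have lB0 : 0 <= ln B by rewrite ln_ge0.
  have lBr : ln B <= e * ln r.
    rewrite mulrC -ler_pdivrMr // -(expRK (ln B / e)) ler_ln ?posrE ?expR_gt0 //; last by lra.
    exact: ltW.
  rewrite ler_pdivrMr //.
  have [M0|M0] := leP (ln (max_modulus phi r)) 0.
    by rewrite ln0 // mulr_ge0 ?(ltW lr) //; lra.
  apply: (@le_trans _ _ (ln (B * r ^+ 2))).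
    by rewrite ler_ln ?posrE ?MB ?(ltW rr) // mulr_gt0 ?exprn_gt0; lra.
  have Bp : 0 < B by lra.
  have rp : 0 < r by lra.
  by rewrite lnM ?posrE ?exprn_gt0 // lnXn //; lra.
move: (ord2); rewrite le_eqVlt => /orP[/eqP E2|]; last by left.
right; split => //; rewrite E2 /=; apply: (@le_lt_trans _ _ B%:E); last by rewrite ltry.
apply: (@limf_esup_pinfty_le _ _ r1) => r rr.
rewrite powR_mulrn; last by lra.
by rewrite ler_pdivrMr ?exprn_gt0 ?MB ?(ltW rr) //; lra.
Qed.

(** A quantitative Liouville theorem: at a point where the derivative does not vanish, Cauchy's
    estimate forces at least linear growth on discs about it. *)
Lemma liouville_growth : ~ is_constant phi -> exists z0 d, 0 < d /\
  forall r, 0 < r -> exists2 z, normc (z - z0) <= r & d * r <= normc (phi z).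
Proof.
move=> nc; have [[z0 z0P]|nz] := pselect (exists z0, D phi z0 <> 0); last first.
  exfalso; apply: nc; exists (phi 0) => z.
  have D0 u : D phi u = 0 by apply: contrapT => Du; apply: nz; exists u.
  have := @holo_mean_value R phi 0 (normc z) 0 0 z (fun u _ => Hphi u).
  rewrite !subr0 normc0 mulr0 mul0r => /(_ _ (normc_ge0 z) (lexx _)) L.
  apply/eqP; rewrite -subr_eq0 -normc_eq0 eq_le normc_ge0 andbT; apply: L.
  by move=> u _; rewrite D0 normc0.
have Dp : 0 < normc (D phi z0) by rewrite normc_gt0; apply/eqP.
exists z0, (normc (D phi z0) / 4); split; first by rewrite divr_gt0.
move=> r r0; apply: contrapT => nz.
have bound z : normc (z - z0) <= r -> normc (phi z) <= normc (D phi z0) / 4 * r.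
  by move=> zr; rewrite leNgt; apply/negP => L; apply: nz; exists z => //; exact: ltW.
have := cauchy_estimate r0 (fun u _ => Hphi u) bound (holo_cdiff (Hphi z0)).
have -> : 2 * (normc (D phi z0) / 4 * r) / r = normc (D phi z0) / 2 by field; rewrite gt_eqF.
lra.
Qed.

End Entire.

Lemma dirichlet_type_spaceP p a f : dirichlet_type_space p a f <->
  (forall z, disc z -> holo f z) /\ (energy p a (D f) (plane disc) < +oo)%E.
Proof.
have E : dirichlet_integral p a f = ((pi^-1)%:E * energy p a (D f) (plane disc))%E by [].
have pV : 0 < (pi : R)^-1 by rewrite invr_gt0 pi_gt0.
have fin : (dirichlet_integral p a f < +oo)%E <-> (energy p a (D f) (plane disc) < +oo)%E.
  rewrite E; have := energy_ge0 p a (D f) (plane disc).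
  case: (energy _ _ _ _) => [x| |] // _; first by rewrite -EFinM !ltry.
  by rewrite gt0_muley // lte_fin.
split=> -[Hf /fin Ef]; split => // z zd; first by apply/holoP; exact: Hf.
by apply/holoP; exact: Hf.
Qed.

End GrowthOrder.

(** * Necessary conditions for both inclusions *)

Section Necessity.
Variable R : realType.
Local Notation C := R[i].
Implicit Types (r e A B : R) (z w : C) (phi f g : C -> C).
Local Notation D f := (derive1 (f : C^o -> C^o)).
Local Notation disc := (@unit_disc R).

(** The pointwise bound on the derivative is of order (1 - |z|)^(-(p + 1) / p), and [K] is an
    integer above this exponent. It depends on [p] alone, since the targets have to be fixed before
    the function that reaches them. *)
Lemma bergman_polynomial_growth (p : R) : 0 < p -> exists K : nat, forall g,
  dirichlet_type_space p (p - 1) g ->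
  exists M, forall n, normc (g (dpoint R n)) <= M * 2 ^+ (K * n).
Proof.
move=> p0; pose K := (Num.truncn ((p + 1) / p)).+1.
exists K => g /dirichlet_type_spaceP[Hg Eg].
have [k k0 kP] := @bergman_growth R p (p - 1) p0.
pose E := fine (energy p (p - 1) (D g) (plane disc)).
have E0 : 0 <= E by rewrite fine_ge0 // energy_ge0.
have pn : p != 0 by rewrite gt_eqF.
have HDg z : disc z -> holo (D g) z by apply: holo_derive1_disc.
exists (normc (g 0) + 2 * (E / k) `^ p^-1) => n.
pose x : R := 1 - 2^-1 ^+ n.
have p2 : 0 < 2^-1 ^+ n :> R by rewrite exprn_gt0 // invr_gt0.
have x0 : 0 <= x by rewrite -[x]normc_dpoint normc_ge0.
have x1 : x < 1 by rewrite /x; lra.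
have DM z : normc (z - 0) <= x -> normc (D g z) <= (E / k) `^ p^-1 * 2 ^+ (K * n).
  rewrite subr0 => zx; have zd : disc z by exact: le_lt_trans zx x1.
  have d0 : 0 < 1 - normc z by rewrite subr_gt0.
  have := kP _ HDg z zd; rewrite -[X in (_ <= X)%E]fineK ?ge0_fin_numE ?energy_ge0 // lee_fin -/E.
  rewrite -mulrA -[(1 - normc z) ^+ 2]powR_mulrn ?(ltW d0) // -powRD; last first.
    by apply/implyP => _; rewrite gt_eqF.
  have -> : 2%:R + (p - 1) = p + 1 :> R by ring.
  rewrite mulrC -ler_pdivlMr // => L.
  have d2 : 2^-1 ^+ n <= 1 - normc z by rewrite /x in zx; lra.
  have L2 : normc (D g z) `^ p * (2^-1 ^+ n) `^ (p + 1) <= E / k.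
    apply: le_trans L; rewrite ler_wpM2l ?powR_ge0 //.
    by apply: ge0_ler_powR; rewrite ?nnegrE ?(ltW p2) ?(ltW d0) // addr_ge0 // ltW.
  have L3 : normc (D g z) * (2^-1 ^+ n) `^ ((p + 1) / p) <= (E / k) `^ p^-1.
    have -> : normc (D g z) * (2^-1 ^+ n) `^ ((p + 1) / p) =
        (normc (D g z) `^ p * (2^-1 ^+ n) `^ (p + 1)) `^ p^-1.
      by rewrite powRM ?powR_ge0 // -!powRrM mulfV // powRr1 ?normc_ge0.
    by apply: ge0_ler_powR; rewrite ?nnegrE ?mulr_ge0 ?powR_ge0 ?invr_ge0 ?(ltW p0) ?(ltW k0).
  have L4 : (2^-1 ^+ n) `^ K%:R <= (2^-1 ^+ n) `^ ((p + 1) / p).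
    apply: ger_powR; first by rewrite p2 exprn_ile1 ?invr_ge0 // invf_le1 // ler1n.
    by apply/ltW; rewrite /K; exact: truncnS_gt.
  rewrite powR_mulrn ?(ltW p2) // -exprM mulnC [2^-1 ^+ (K * n)]exprVn in L4.
  rewrite -ler_pdivrMr ?exprn_gt0 //; apply: le_trans L3.
  by rewrite ler_wpM2l ?normc_ge0.
have gL : normc (g (dpoint R n) - g 0) <= 2 * ((E / k) `^ p^-1 * 2 ^+ (K * n)) * normc (dpoint R n - 0).
  apply: (holo_mean_value (z0 := 0) (r := x)) => //.
  - by move=> u; rewrite subr0 => ux; apply: Hg; exact: le_lt_trans ux x1.
  - by rewrite subrr normc0.
  - by rewrite subr0 normc_dpoint.
apply: le_trans (normc_le_dist _ (g 0)) _; rewrite mulrDl lerD //.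
  by rewrite ler_peMr ?normc_ge0 // exprn_ege1 // ler1n.
apply: le_trans gL _; rewrite subr0 normc_dpoint -/x -[leRHS]mulrA.
by rewrite ler_piMr ?(ltW x1) // !mulr_ge0 ?powR_ge0 ?exprn_ge0.
Qed.

Lemma superposition_order_type phi (p : R) : 0 < p -> (forall z, holo phi z) ->
  (superposition phi @` @dirichlet_space R `<=` dirichlet_type_space p (p - 1)) ->
  (growth_order phi < 2%:E)%E \/ (growth_order phi = 2%:E /\ (growth_type phi < +oo)%E).
Proof.
move=> p0 Hphi sub; apply: contrapT => H; have big := growth_unbounded H.
have [K KP] := bergman_polynomial_growth p0.
(* From 64 (n + 1) / n^2 <= 128 / n for n >= 1. *)
pose E (n : nat) : R := 128 * n%:R^-1.
(* A factor 2^n above the growth 2^(K n) that the target space allows at [dpoint n]. *)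
pose T (n : nat) : R := 2 ^+ (K.+1 * n).
have T0 n : 0 < T n by rewrite exprn_gt0.
have nV1 n : 0 <= (n%:R : R)^-1 <= 1.
  by rewrite invr_ge0 ler0n /=; case: n => [|n]; rewrite ?invr0 // invf_le1 // ler1n.
have kernelE n : (0 < n)%N -> (energy 2 0 (D (@log_kernel R n)) (plane disc) <= (E n)%:E)%E.
  move=> n0; apply: le_trans (log_kernel_energy n (lexx 0)) _.
  rewrite lee_fin !powRr0 mulr1.
  have -> : \sum_(i < n.+1) (1 : R) ^+ i = n.+1%:R.
    by under eq_bigr do rewrite expr1n; rewrite big_const_ord iter_addr_0.
  rewrite /E -[n.+1%:R]natr1; have /andP[v0 v1] := nV1 n.
  have vn : (n%:R : R)^-1 * n%:R = 1 by rewrite mulVf // pnatr_eq0 -lt0n.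
  move: (n%:R^-1 : R) v0 v1 vn => v; move: (n%:R : R) => m v0 v1 vm.
  have -> : 64 * v ^+ 2 * (m + 1) = 64 * v * (v * m) + 64 * (v * v) by ring.
  by rewrite vm; have := ler_wpM2l v0 v1; lra.
have E_ge n : 1 * n%:R^-1 ^+ 2 <= E n.
  by rewrite mul1r /E expr2; have /andP[v0 v1] := nV1 n; have := ler_wpM2l v0 v1; lra.
have Q_open n w : 2 * T n <= normc (phi w) ->
    exists2 d, 0 < d & forall w', normc (w' - w) <= d -> T n <= normc (phi w').
  move=> Qw; have [d d0 dP] := cdiff_continuous (holo_cdiff (Hphi w)) (T0 n).
  exists (d / 2) => [|w' ww']; first by rewrite divr_gt0.
  have := dP (w' - w); rewrite [w + _]addrC subrK => /(_ _) L.
  have {}L : normc (phi w' - phi w) < T n by apply: L; lra.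
  by have := normc_le_dist (phi w) (phi w'); rewrite normc_distC; lra.
have Q_target e N : 0 < e -> exists n w, [/\ (N < n)%N, 1 <= normc w,
    normc w ^+ 2 * E n <= e & 2 * T n <= normc (phi w)].
  (* The index [n] will be just large enough for the cost 128 |w|^2 / n to be at most [e], so it is
     at most (128 / e + 1 + N) |w|^2. [B] is chosen beforehand so that B |w|^2 >= (K + 1) n + 1 for
     every such [n]. *)
  move=> e0; pose B : R := K.+1%:R * (128 / e + 1 + N%:R) + 1.
  have [w w1 wB] := big B 1.
  pose r2 := normc w ^+ 2; have r21 : 1 <= r2 by rewrite exprn_ege1.
  have x0 : 0 <= 128 * r2 / e by rewrite !mulr_ge0 ?invr_ge0 ?(ltW e0) //; lra.
  pose n := ((Num.truncn (128 * r2 / e)).+1 + N)%N.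
  have nl : 128 * r2 / e <= n%:R.
    by rewrite natrD; have := truncnS_gt (128 * r2 / e); have := ler0n R N; lra.
  have nu : n%:R <= (128 / e + 1 + N%:R) * r2.
    have /andP[tl _] := truncn_itv x0; rewrite natrD -[(Num.truncn _).+1%:R]natr1.
    rewrite [leRHS]mulrDl [(128 / e + 1) * r2]mulrDl mul1r.
    rewrite [128 / e * r2]mulrAC !lerD //.
    by rewrite -[leLHS]mulr1 ler_wpM2l.
  exists n, w; split => //.
  - by rewrite /n addSn ltnS leq_addl.
  - have n0 : 0 < n%:R :> R by rewrite ltr0n.
    rewrite /E mulrA ler_pdivrMr // mulrC [e * _]mulrC -ler_pdivrMr //.
  - apply: le_trans (ltW wB); rewrite -exprS.
    have e2 : 2 <= expR 1 :> R by have := expR_ge1Dx (1 : R); lra.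
    apply: (@le_trans _ _ (expR 1 ^+ (K.+1 * n).+1)).
      by apply: lerXn2r; rewrite ?nnegrE ?expR_ge0.
    rewrite -expRM_natl mulr1 ler_expR -natr1 natrM -/r2 /B mulrDl mul1r lerD //.
    by rewrite -mulrA ler_wpM2l.
have [f [Hf Ef fT]] := gliding_hump (lexx 0) ltr01 kernelE E_ge Q_open Q_target.
have /KP[M MP] : dirichlet_type_space p (p - 1) (superposition phi f).
  by apply: sub; exists f => //; apply/dirichlet_type_spaceP.
have [n Nn nT] := fT (Num.truncn M).+1.
have M1 : M < n%:R by apply: lt_le_trans (truncnS_gt M) _; rewrite ler_nat.
have n2 : n%:R < 2 ^+ n :> R by rewrite -natrX ltr_nat ltn_expl.
have := le_trans nT (MP n); rewrite /T mulSn exprD ler_pM2r ?exprn_gt0 //.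
lra.
Qed.

Lemma superposition_constant phi (p : R) : 0 < p -> (forall z, holo phi z) ->
  (superposition phi @` dirichlet_type_space p (p - 1) `<=` @dirichlet_space R) ->
  is_constant phi.
Proof.
move=> p0 Hphi sub; apply: contrapT => H; have [z0 [d [d0 dP]]] := liouville_growth Hphi H.
(* A positive [c] within the range [c < 1], [c * p <= 2] of the embedding. *)
pose c := Num.min 2^-1 (2 / p).
have c0 : 0 < c by rewrite lt_min invr_gt0 ltr0n divr_gt0.
have c1 : c < 1.
  have : c <= 2^-1 by rewrite ge_min lexx.
  by lra.
have cp : c * p <= 2 by rewrite -ler_pdivlMr // ge_min lexx orbT.
pose q : R := 2^-1 `^ c.
have q0 : 0 <= q by exact: powR_ge0.
have q1 : q < 1.
  have : q < 1 `^ c.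
    by apply: gt0_ltr_powR; rewrite ?nnegrE ?invr_ge0 // invf_lt1 // ltr1n.
  by rewrite powR1.
have q10 : 0 < 1 - q by rewrite subr_gt0.
pose K1 := 64 * 4 `^ c / (1 - q).
have K10 : 0 < K1 by rewrite !mulr_gt0 ?powR_gt0 ?invr_gt0.
pose E (n : nat) : R := K1 * n%:R^-1 ^+ 2.
(* The squared modulus 2 n at [dpoint n] exceeds B + n, the growth in the Dirichlet space with
   [e = 1], as soon as n > B. *)
pose s (n : nat) : R := Num.sqrt (2 * n%:R).
have s0 n : 0 <= s n by exact: sqrtr_ge0.
have s2 n : s n ^+ 2 = 2 * n%:R by rewrite sqr_sqrtr // mulr_ge0.
have kernelE n : (0 < n)%N -> (energy 2 c (D (@log_kernel R n)) (plane disc) <= (E n)%:E)%E.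
  move=> n0; apply: le_trans (log_kernel_energy n (ltW c0)) _.
  rewrite lee_fin -/q.
  have -> : E n = 64 * 4 `^ c * n%:R^-1 ^+ 2 / (1 - q) by rewrite /E /K1 mulrAC.
  rewrite ler_wpM2l ?mulr_ge0 ?powR_ge0 ?sqr_ge0 // -[leRHS]div1r ler_pdivlMr // mulrC.
  have := subrX1 q n.+1; rewrite -[q - 1]opprB mulNr => /(congr1 -%R).
  by rewrite opprK => <-; rewrite opprB gerBl exprn_ge0.
have Q_open n w : s n + 1 <= normc (phi w) ->
    exists2 d, 0 < d & forall w', normc (w' - w) <= d -> s n <= normc (phi w').
  move=> Qw; have [e e0 eP] := cdiff_continuous (holo_cdiff (Hphi w)) ltr01.
  exists (e / 2) => [|w' ww']; first by rewrite divr_gt0.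
  have := eP (w' - w); rewrite [w + _]addrC subrK => /(_ _) L.
  have {}L : normc (phi w' - phi w) < 1 by apply: L; lra.
  by have := normc_le_dist (phi w) (phi w'); rewrite normc_distC; lra.
have Q_target e N : 0 < e -> exists n w, [/\ (N < n)%N, 1 <= normc w,
    normc w ^+ 2 * E n <= e & s n + 1 <= normc (phi w)].
  (* A point whose value exceeds [M] lies outside the unit disc; this is how [1 <= normc w] is
     obtained. *)
  move=> e0; have [M MP] := entire_bounded Hphi 1.
  (* From |w| <= |z0| + (s n + 1) / d and (s n + 1)^2 <= 6 n one gets |w|^2 <= A n, so the cost of
     the hump is at most A K1 / n. *)
  pose A := 2 * normc z0 ^+ 2 + 12 / d ^+ 2.
  have A0 : 0 <= A by apply: addr_ge0; apply: mulr_ge0; rewrite ?invr_ge0 ?sqr_ge0.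
  pose n := ((Num.truncn (M ^+ 2)).+1 + (Num.truncn (A * K1 / e)).+1 + N)%N.
  have nM : M ^+ 2 < n%:R.
    apply: lt_le_trans (truncnS_gt _) _; rewrite ler_nat /n -addnA leq_addr //.
  have nA : A * K1 / e < n%:R.
    apply: lt_le_trans (truncnS_gt _) _; rewrite ler_nat /n addnAC leq_addl //.
  have nN : (N < n)%N by rewrite /n !addSn ltnS leq_addl.
  have n1 : 1 <= n%:R :> R by rewrite ler1n (leq_trans _ nN).
  have n0 : 0 < n%:R :> R by lra.
  have sd : 0 < (s n + 1) / d by rewrite divr_gt0 // ltr_wpDl.
  have [w wr wphi] := dP _ sd.
  rewrite mulrC divfK ?gt_eqF // in wphi.
  have sM : M <= s n.
    have [M0|M0] := leP M 0; first exact: le_trans M0 _.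
    by rewrite -ler_sqr ?nnegrE ?(ltW M0) // s2; lra.
  have w1 : 1 <= normc w.
    rewrite leNgt; apply/negP => w1; have := MP w (ltW w1); lra.
  exists n, w; split => //.
  have wA : normc w ^+ 2 <= A * n%:R.
    have h1 : normc w <= normc z0 + (s n + 1) / d by apply: le_trans (normc_le_dist w z0) _; rewrite lerD2l.
    have h2 : normc w ^+ 2 <= (normc z0 + (s n + 1) / d) ^+ 2.
      by rewrite ler_sqr ?nnegrE ?normc_ge0 // addr_ge0 ?normc_ge0 // ltW.
    have h3 : ((s n + 1) / d) ^+ 2 <= 6 * n%:R / d ^+ 2.
      rewrite expr_div_n ler_wpM2r ?invr_ge0 ?sqr_ge0 //.
      by have := s2 n; have := sqr_ge0 (s n - 1); lra.
    have h4 := sqr_ge0 (normc z0 - (s n + 1) / d).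
    have h5 : normc z0 ^+ 2 <= normc z0 ^+ 2 * n%:R by rewrite ler_peMr ?sqr_ge0.
    have -> : A * n%:R = 2 * (normc z0 ^+ 2 * n%:R) + 2 * (6 * n%:R / d ^+ 2) by rewrite /A; ring.
    lra.
  have E0 : 0 <= E n by rewrite mulr_ge0 ?sqr_ge0 // ltW.
  apply: le_trans (ler_wpM2r E0 wA) _.
  have -> : A * n%:R * E n = A * K1 / n%:R by rewrite /E; field; rewrite gt_eqF.
  by rewrite ler_pdivrMr // [e * _]mulrC -ler_pdivrMr // ltW.
have [f [Hf Ef fT]] := gliding_hump (ltW c0) K10 kernelE (fun n => lexx _) Q_open Q_target.
have /dirichlet_type_spaceP[Hg Eg] : @dirichlet_space R (superposition phi f).
  apply: sub; exists f => //; apply/dirichlet_type_spaceP; split; first exact: Hf.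
  apply: (dirichlet_embedding p0 (ltW c0) c1 cp) => // z zd.
  exact: holo_derive1_disc.
have [B BP] := dirichlet_growth Hg Eg ltr01.
have [n Nn nT] := fT (Num.truncn B).+1.
have B1 : B < n%:R by apply: lt_le_trans (truncnS_gt B) _; rewrite ler_nat.
have := BP n (dpoint R n); rewrite normc_dpoint lexx mul1r => /(_ isT).
have : s n ^+ 2 <= normc (phi (f (dpoint R n))) ^+ 2 by rewrite ler_sqr ?nnegrE ?normc_ge0.
rewrite s2 /superposition /=; lra.
Qed.

End Necessity.

(** * Sufficient conditions for both inclusions *)

Section Sufficiency.
Variable R : realType.
Local Notation C := R[i].
Local Notation D f := (derive1 (f : C^o -> C^o)).
Local Notation disc := (@unit_disc R).

Lemma superposition_dirichlet (phi : C -> C) (p : R) : 0 < p -> (forall z, holo phi z) ->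
  (growth_order phi < 2%:E)%E \/ (growth_order phi = 2%:E /\ (growth_type phi < +oo)%E) ->
  superposition phi @` @dirichlet_space R `<=` dirichlet_type_space p (p - 1).
Proof.
move=> p0 Hphi H; have [A [B [A0 B0 AB]]] := growth_bound Hphi H; move=> _ [f /dirichlet_type_spaceP[Hf Ef] <-].
pose c := Num.min 2^-1 (2 / p).
have c0 : 0 < c by rewrite lt_min invr_gt0 ltr0n divr_gt0.
have c1 : c < 1.
  have : c <= 2^-1 by rewrite ge_min lexx.
  by lra.
have cp : c * p <= 2 by rewrite -ler_pdivlMr // ge_min lexx orbT.
have Hg z : disc z -> holo (superposition phi f) z.
  by move=> zd; have [] := comp_holo (Hf z zd) (Hphi (f z)).
apply/dirichlet_type_spaceP; split; first exact: Hg.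
apply: (dirichlet_embedding p0 (ltW c0) c1 cp) => [z zd|]; first exact: holo_derive1_disc.
exact: (superposition_finite_type Hphi A0 B0).
Qed.

Lemma superposition_of_constant (phi : C -> C) (X : set (C -> C)) : is_constant phi ->
  superposition phi @` X `<=` @dirichlet_space R.
Proof.
move=> [c phic] _ [f _ <-]; have -> : superposition phi f = fun=> c by apply/funext => z; exact: phic.
apply/dirichlet_type_spaceP; split; first by move=> z _; exists 0; exact: cdiff_cst.
rewrite /energy (eq_integral (cst 0%E)) ?integral0 // => w _.
by rewrite /wdens (cdiff_derive1 (cdiff_cst c _)) normc0 powR0 ?mulr0.
Qed.

End Sufficiency.

Theorem theorem3 (R : realType) (phi : R[i] -> R[i]) (p : R)
    (phi_entire : entire phi) (p_gt0 : 0 < p) :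
  ((superposition phi @` @dirichlet_space R `<=` dirichlet_type_space p (p - 1))
     <-> ((growth_order phi < 2%:E)%E \/
          (growth_order phi = 2%:E /\ (growth_type phi < +oo)%E)))
  /\
  ((superposition phi @` dirichlet_type_space p (p - 1) `<=` @dirichlet_space R)
     <-> is_constant phi).
Proof.
have Hphi z : holo phi z by apply/holoP; exact: phi_entire.
split; split.
- exact: superposition_order_type.
- exact: superposition_dirichlet.
- exact: superposition_constant p_gt0 Hphi.
- exact: superposition_of_constant.
Qed.
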